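(* Let $\gamma_1,\gamma_2\in(1,2)$ with $\gamma_1<\gamma_2$, and suppose that $\lambda_\rho\to\infty$ and $\lambda_\rho\rho^{\gamma_1+\gamma_2}\to\infty$ as $\rho\to0$. Then, as $\rho\to0$, the random field $$\left(\frac{\widetilde J_\rho(\mu)}{\sqrt{\lambda_\rho\rho^{\gamma_1+\gamma_2}}}\right)_{\mu\in\mathcal M^{\gamma_1,\gamma_2}}$$ converges in finite-dimensional distributions to $(Z(\mu))_{\mu\in\mathcal M^{\gamma_1,\gamma_2}}$, where $Z$ is the centred Gaussian linear random field with covariance function $$C_Z(\mu,\nu)=\int_{\mathbb R^2\times\mathbb R_+^2}\mu(B(x,u))\,\nu(B(x,u))\,\frac{1}{u_1^{\gamma_1+1}}\frac{1}{u_2^{\gamma_2+1}}\,\mathrm d(x,u).$$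
   Context: $\mathbb R_+=(0,\infty)$. For $x\in\mathbb R^2$, $u\in\mathbb R_+^2$, $B(x,u)=[x_1-\frac{u_1}{2},x_1+\frac{u_1}{2}]\times[x_2-\frac{u_2}{2},x_2+\frac{u_2}{2}]$ is the rectangle with centre $x$ and edge lengths $u_1,u_2$. Standing assumptions: $\gamma_1\in(1,2)$, $\gamma_1<\gamma_2$. $F$ is a probability measure on $\mathbb R_+^2$ of the form $F(\mathrm du)=f_1(u_1)f_2(u_2)\,\mathrm du_1\,\mathrm du_2$, where $f_1,f_2\ge0$ are measurable and $f_i(u_i)\sim u_i^{-\gamma_i-1}$ as $u_i\to\infty$ for $i=1,2$ ($f\sim g$ means $f/g\to1$), and $\int_{\mathbb R_+}u_if_i(u_i)\,\mathrm du_i<\infty$. For $\rho>0$, $F_\rho$ is the image measure of $F$ under $u\mapsto\rho u$, and $\lambda_\rho=\lambda(\rho)>0$ is a given function of $\rho$. $\mathcal M_2$ is the linear space of signed measures $\mu$ on $\mathbb R^2$ with finite total variation. Let $N_\rho$ be a Poisson random measure on $\mathbb R^2\times\mathbb R_+^2$ with intensity measure $\lambda_\rho\,\mathrm dx\,F_\rho(\mathrm du)$. For $\mu\in\mathcal M_2$ put $J_\rho(\mu)=\int_{\mathbb R^2\times\mathbb R_+^2}\mu(B(x,u))\,N_\rho(\mathrm dx,\mathrm du)$ and $\widetilde J_\rho(\mu)=J_\rho(\mu)-\mathbb E J_\rho(\mu)$. $\mathcal M^{\gamma_1,\gamma_2}$ is the set of all $\mu\in\mathcal M_2$ for which there exist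 constants $C>0$ and $\alpha_1,\alpha_2$ with $\gamma_i<\alpha_i\le2$ for $i=1,2$ such that for all $u\in\mathbb R_+^2$ $$\int_{\mathbb R^2}\mu(B(x,u))^2\,\mathrm dx\le C\min(u_1,u_1^{\alpha_1})\min(u_2,u_2^{\alpha_2}).$$ A random field $W$ indexed by a linear space of measures is linear if $W(a\mu+b\nu)=aW(\mu)+bW(\nu)$ almost surely for all $a,b\in\mathbb R$ and all $\mu,\nu$. *)

(* Defs.v *)
From HB Require Import structures.
From mathcomp Require Import all_boot all_order all_algebra.
From mathcomp Require Import all_classical all_reals all_analysis.
From mathcomp Require Import measurable_realfun.

Set Implicit Arguments.
Unset Strict Implicit.
Unset Printing Implicit Defensive.

Import Order.TTheory GRing.Theory Num.Theory.
Import numFieldNormedType.Exports.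

Local Open Scope classical_set_scope.
Local Open Scope ring_scope.

Notation plane R := (measurableTypeR R * measurableTypeR R)%type.

(* Charges are finite on all measurable sets, hence (Hahn decomposition) they
   are exactly the signed measures of finite total variation. *)
Notation signed_measure R := ({charge set (plane R) -> \bar R})%R.

Definition leb2 {R : realType} : set (plane R) -> \bar R :=
  (@lebesgue_measure R \x @lebesgue_measure R)%E.

(* Declared on [leb2] itself: on a bare product, sigma-finiteness is inferred
   only for subprobabilities. *)
Section leb2_instances.
Context {R : realType}.
Local Open Scope ereal_scope.

Let leb2_0 : @leb2 R set0 = 0.
Proof. exact: measure0. Qed.

Let leb2_ge0 A : 0 <= @leb2 R A.
Proof. exact: measure_ge0. Qed.

Let leb2_sigma_additive : semi_sigma_additive (@leb2 R).
Proof. exact: measure_semi_sigma_additive. Qed.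

HB.instance Definition _ := isMeasure.Build _ _ _ (@leb2 R)
  leb2_0 leb2_ge0 leb2_sigma_additive.

Let leb2_sigma_finite : sigma_finite setT (@leb2 R).
Proof.
have /sigma_finiteP[F [TF ndF Foo]] := sigma_finiteT (@lebesgue_measure R).
exists (fun n => F n `*` F n).
  rewrite -setXTT TF predeqE => -[x y]; split.
    move=> [/= [n _ Fnx] [k _ Fky]]; exists (maxn n k) => //; split.
    - by move: x Fnx; exact/subsetPset/ndF/leq_maxl.
    - by move: y Fky; exact/subsetPset/ndF/leq_maxr.
  by move=> [n _ []/= ? ?]; split; exists n.
move=> k; have [mF Fk] := Foo k; split; first exact: measurableX.
rewrite /leb2 product_measure1E//.
by apply: lte_mul_pinfty => //; rewrite ge0_fin_numE.
Qed.

HB.instance Definition _ := Measure_isSigmaFinite.Build _ _ _ (@leb2 R)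
  leb2_sigma_finite.

End leb2_instances.

Definition quadrant {R : realType} : set (plane R) :=
  [set u | 0 < u.1 /\ 0 < u.2].

(* R^2 x (0,oo)^2, the set of (centre, edge lengths) *)
Definition rectangles {R : realType} : set (plane R * plane R) :=
  [set: plane R] `*` quadrant.

Definition B {R : realType} (x u : plane R) : set (plane R) :=
  `[(x.1 : R) - u.1 / 2, (x.1 : R) + u.1 / 2] `*`
  `[(x.2 : R) - u.2 / 2, (x.2 : R) + u.2 / 2].

Section edge_lengths.
Context {R : realType}.

Definition edge_density (gamma : R) (f : R -> R) : Prop :=
  [/\ measurable_fun (`]0%R, +oo[ : set (measurableTypeR R)) f,
      forall u, 0 < u -> 0 <= f u,
      f u / u `^ (- gamma - 1) @[u --> +oo] --> (1 : R) &
      (\int[lebesgue_measure]_(u in `]0%R, +oo[) (u * f u)%:E < +oo)%E].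

(* The law F on (0,oo)^2 is extended by 0 to the whole plane. *)
Definition has_product_density (F : set (plane R) -> \bar R)
    (f1 f2 : R -> R) : Prop :=
  forall A, measurable A ->
    F A = (\int[leb2]_(u in A `&` quadrant) (f1 u.1 * f2 u.2)%:E)%E.

Definition rescaled (F : set (plane R) -> \bar R) (rho : R) :
    set (plane R) -> \bar R :=
  pushforward F (fun u : plane R => (rho * u.1, rho * u.2) : plane R).

Definition intensity (l : R) (F : set (plane R) -> \bar R) (rho : R)
    (A : set (plane R * plane R)) : \bar R :=
  (l%:E * (leb2 \x rescaled F rho) A)%E.

End edge_lengths.

Section poisson_random_measure.
Context {R : realType} d (Omega : measurableType d) (P : probability Omega R).
Local Open Scope ereal_scope.

Definition mutually_independent (n : nat) (X : 'I_n -> Omega -> \bar R) :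
    Prop :=
  forall E : 'I_n -> set (\bar R), (forall i, measurable (E i)) ->
    P (\bigcap_(i in [set: 'I_n]) (X i @^-1` E i)) =
    \prod_(i < n) P (X i @^-1` E i).

(* The Poisson probabilities are written out because the library's
   [poisson_pmf] is identically 1 at rate 0, whereas rate 0 must give the
   Dirac mass at 0 (here 0 ^+ 0 = 1). *)
Definition poisson_random_measure d' (T : measurableType d')
    (m : set T -> \bar R) (N : Omega -> {measure set T -> \bar R}) : Prop :=
  [/\ forall A, measurable A -> measurable_fun [set: Omega] (fun w => N w A),
      forall A, measurable A -> m A < +oo -> forall k : nat,
        P [set w | N w A = k%:R%:E] =
        ((fine (m A)) ^+ k / k`!%:R * expR (- fine (m A)))%:E,
      forall A, measurable A -> m A = +oo -> {ae P, forall w, N w A = +oo} &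
      forall (n : nat) (A : 'I_n -> set T), (forall i, measurable (A i)) ->
        trivIset [set: 'I_n] A ->
        mutually_independent (fun i w => N w (A i))].

End poisson_random_measure.

Section field.
Context {R : realType} d (Omega : measurableType d) (P : probability Omega R).

Definition J (N : Omega -> {measure set (plane R * plane R) -> \bar R})
    (mu : signed_measure R) (w : Omega) : R :=
  fine (\int[N w]_(z in rectangles) mu (B z.1 z.2))%E.

Definition J_centred (N : Omega -> {measure set (plane R * plane R) -> \bar R})
    (mu : signed_measure R) (w : Omega) : R :=
  J N mu w - fine 'E_P[J N mu].

End field.

Section index_space.
Context {R : realType}.

Definition M (gamma1 gamma2 : R) : set (signed_measure R) :=
  [set mu | exists C alpha1 alpha2 : R,
    [/\ 0 < C, gamma1 < alpha1 <= 2, gamma2 < alpha2 <= 2 &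
      forall u, quadrant u ->
        (\int[leb2]_x ((mu (B x u)) ^+ 2) <=
         (C * Num.min u.1 (u.1 `^ alpha1) * Num.min u.2 (u.2 `^ alpha2))%:E)%E]].

Definition C_Z_integrand (gamma1 gamma2 : R) (mu nu : signed_measure R)
    (z : plane R * plane R) : \bar R :=
  (mu (B z.1 z.2) * nu (B z.1 z.2) *
    (1 / z.2.1 `^ (gamma1 + 1) * (1 / z.2.2 `^ (gamma2 + 1)))%:E)%E.

Definition C_Z (gamma1 gamma2 : R) (mu nu : signed_measure R) : \bar R :=
  (\int[leb2 \x leb2]_(z in rectangles) C_Z_integrand gamma1 gamma2 mu nu z)%E.

End index_space.

Section gaussian.
Context {R : realType} d (Omega : measurableType d) (P : probability Omega R).

(* Degenerate laws are Gaussian; they are treated apart because the library's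
   [normal_prob m 0] is the uniform law on [0, 1]. *)
Definition gaussian (X : Omega -> R) : Prop :=
  exists m s : R, 0 <= s /\
    forall A : set (R), measurable A ->
      P (X @^-1` A) = if s == 0 then \d_(m : measurableTypeR R) A
                      else normal_prob m s A.

Definition gaussian_field (T : Type) (D : set T) (Z : T -> Omega -> R) : Prop :=
  forall (n : nat) (t : 'I_n -> T) (a : 'I_n -> R), (forall i, D (t i)) ->
    gaussian (fun w => \sum_(i < n) a i * Z (t i) w).

Definition linear_field (D : set (signed_measure R))
    (W : signed_measure R -> Omega -> R) : Prop :=
  forall (a b : R) (mu nu : signed_measure R), D mu -> D nu ->
    {ae P, forall w,
      W (cadd (cscale a mu) (cscale b nu)) w = a * W mu w + b * W nu w}.

End gaussian.

Section convergence.
Context {R : realType}.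
Context (dO : R -> measure_display) (Omega : forall rho, measurableType (dO rho))
  (P : forall rho, probability (Omega rho) R).
Context d' (Omega' : measurableType d') (P' : probability Omega' R).

Definition cvg_in_distribution (n : nat) (X : forall rho, Omega rho -> 'rV[R]_n)
    (F : set_system R) (Y : Omega' -> 'rV[R]_n) : Prop :=
  forall g : 'rV[R]_n -> R, continuous g ->
    (exists K, forall v, `|g v| <= K) ->
    ('E_(P rho)[(g \o X rho)] @[rho --> F] --> 'E_P'[(g \o Y)])%E.

Definition cvg_fdd (T : Type) (D : set T) (W : forall rho, T -> Omega rho -> R)
    (F : set_system R) (Z : T -> Omega' -> R) : Prop :=
  forall (n : nat) (t : 'I_n -> T), (forall i, D (t i)) ->
    cvg_in_distribution (fun rho w => \row_(i < n) W rho (t i) w) F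
      (fun w => \row_(i < n) Z (t i) w).

End convergence.

(* Main.v *)
Require Import Defs.
From HB Require Import structures.
From mathcomp Require Import all_boot all_order all_algebra.
From mathcomp Require Import all_classical all_reals all_analysis.
From mathcomp Require Import measurable_realfun ring lra.

Set Implicit Arguments.
Unset Strict Implicit.
Unset Printing Implicit Defensive.

Import Order.TTheory GRing.Theory Num.Theory.
Import numFieldNormedType.Exports.

Local Open Scope classical_set_scope.
Local Open Scope ring_scope.

(** The theorem is proved with exponential moments.  Let f(x,u) = mu(B(x,u)), a
    bounded function that is integrable for the intensity m because edges have
    finite mean length, and let s = sqrt(lambda rho^(gamma1+gamma2)), which tends
    to infinity.  For a Poisson random measure N of intensity m,
    E exp(int f dN) = exp(int (e^f - 1) dm) ([poisson_mgf]), so the centred and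
    normalised field has exponential moment
    exp(int (e^(f/s) - 1 - f/s) dm).  By Taylor's formula this exponent is
    q/2 (1 + O(1/s)) with q = s^-2 int f^2 dm ([compensated_exponent_bound]).

    With H(u) = int mu(B(x,u))^2 dx, Tonelli's theorem gives
    q = rho^(-gamma1-gamma2) int H(rho u) f1(u1) f2(u2) du.  After the change of
    variables v = rho u the edge density, suitably normalised, tends to
    v1^(-gamma1-1) v2^(-gamma2-1).  The bound on H that defines the index space is
    an integrable majorant for large edges and shows that edges below a fixed
    length contribute nothing in the limit.  Hence q tends to C_Z(mu,mu)
    ([density_limit]), and the exponential moment tends to exp(C_Z(mu,mu)/2), that
    of Z(mu) ([J_centred_mgf_cvg], [gaussian_mgf]).

    The index space is a linear space, and both fields are linear on it up to null
    sets.  So E exp(a.X_rho) converges to E exp(a.Y) for the vectors X_rho and Y of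
    any finite number of coordinates and all real vectors a.

    It remains to pass from exponential moments to bounded continuous functions
    ([mean_cvg_bounded_continuous]).  A function that can be approximated, relative
    to the weight exp(c|x|), by functions with convergent means has convergent
    means itself.  This yields x^j exp(tx) from difference quotients in t, hence
    polynomials, hence sines and cosines from their Taylor series, and finally all
    bounded continuous functions, because trigonometric polynomials are dense in
    this weighted sense ([trig_dense]): on a box one takes Bernstein polynomials in
    the variables sin(x_i / L), and outside the box the weight dominates. *)

(** * Exponential series and convergence of means *)

Lemma integrable_scale (R : realType) d (T : measurableType d)
    (mu : {measure set T -> \bar R}) (c : R) (g : T -> R) :
  mu.-integrable setT (EFin \o g) -> mu.-integrable setT (EFin \o (fun x => c * g x)).
Proof.
move=> ig; rewrite (_ : _ \o _ = fun x => (c%:E * (EFin \o g) x)%E)//.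
exact: integrableZl.
Qed.

Section exponential_series.
Context {R : realType}.
Implicit Types (x y : R) (J : nat).

Lemma fact_mul_le (j k : nat) : (j`! * k`! <= (j + k)`!)%N.
Proof. by rewrite -(bin_fact (leq_addr k j)) addKn leq_pmull // bin_gt0 leq_addr. Qed.

Lemma exp_series_le x n : 0 <= x -> series (exp_coeff x) n <= expR x.
Proof.
move=> x0; rewrite /expR; apply: nondecreasing_cvgn_le.
  apply/nondecreasing_seqP => k; rewrite /series /= big_nat_recr //= lerDl.
  exact: exp_coeff_ge0.
exact: is_cvg_series_exp_coeff.
Qed.

(** The exponential series dominates the sine and cosine series termwise, so one
    estimate of the remainder serves all three. *)
Lemma exp_tail (a : R^nat) x l J :
  (forall j, `|a j| <= `|x| ^+ j / j`!%:R) -> series a @ \oo --> l ->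
  `|l - series a J| <= `|x| ^+ J / J`!%:R * expR `|x|.
Proof.
move=> ha cvga.
have c : `|series a (n + J)%N - series a J| @[n --> \oo] --> `|l - series a J|.
  apply: cvg_norm; apply: cvgB; last exact: cvg_cst.
  by rewrite (cvg_shiftn J (series a)).
apply: (cvgr_to_le c); near=> n.
rewrite series_addn addrAC subrr add0r.
apply: (@le_trans _ _ (\sum_(J <= k < n + J) `|x| ^+ k / k`!%:R)).
  by apply: (le_trans (ler_norm_sum _ _ _)); apply: ler_sum => i _; exact: ha.
rewrite -{1}(add0n J) big_addn addnK.
apply: (@le_trans _ _ (\sum_(0 <= i < n) `|x| ^+ J / J`!%:R * exp_coeff `|x| i)).
  apply: ler_sum => i _.
  have -> : `|x| ^+ J / J`!%:R * exp_coeff `|x| i =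
      `|x| ^+ (i + J) / (i`! * J`!)%:R.
    by rewrite /exp_coeff /= exprD natrM invfM; ring.
  rewrite ler_wpM2l ?exprn_ge0// lef_pV2 ?posrE ?ltr0n ?muln_gt0 ?fact_gt0//.
  by rewrite ler_nat fact_mul_le.
rewrite -mulr_sumr ler_wpM2l ?divr_ge0 ?exprn_ge0//.
exact: exp_series_le.
Unshelve. all: by end_near. Qed.

Lemma pow_le_exp x J : `|x| ^+ J <= J`!%:R * expR `|x|.
Proof.
rewrite -ler_pdivrMl ?ltr0n ?fact_gt0// mulrC.
have := @exp_series_le `|x| J.+1 (normr_ge0 _).
rewrite /series /= big_nat_recr //= => /(le_trans _); apply.
rewrite {2}/exp_coeff /= lerDr sumr_ge0// => i _.
by rewrite exp_coeff_ge0.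
Qed.

Lemma exp_taylor x J :
  `|expR x - \sum_(0 <= j < J) x ^+ j / j`!%:R| <= `|x| ^+ J / J`!%:R * expR `|x|.
Proof.
apply: (@exp_tail (exp_coeff x)) => [j|]; last exact: is_cvg_series_exp_coeff.
by rewrite /exp_coeff /= normrM normrX normfV normr_nat.
Qed.

Lemma exp_taylor1 x : `|expR x - 1| <= `|x| * expR `|x|.
Proof. by have := exp_taylor x 1; rewrite big_nat1 expr0 !divr1. Qed.

Lemma exp_taylor2 x : `|expR x - 1 - x| <= `|x| ^+ 2 * expR `|x|.
Proof.
have := exp_taylor x 2.
rewrite big_nat_recr//= big_nat1 expr0 !divr1 expr1 opprD addrA => /le_trans; apply.
by rewrite ler_wpM2r ?expR_ge0// ler_piMr ?exprn_ge0// invf_le1 ?ltr0n ?fact_gt0// ler1n fact_gt0.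
Qed.

Lemma exp_taylor3 x :
  `|expR x - 1 - x - x ^+ 2 / 2| <= `|x| ^+ 3 * expR `|x|.
Proof.
have := exp_taylor x 3.
rewrite !big_nat_recr//= big_geq// add0r expr0 !divr1 expr1 !opprD !addrA => /le_trans; apply.
by rewrite ler_wpM2r ?expR_ge0// ler_piMr ?exprn_ge0// invf_le1 ?ltr0n ?fact_gt0// ler1n fact_gt0.
Qed.

Lemma cvg_series_cos x : series (cos_coeff x) @ \oo --> cos x.
Proof. by rewrite unlock; exact: is_cvg_series_cos_coeff. Qed.

Lemma cvg_series_sin x : series (sin_coeff x) @ \oo --> sin x.
Proof. by rewrite unlock; exact: is_cvg_series_sin_coeff. Qed.

Lemma cos_tail x J :
  `|cos x - series (cos_coeff x) J| <= `|x| ^+ J / J`!%:R * expR `|x|.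
Proof.
apply: (@exp_tail (cos_coeff x) x) => [j|]; last exact: cvg_series_cos.
rewrite /cos_coeff.
rewrite /= !normrM normfV !normr_nat !normrX normrN normr1 expr1n mulr1.
by case: odd; rewrite /= ?mul0r ?mul1r ?divr_ge0 ?exprn_ge0.
Qed.

Lemma sin_tail x J :
  `|sin x - series (sin_coeff x) J| <= `|x| ^+ J / J`!%:R * expR `|x|.
Proof.
apply: (@exp_tail (sin_coeff x) x) => [j|]; last exact: cvg_series_sin.
rewrite /sin_coeff.
rewrite /= !normrM normfV !normr_nat !normrX normrN normr1 expr1n mulr1.
by case: odd; rewrite /= ?mul0r ?mul1r ?divr_ge0 ?exprn_ge0.
Qed.

(** A smooth substitute for exp(c|x|): being a sum of two exponentials, it has a
    convergent mean as soon as exponential moments converge. *)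
Definition expw (c x : R) := expR (c * x) + expR (- (c * x)).

Lemma expw_ge1 c x : expR (c * `|x|) <= expw c x.
Proof.
rewrite /expw; case: (ler0P x) => x0.
  by rewrite mulrN lerDr expR_ge0.
by rewrite lerDl expR_ge0.
Qed.

End exponential_series.

Section mean_convergence.
Context {R : realType} (I : Type) (G : set_system I) {FG : ProperFilter G}.
Context (dO : I -> measure_display) (Omega : forall i, measurableType (dO i)).
Context (P : forall i, probability (Omega i) R).
Context d' (Omega' : measurableType d') (P' : probability Omega' R).

(** Probability spaces vary with the index, so only means can be compared.
    Integrability is included to make the real-valued integral meaningful. *)
Definition mean_cvg (X : forall i, Omega i -> R) (X' : Omega' -> R) : Prop :=
  [/\ forall i, (P i).-integrable setT (EFin \o X i),
      P'.-integrable setT (EFin \o X') &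
      (\int[P i]_w X i w) @[i --> G] --> \int[P']_w X' w].

Lemma mean_cvgD X X' Y Y' : mean_cvg X X' -> mean_cvg Y Y' ->
  mean_cvg (fun i w => X i w + Y i w) (fun w => X' w + Y' w).
Proof.
move=> [iX iX' cX] [iY iY' cY]; split.
- move=> i; rewrite (_ : _ \o _ = (EFin \o X i) \+ (EFin \o Y i))%E//.
  exact: integrableD.
- rewrite (_ : _ \o _ = (EFin \o X') \+ (EFin \o Y'))%E//.
  exact: integrableD.
- rewrite RintegralD//.
  under eq_fun do rewrite RintegralD//.
  exact: cvgD.
Qed.

Lemma mean_cvgZ (c : R) X X' : mean_cvg X X' ->
  mean_cvg (fun i w => c * X i w) (fun w => c * X' w).
Proof.
move=> [iX iX' cX]; split.
- move=> i; exact: integrable_scale.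
- exact: integrable_scale.
- rewrite RintegralZl//.
  under eq_fun do rewrite RintegralZl//.
  exact: cvgMr.
Qed.

Lemma mean_cvg_cst (c : R) : mean_cvg (fun _ _ => c) (fun=> c).
Proof.
have icst d (T : measurableType d) (Q : probability T R) :
    Q.-integrable setT (EFin \o cst c).
  exact: finite_measure_integrable_cst.
split=> //=.
rewrite Rintegral_cst//.
under eq_fun do rewrite Rintegral_cst// [fine _](congr1 fine (probability_setT _)).
rewrite [fine _](congr1 fine (probability_setT _)); exact: cvg_cst.
Qed.

Lemma mean_cvg_eq (X Y : forall i, Omega i -> R) (X' Y' : Omega' -> R) :
  (forall i w, X i w = Y i w) -> X' =1 Y' -> mean_cvg X X' -> mean_cvg Y Y'.
Proof.
move=> XY /funext <-; have -> // : X = Y.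
by apply: functional_extensionality_dep => i; exact/funext.
Qed.

Lemma mean_cvg_sum (K : Type) (r : seq K) (F : K -> forall i, Omega i -> R)
  (F' : K -> Omega' -> R) : (forall k, mean_cvg (F k) (F' k)) ->
  mean_cvg (fun i w => \sum_(k <- r) F k i w) (fun w => \sum_(k <- r) F' k w).
Proof.
move=> h; elim: r => [|k r IH].
  by apply: mean_cvg_eq (mean_cvg_cst 0) => [i w|w]; rewrite big_nil.
by apply: mean_cvg_eq (mean_cvgD (h k) IH) => [i w|w]; rewrite big_cons.
Qed.

Let approx1 d (T : measurableType d) (Q : probability T R) (X Y W : T -> R) e :
  measurable_fun setT X -> Q.-integrable setT (EFin \o Y) ->
  Q.-integrable setT (EFin \o W) -> (forall w, `|X w - Y w| <= e * W w) ->
  Q.-integrable setT (EFin \o X) /\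
  `|\int[Q]_w X w - \int[Q]_w Y w| <= e * \int[Q]_w W w.
Proof.
move=> mX iY iW h.
have iZ : Q.-integrable setT (EFin \o (fun w => e * W w)).
  exact: integrable_scale.
have iS : Q.-integrable setT (EFin \o (fun w => `|Y w| + e * W w)).
  rewrite (_ : _ \o _ = (EFin \o (fun w => `|Y w|%R)) \+
    (EFin \o (fun w => e * W w)%R))%E//.
  by apply: integrableD => //; exact: integrable_norm.
have iX : Q.-integrable setT (EFin \o X).
  apply: (le_integrable measurableT _ _ iS) => [|w _].
    exact/measurable_EFinP.
  rewrite /= lee_fin; apply: (le_trans _ (ler_norm _)).
  rewrite -lerBlDl (le_trans _ (h w))//.
  by rewrite lerBlDl -{1}(subrK (Y w) (X w)) addrC; exact: ler_normD.
split=> //.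
have iB : Q.-integrable setT (EFin \o (fun w => X w - Y w)).
  rewrite (_ : _ \o _ = (EFin \o X) \- (EFin \o Y))%E//.
  exact: integrableB.
rewrite -RintegralB// -RintegralZl//.
apply: (le_trans (le_normr_Rintegral measurableT iB)).
apply: le_Rintegral => //.
exact: (integrable_norm iB).
Qed.

(** Weighted closure: a variable whose distance to variables with convergent
    means is at most e W, for every e > 0, has convergent means if W has them.
    This is the only limit exchange used to pass from exponential moments to
    bounded continuous functions. *)
Lemma mean_cvg_approx (W X : forall i, Omega i -> R) (W' X' : Omega' -> R) : mean_cvg W W' ->
  (forall i, measurable_fun setT (X i)) -> measurable_fun setT X' ->
  (forall e, 0 < e -> exists Y Y', [/\ mean_cvg Y Y',
     forall i w, `|X i w - Y i w| <= e * W i w &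
     forall w, `|X' w - Y' w| <= e * W' w]) ->
  mean_cvg X X'.
Proof.
move=> [iW iW' cW] mX mX' h.
have [Y1 [Y1' [[iY1 iY1' _] h1 h1']]] := h 1 ltr01.
have iX i := (approx1 (mX i) (iY1 i) (iW i) (h1 i)).1.
have iX' := (approx1 mX' iY1' iW' h1').1.
split => //; apply/cvgrPdist_le => eps eps0.
set k := \int[P']_w W' w in cW *.
pose e := eps / 3 / (`|k| + 1).
have k1 : 0 < `|k| + 1 by rewrite ltr_wpDl.
have e0 : 0 < e by rewrite !divr_gt0.
have [Y [Y' [[iY iY' cY] hY hY']]] := h e e0.
have dX' := (approx1 mX' iY' iW' hY').2.
have ek : e * (`|k| + 1) = eps / 3 by rewrite /e divfK// gt_eqF.
near=> i.
have dX := (approx1 (mX i) (iY i) (iW i) (hY i)).2.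
have dY : `|\int[P']_w Y' w - \int[P i]_w Y i w| <= eps / 3.
  by near: i; move/cvgrPdist_le : cY; apply; rewrite divr_gt0.
have dW : \int[P i]_w W i w <= k + 1.
  by near: i; apply: (cvgr_le _ cW); rewrite ltrDl.
have : e * \int[P i]_w W i w <= eps / 3.
  by rewrite -ek ler_pM2l// (le_trans dW)// lerD2r ler_norm.
have : e * k <= eps / 3 by rewrite -ek ler_pM2l// (le_trans (ler_norm _))// lerDl.
rewrite -/k in dX'.
move: dX dX' dY; rewrite !ler_norml.
move: (\int[P']_w X' w) (\int[P']_w Y' w) (\int[P i]_w X i w) (\int[P i]_w Y i w)
  (e * \int[P i]_w W i w) (e * k) => x' y' x y w w'.
clear; move=> /andP[? ?] /andP[? ?] /andP[? ?] ? ?.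
by apply/andP; split; lra.
Unshelve. all: by end_near. Qed.

End mean_convergence.

(** * From exponential moments to cosines *)

Section mgf_to_cos.
Context {R : realType} (I : Type) (G : set_system I) {FG : ProperFilter G}.
Context (dO : I -> measure_display) (Omega : forall i, measurableType (dO i)).
Context (P : forall i, probability (Omega i) R).
Context d' (Omega' : measurableType d') (P' : probability Omega' R).
Context (V : forall i, Omega i -> R) (V' : Omega' -> R).
Arguments V : clear implicits.
Hypothesis mV : forall i, measurable_fun setT (V i).
Hypothesis mV' : measurable_fun setT V'.

Let stable (phi : R -> R) :=
  mean_cvg G P P' (fun i w => phi (V i w)) (fun w => phi (V' w)).

Hypothesis cvg_exp : forall t, stable (fun x => expR (t * x)).

Let stable_expw c : stable (expw c).
Proof.
apply: mean_cvg_eq (mean_cvgD (cvg_exp c) (cvg_exp (- c))) => [i w|w];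
  by rewrite mulNr.
Qed.

(** The closure principle for functions of V, with weight [expw c]. *)
Let stable_approx (c : R) (phi : R -> R) : measurable_fun setT phi ->
  (forall e, 0 < e -> exists2 psi, stable psi &
     forall x, `|phi x - psi x| <= e * expw c x) -> stable phi.
Proof.
move=> mphi h; apply: (mean_cvg_approx (stable_expw c)).
- by move=> i; exact: measurableT_comp.
- exact: measurableT_comp.
- move=> e e0; have [psi spsi hpsi] := h e e0.
  by exists (fun i w => psi (V i w)), (fun w => psi (V' w)); split.
Qed.

(** A difference quotient in t of x^j exp(tx) approximates x^(j+1) exp(tx) to
    first order in h, uniformly in x for the weight [expw (|t| + 2)]. *)
Let quotient_bound (j : nat) (t h x : R) : 0 < h -> h <= 1 ->
  `|x ^+ j.+1 * expR (t * x) -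
    h^-1 * (x ^+ j * expR ((t + h) * x) - x ^+ j * expR (t * x))| <=
  h * (j.+2)`!%:R * expw (`|t| + 2) x.
Proof.
move=> h0 h1.
have -> : x ^+ j.+1 * expR (t * x) -
    h^-1 * (x ^+ j * expR ((t + h) * x) - x ^+ j * expR (t * x)) =
    - (h^-1 * x ^+ j * expR (t * x) * (expR (h * x) - 1 - h * x)).
  rewrite mulrDl expRD exprS; have hn : h != 0 by rewrite gt_eqF.
  by field.
rewrite normrN !normrM normrX (gtr0_norm (expR_gt0 _)) gtr0_norm ?invr_gt0//.
apply: (@le_trans _ _ (h^-1 * `|x| ^+ j * expR (`|t| * `|x|) *
    ((h * `|x|) ^+ 2 * expR `|x|))).
  rewrite ler_pM// ?mulr_ge0 ?invr_ge0 ?expR_ge0 ?exprn_ge0 ?(ltW h0)//.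
    rewrite ler_wpM2l ?mulr_ge0 ?invr_ge0 ?exprn_ge0 ?(ltW h0)//.
    by rewrite ler_expR -normrM ler_norm.
  apply: (le_trans (exp_taylor2 _)); rewrite normrM (gtr0_norm h0).
  rewrite ler_wpM2l ?exprn_ge0 ?mulr_ge0 ?(ltW h0)// ler_expR.
  by rewrite ler_piMl.
have -> : h^-1 * `|x| ^+ j * expR (`|t| * `|x|) * ((h * `|x|) ^+ 2 * expR `|x|)
   = h * (`|x| ^+ j.+2 * expR (`|t| * `|x|) * expR `|x|).
  by rewrite -[j.+2]addn2 exprD; field; rewrite gt_eqF.
rewrite -[leRHS]mulrA ler_pM2l//.
apply: (le_trans _ (ler_wpM2l _ (expw_ge1 _ _))) => //.
have -> : expR ((`|t| + 2) * `|x|) = expR `|x| * (expR (`|t| * `|x|) * expR `|x|).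
  by rewrite -!expRD; congr expR; ring.
rewrite -mulrA [leRHS]mulrA ler_wpM2r ?mulr_ge0 ?expR_ge0//.
exact: pow_le_exp.
Qed.

(** Differentiating in t raises the power of x: the difference quotients have
    convergent means by induction, and they converge in the weighted sense. *)
Lemma stable_pow_exp (j : nat) (t : R) : stable (fun x => x ^+ j * expR (t * x)).
Proof.
elim: j t => [|j IH] t.
  by apply: mean_cvg_eq (cvg_exp t) => [i w|w]; rewrite expr0 mul1r.
apply: (@stable_approx (`|t| + 2)).
  apply: measurable_funM; first exact: measurable_funX.
  by apply: measurableT_comp => //; exact: measurable_funM.
move=> e e0.
(* makes the constant h (j+2)! of the quotient bound at most e *)
pose h := Num.min 1 (e / (j.+2)`!%:R).
have f0 : 0 < (j.+2)`!%:R :> R by rewrite ltr0n fact_gt0.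
have h0 : 0 < h by rewrite lt_min ltr01 divr_gt0.
have h1 : h <= 1 by rewrite ge_min lexx.
exists (fun x => h^-1 * (x ^+ j * expR ((t + h) * x) + -1 * (x ^+ j * expR (t * x)))).
  apply: mean_cvgZ; apply: mean_cvgD; first exact: IH.
  by apply: mean_cvgZ; exact: IH.
move=> x; rewrite mulN1r; apply: (le_trans (quotient_bound _ _ _ h0 h1)).
rewrite ler_wpM2r ?addr_ge0 ?expR_ge0//.
by rewrite -ler_pdivlMr// ge_min lexx orbT.
Qed.

Lemma stable_pow (j : nat) : stable (fun x => x ^+ j).
Proof.
by apply: mean_cvg_eq (stable_pow_exp j 0) => [i w|w];
  rewrite mul0r expR0 mulr1.
Qed.

(** The remainder of the exponential series at x is at most 2^-J exp(3|x|),
    because (2|x|)^J / J! <= exp(2|x|). *)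
Let tail_small (e : R) : 0 < e -> exists J : nat, forall x : R,
  `|x| ^+ J / J`!%:R * expR `|x| <= e * expw 3 x.
Proof.
move=> e0.
have [J /= hJ] : exists J : nat, (2^-1) ^+ J <= e.
  have /cvgrPdist_le/(_ _ e0)[J _ /(_ J (leqnn _))] :
    (fun n : nat => (2^-1 : R) ^+ n) @ \oo --> (0 : R).
    by apply: cvg_expr; rewrite ger0_norm// invf_lt1// ltr1n.
  rewrite sub0r normrN ger0_norm ?exprn_ge0//= => h.
  by exists J.
exists J => x.
apply: (@le_trans _ _ (2^-1 ^+ J * expR (3 * `|x|))); last first.
  by rewrite ler_pM ?expR_ge0 ?exprn_ge0// expw_ge1.
have -> : expR (3 * `|x|) = expR (2 * `|x|) * expR `|x|.
  by rewrite -expRD; congr expR; ring.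
rewrite mulrA ler_wpM2r ?expR_ge0//.
rewrite ler_pdivrMr ?ltr0n ?fact_gt0// -mulrA (mulrC (expR _)).
have := pow_le_exp (2 * x) J; rewrite normrM ger0_norm// exprMn => h.
rewrite -ler_pdivrMl ?exprn_gt0 ?invr_gt0//.
by rewrite -exprVn invrK.
Qed.

(** The partial sums of the cosine series are polynomials, whose means converge,
    and they approximate the cosine for the weight [expw 3]. *)
Lemma stable_cos : stable cos.
Proof.
apply: (@stable_approx 3); first exact: (continuous_measurable_fun (@continuous_cos R)).
move=> e /tail_small[J hJ].
exists (fun x => series (cos_coeff x) J); last first.
  by move=> x; apply: (le_trans (cos_tail _ _)).
pose c (j : nat) : R := (~~ odd j)%:R * (-1) ^ j./2 / j`!%:R.
apply: mean_cvg_eq (mean_cvg_sum (index_iota 0 J)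
  (fun j => mean_cvgZ (c j) (stable_pow j))) => [i w|w];
  by apply: eq_bigr => j _; rewrite /cos_coeff /c /= mulrAC.
Qed.

Lemma stable_sin : stable sin.
Proof.
apply: (@stable_approx 3); first exact: (continuous_measurable_fun (@continuous_sin R)).
move=> e /tail_small[J hJ].
exists (fun x => series (sin_coeff x) J); last first.
  by move=> x; apply: (le_trans (sin_tail _ _)).
pose c (j : nat) : R := (odd j)%:R * (-1) ^+ j.-1./2 / j`!%:R.
apply: mean_cvg_eq (mean_cvg_sum (index_iota 0 J)
  (fun j => mean_cvgZ (c j) (stable_pow j))) => [i w|w];
  by apply: eq_bigr => j _; rewrite /sin_coeff /c /= mulrAC.
Qed.

Lemma mean_cvg_cos_of_exp (b : R) :
  mean_cvg G P P' (fun i w => cos (V i w + b)) (fun w => cos (V' w + b)).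
Proof.
apply: mean_cvg_eq (mean_cvgD (mean_cvgZ (cos b) stable_cos)
  (mean_cvgZ (- sin b) stable_sin)) => [i w|w];
  by rewrite cosD mulNr mulrC (mulrC (sin b)).
Qed.

End mgf_to_cos.

(** * Trigonometric polynomials and Bernstein weights *)

Section trig_poly.
Context {R : realType} (n : nat).
Implicit Types (f g : 'rV[R]_n -> R) (a x : 'rV[R]_n).

Definition dot a x : R := \sum_i a 0 i * x 0 i.

(** Sums of cosine waves.  Phases are free, so sines are included, and products
    of waves are again sums of waves. *)
Inductive trig_poly : ('rV[R]_n -> R) -> Prop :=
| trig_wave c a b : trig_poly (fun x => c * cos (dot a x + b))
| trig_add f g : trig_poly f -> trig_poly g -> trig_poly (fun x => f x + g x).

Lemma dot0 x : dot 0 x = 0.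
Proof. by rewrite /dot big1// => i _; rewrite mxE mul0r. Qed.

Lemma dotDl a1 a2 x : dot (a1 + a2) x = dot a1 x + dot a2 x.
Proof. by rewrite /dot -big_split; apply: eq_bigr => i _; rewrite mxE mulrDl. Qed.

Lemma dotNl a x : dot (- a) x = - dot a x.
Proof. by rewrite /dot -sumrN; apply: eq_bigr => i _; rewrite mxE mulNr. Qed.

Lemma dot_delta c i x : dot (c *: delta_mx 0 i) x = c * x 0 i.
Proof.
rewrite /dot (bigD1 i)//= big1 ?addr0 ?mxE ?eqxx ?mulr1// => j ji.
by rewrite !mxE (negbTE ji) andbF mulr0 mul0r.
Qed.

Lemma trig_cst c : trig_poly (fun=> c).
Proof.
rewrite (_ : (fun=> c) = (fun x => c * cos (dot 0 x + 0))); first exact: trig_wave.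
by apply/funext => x; rewrite dot0 addr0 cos0 mulr1.
Qed.

Lemma trig_mul f g : trig_poly f -> trig_poly g -> trig_poly (fun x => f x * g x).
Proof.
move=> tf; elim: tf g => {f}[c a b|f1 f2 _ IH1 _ IH2] g tg; last first.
  rewrite (_ : (fun _ => _) = (fun x => f1 x * g x + f2 x * g x)).
    by apply: trig_add; [exact: IH1|exact: IH2].
  by apply/funext => x; rewrite mulrDl.
elim: tg => {g}[c' a' b'|g1 g2 _ IH1 _ IH2]; last first.
  rewrite (_ : (fun _ => _) = (fun x => c * cos (dot a x + b) * g1 x +
      c * cos (dot a x + b) * g2 x)); first exact: trig_add.
  by apply/funext => x; rewrite mulrDr.
rewrite (_ : (fun _ => _) = (fun x =>
   (c * c' / 2) * cos (dot (a + a') x + (b + b')) +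
   (c * c' / 2) * cos (dot (a - a') x + (b - b')))).
  by apply: trig_add; exact: trig_wave.
apply/funext => x; rewrite !dotDl dotNl.
rewrite (_ : _ + _ + (b + b') = (dot a x + b) + (dot a' x + b')); last by ring.
rewrite (_ : _ - _ + (b - b') = (dot a x + b) - (dot a' x + b')); last by ring.
move: (dot a x + b) (dot a' x + b') => u v.
by rewrite cosD cosB; field.
Qed.

Lemma trig_sum (K : Type) (r : seq K) (F : K -> 'rV[R]_n -> R) :
  (forall k, trig_poly (F k)) -> trig_poly (fun x => \sum_(k <- r) F k x).
Proof.
move=> h; elim: r => [|k r IH].
  by under eq_fun do rewrite big_nil; exact: trig_cst.
by under eq_fun do rewrite big_cons; exact: trig_add.
Qed.

Lemma trig_prod (K : Type) (r : seq K) (F : K -> 'rV[R]_n -> R) :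
  (forall k, trig_poly (F k)) -> trig_poly (fun x => \prod_(k <- r) F k x).
Proof.
move=> h; elim: r => [|k r IH].
  by under eq_fun do rewrite big_nil; exact: trig_cst.
by under eq_fun do rewrite big_cons; exact: trig_mul.
Qed.

End trig_poly.

Section bernstein.
Context {R : realType}.

(** The probability that m independent tosses with success probability t give k
    successes, by Pascal's recursion. *)
Fixpoint bern (t : R) (m k : nat) : R :=
  if m is m'.+1 then
    (if k is k'.+1 then t * bern t m' k' else 0) + (1 - t) * bern t m' k
  else (k == 0%N)%:R.

Lemma bern_ge0 t m k : 0 <= t <= 1 -> 0 <= bern t m k.
Proof.
move=> /andP[t0 t1]; elim: m k => [|m IH] [|k] //=.
  by rewrite add0r mulr_ge0// subr_ge0.
by rewrite addr_ge0// mulr_ge0// subr_ge0.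
Qed.

Lemma bern_gt t m k : (m < k)%N -> bern t m k = 0.
Proof.
elim: m k => [|m IH] [|k]//= mk; rewrite !IH ?mulr0 ?addr0//.
exact: ltnW.
Qed.

(** Conditioning on one toss; mass, mean and variance all follow from this
    recursion by induction on m. *)
Lemma bern_rec t m (f : nat -> R) :
  \sum_(k < m.+2) bern t m.+1 k * f k =
  t * (\sum_(k < m.+1) bern t m k * f k.+1) +
  (1 - t) * (\sum_(k < m.+1) bern t m k * f k).
Proof.
have -> : \sum_(k < m.+1) bern t m k * f k = \sum_(k < m.+2) bern t m k * f k.
  by rewrite [RHS]big_ord_recr /= bern_gt// mul0r addr0.
rewrite big_ord_recl [X in _ = _ + _ * X]big_ord_recl /= add0r mulrDr addrCA mulrA.
congr (_ + _); rewrite 2!mulr_sumr -big_split/=; apply: eq_bigr => i _; rewrite /bump /= add1n.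
ring.
Qed.

Lemma bern_sum1 t m : \sum_(k < m.+1) bern t m k = 1.
Proof.
elim: m => [|m IH]; first by rewrite big_ord1.
have := bern_rec t m (fun=> 1).
under eq_bigr do rewrite mulr1.
under [X in _ = t * X + _]eq_bigr do rewrite mulr1.
under [X in _ = _ + _ * X]eq_bigr do rewrite mulr1.
by rewrite IH => ->; ring.
Qed.

Lemma bern_mean t m : \sum_(k < m.+1) bern t m k * (k%:R - m%:R * t) = 0.
Proof.
elim: m => [|m IH]; first by rewrite big_ord1 /= mul0r subr0 mulr0.
rewrite (bern_rec t m (fun k => k%:R - m.+1%:R * t)).
have shift c : \sum_(k < m.+1) bern t m k * (k%:R - m%:R * t + c) = c.
  under eq_bigr do rewrite mulrDr.
  by rewrite big_split /= IH add0r -mulr_suml bern_sum1 mul1r.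
have e1 : \sum_(k < m.+1) bern t m k * (k.+1%:R - m.+1%:R * t) = 1 - t.
  by rewrite -[RHS]shift; apply: eq_bigr => k _; rewrite -!natr1; ring.
have e2 : \sum_(k < m.+1) bern t m k * (k%:R - m.+1%:R * t) = - t.
  by rewrite -[RHS]shift; apply: eq_bigr => k _; rewrite -!natr1; ring.
by rewrite e1 e2; ring.
Qed.

(** Variance of the binomial law; this is what makes Bernstein polynomials
    concentrate near the evaluation point. *)
Lemma bern_var t m :
  \sum_(k < m.+1) bern t m k * (k%:R - m%:R * t) ^+ 2 = m%:R * (t * (1 - t)).
Proof.
elim: m => [|m IH]; first by rewrite big_ord1 /= mul0r subr0 expr0n mulr0 mul0r.
rewrite (bern_rec t m (fun k => (k%:R - m.+1%:R * t) ^+ 2)).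
have shift c : \sum_(k < m.+1) bern t m k * (k%:R - m%:R * t + c) ^+ 2 =
    m%:R * (t * (1 - t)) + c ^+ 2.
  rewrite (eq_bigr (fun k : 'I_m.+1 =>
      (bern t m k * (k%:R - m%:R * t) ^+ 2 + (2 * c) * (bern t m k *
      (k%:R - m%:R * t))) + bern t m k * c ^+ 2)); last by move=> k _; ring.
  rewrite 2!big_split /= IH -mulr_sumr bern_mean mulr0 addr0.
  by rewrite -mulr_suml bern_sum1 mul1r.
have e1 : \sum_(k < m.+1) bern t m k * (k.+1%:R - m.+1%:R * t) ^+ 2 =
    m%:R * (t * (1 - t)) + (1 - t) ^+ 2.
  by rewrite -[RHS]shift; apply: eq_bigr => k _; rewrite -!natr1; ring.
have e2 : \sum_(k < m.+1) bern t m k * (k%:R - m.+1%:R * t) ^+ 2 =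
    m%:R * (t * (1 - t)) + (- t) ^+ 2.
  by rewrite -[RHS]shift; apply: eq_bigr => k _; rewrite -!natr1; ring.
by rewrite e1 e2 -natr1; ring.
Qed.

Lemma trig_bern n (f : 'rV[R]_n -> R) m k : trig_poly f ->
  trig_poly (fun x => bern (f x) m k).
Proof.
move=> tf; have tN : trig_poly (fun x => 1 - f x).
  apply: trig_add; first exact: trig_cst.
  by under eq_fun do rewrite -mulN1r; apply: trig_mul => //; exact: trig_cst.
elim: m k => [|m IH] k /=; first exact: trig_cst.
apply: trig_add; last exact: trig_mul.
by case: k => [|k]; [exact: trig_cst|exact: trig_mul].
Qed.

End bernstein.

(** * Uniform trigonometric approximation on boxes *)

Section trig_dense.
Context {R : realType} (n : nat).
Variables (g : 'rV[R]_n -> R) (K L : R).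
Hypothesis cg : continuous g.
Hypothesis gK : forall x, `|g x| <= K.
Hypothesis L0 : 0 < L.

Let s (y : R) := (1 + sin (y / L)) / 2.

Let s01 y : 0 <= s y <= 1.
Proof.
rewrite /s; have := sin_geN1 (y / L); have := sin_le1 (y / L) => h1 h2.
apply/andP; split; lra.
Qed.

(** The point whose i-th coordinate satisfies sin(y_i / L) = 2 j_i / m - 1. *)
Let grid m (j : {ffun 'I_n -> 'I_m.+1}) : 'rV[R]_n :=
  \row_i (L * asin (2 * (j i)%:R / m%:R - 1)).

(** The coordinates are perturbed independently, by binomial laws with parameters
    (1 + sin(x_i / L)) / 2; [T] below is the corresponding mean of g, a
    Bernstein polynomial in the variables sin(x_i / L). *)
Let wgt m (x : 'rV[R]_n) (j : {ffun 'I_n -> 'I_m.+1}) : R :=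
  \prod_i bern (s (x 0 i)) m (j i).

Let T m x := \sum_(j : {ffun 'I_n -> 'I_m.+1}) g (grid j) * wgt x j.

Let wgt_ge0 m x (j : {ffun 'I_n -> 'I_m.+1}) : 0 <= wgt x j.
Proof. by apply: prodr_ge0 => i _; exact: bern_ge0. Qed.

Let wgt_sum1 m x : \sum_(j : {ffun 'I_n -> 'I_m.+1}) wgt x j = 1.
Proof.
rewrite -(bigA_distr_bigA (fun i (k : 'I_m.+1) => bern (s (x 0 i)) m k)) /=.
by rewrite big1// => i _; exact: bern_sum1.
Qed.

Let wgt_marginal m x (i0 : 'I_n) (phi : nat -> R) :
  \sum_(j : {ffun 'I_n -> 'I_m.+1}) wgt x j * phi (j i0) =
  \sum_(k < m.+1) bern (s (x 0 i0)) m k * phi k.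
Proof.
pose F i (k : 'I_m.+1) := bern (s (x 0 i)) m k * (if i == i0 then phi k else 1).
rewrite (eq_bigr (fun j : {ffun 'I_n -> 'I_m.+1} => \prod_i F i (j i))); last first.
  move=> j _; rewrite /F big_split /=; congr (_ * _).
  by rewrite (bigD1 i0)//= eqxx big1 ?mulr1// => i /negbTE ->.
rewrite -(bigA_distr_bigA F) (bigD1 i0)//= [X in _ * X]big1 ?mulr1 => [|i /negbTE ii0].
  by apply: eq_bigr => k _; rewrite /F eqxx.
rewrite /F ii0.
by under eq_bigr do rewrite mulr1; rewrite bern_sum1.
Qed.

(** By independence only the i-th binomial variable matters, and its variance
    rescaled from m successes to [-1, 1] is at most 1/m. *)
Let wgt_var m x (i : 'I_n) :
  \sum_(j : {ffun 'I_n -> 'I_m.+2}) wgt x j *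
    (sin (x 0 i / L) - (2 * (j i)%:R / m.+1%:R - 1)) ^+ 2 <= m.+1%:R^-1.
Proof.
rewrite (@wgt_marginal m.+1 x i (fun k => (sin (x 0 i / L) - (2 * k%:R / m.+1%:R - 1)) ^+ 2)).
set t := s _.
have tE : sin (x 0 i / L) = 2 * t - 1 by rewrite /t /s; field.
rewrite (eq_bigr (fun k : 'I_m.+2 => (4 / m.+1%:R ^+ 2) *
    (bern t m.+1 k * (k%:R - m.+1%:R * t) ^+ 2))).
  rewrite -mulr_sumr bern_var.
  rewrite [leLHS](_ : _ = 4 * (t * (1 - t)) / m.+1%:R); last first.
    have : m.+1%:R != 0 :> R by rewrite pnatr_eq0.
    by move: (m.+1%:R) => M M0; field.
  rewrite ler_piMl ?invr_ge0//.
  by have := sqr_ge0 (2 * t - 1); rewrite expr2; lra.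
move=> k _; rewrite tE.
have : m.+1%:R != 0 :> R by rewrite pnatr_eq0.
by move: (m.+1%:R) => M M0; field.
Qed.

(** On the box |x_i| <= L < L pi / 2 the coordinate is recovered from
    sin(x_i / L) by the arcsine, which is continuous at interior points.  The
    estimate is local in x, in the form needed for a covering argument. *)
Lemma grid_local (x0 : 'rV[R]_n) (eps : R) : (forall i, `|x0 0 i| <= L) -> 0 < eps ->
  exists2 delta : R, 0 < delta & \forall x \near x0, forall u : 'I_n -> R,
    (forall i, `|sin ((x : 'rV[R]_n) 0 i / L) - u i| < delta) ->
    `|g x - g (\row_i (L * asin (u i)))| <= eps.
Proof.
move=> x0L eps0.
have e2 : 0 < eps / 2 by rewrite divr_gt0.
have near_g : \forall x \near x0, `|g x0 - g x| < eps / 2.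
  by move/cvgrPdist_lt: (@cg x0) => /(_ _ e2).
move/nbhs_ballP: (near_g) => [eta /= eta0 hball].
pose Q (r : R) (i : 'I_n) := forall u, `|sin (x0 0 i / L) - u| < r -> `|x0 0 i - L * asin u| < eta.
have [r r0 hr] : exists2 r : R, 0 < r & forall i, Q r i.
  have hn : \forall r \near 0^'+, forall i, Q r i.
    apply: filter_forall => i.
    have iL : `|x0 0 i / L| <= 1 by rewrite normrM normfV (gtr0_norm L0) ler_pdivrMr// mul1r.
    have hpi : 1 < pi / 2 :> R.
      rewrite lt_neqAle pihalf_ge1 andbT; apply/eqP => pi1.
      by have := @cos1_gt0 R; rewrite pi1 cos_pihalf ltxx.
    have xpi : x0 0 i / L \in `[(- (pi / 2)), (pi / 2)].
      by rewrite in_itv /= -ler_norml (le_trans iL)// ltW.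
    have sin1 : -1 < sin (x0 0 i / L) < 1.
      move: iL; rewrite ler_norml => /andP[lo hi].
      have hp0 : - (pi / 2) <= pi / 2 :> R by rewrite ge0_cp// ltW// (lt_trans _ hpi).
      rewrite -(@sin_pihalf R) -sinN !ltr_sin ?in_itv/= ?lexx ?hp0 ?xpi//.
      by rewrite (lt_le_trans _ lo) ?ltrN2// (le_lt_trans hi).
    have ca := continuous_asin sin1.
    have eL : 0 < eta / L by rewrite divr_gt0.
    have : \forall u \near sin (x0 0 i / L), `|asin (sin (x0 0 i / L)) - asin u| < eta / L.
      by move/cvgrPdist_lt: ca => /(_ _ eL).
    move/nbhs_ballP => [ri /= ri0 hri].
    near=> r; move=> u hu.
    have /hri /= : ball (sin (x0 0 i / L)) ri u.
      by apply: (lt_le_trans hu); near: r; exact: nbhs_right_le.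
    rewrite sinK// ltr_pdivlMr// -[X in _ * X](gtr0_norm L0) -normrM mulrBl divfK ?gt_eqF//.
    by rewrite mulrC.
  near (0 : R)^'+ => r.
  by exists r => //; near: r.
exists (r / 2); first by rewrite divr_gt0.
have near_sin : \forall x \near x0, forall i, `|sin (x0 0 i / L) - sin ((x : 'rV[R]_n) 0 i / L)| < r / 2.
  apply: (@filter_forall _ _ (fun i (x : 'rV[R]_n) =>
    `|sin (x0 0 i / L) - sin (x 0 i / L)| < r / 2) _ (nbhs_filter x0)) => i.
  have : {for x0, continuous (fun x : 'rV[R]_n => sin (x 0 i / L))}.
    apply: (@continuous_comp _ _ _ (fun x : 'rV[R]_n => x 0 i / L) sin).
      apply: (@cvgMr_tmp _ _ (nbhs x0) (nbhs_filter x0) (fun x : 'rV[R]_n => x 0 i)).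
      exact: (@coord_continuous _ _ _ 0 i x0).
    exact: continuous_sin.
  by move/cvgrPdist_lt => /(_ (r / 2)); apply; rewrite divr_gt0.
near=> x => u hu.
have h1 : `|g x0 - g x| < eps / 2 by near: x.
have h2 : forall i, `|sin (x0 0 i / L) - sin (x 0 i / L)| < r / 2 by near: x.
have /hball /= h3 : ball x0 eta (\row_i (L * asin (u i))).
  split=> // i j; rewrite (ord1 i) mxE; apply: hr.
  rewrite -(subrK (sin (x 0 j / L)) (sin (x0 0 j / L))) -addrA.
  by rewrite (le_lt_trans (ler_normD _ _))// (splitr r) ltrD.
rewrite -(subrK (g x0) (g x)) -addrA (le_trans (ler_normD _ _))//.
by rewrite distrC (splitr eps) lerD// ltW.
Unshelve. all: by end_near. Qed.

(** Chebyshev's inequality: for a deviation of at least d in some coordinate the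
    crude bound 2K is at most 2K/d^2 times the squared deviation. *)
Let gT m (x : 'rV[R]_n) (e d : R) : 0 < d ->
  (forall u : 'I_n -> R, (forall i, `|sin (x 0 i / L) - u i| < d) ->
    `|g x - g (\row_i (L * asin (u i)))| <= e) ->
  `|g x - T m.+1 x| <= e + 2 * K / d ^+ 2 * n%:R / m.+1%:R.
Proof.
move=> d0 hx.
have K0 : 0 <= K by exact: le_trans (gK 0).
have e0 : 0 <= e.
  apply: le_trans (hx (fun i => sin (x 0 i / L)) _) => // i.
  by rewrite subrr normr0.
pose D (j : {ffun 'I_n -> 'I_m.+2}) i := sin (x 0 i / L) - (2 * (j i)%:R / m.+1%:R - 1).
have pw (j : {ffun 'I_n -> 'I_m.+2}) :
    `|g x - g (grid j)| <= e + \sum_i (2 * K / d ^+ 2) * D j i ^+ 2.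
  have c0 : 0 <= 2 * K / d ^+ 2 by apply: divr_ge0; [exact: mulr_ge0|exact: sqr_ge0].
  have [/forallP h|] := boolP [forall i, `|D j i| < d].
    apply: le_trans (hx (fun i => 2 * (j i)%:R / m.+1%:R - 1) h) _.
    by rewrite lerDl sumr_ge0// => i _; rewrite mulr_ge0 ?sqr_ge0.
  rewrite negb_forall => /existsP[i]; rewrite -leNgt => di.
  apply: (@le_trans _ _ (2 * K)).
    have := gK x; have := gK (grid j); have := ler_normB (g x) (g (grid j)); lra.
  apply: (@le_trans _ _ (2 * K / d ^+ 2 * D j i ^+ 2)).
    rewrite mulrAC ler_pdivlMr ?exprn_gt0// ler_wpM2l ?mulr_ge0//.
    by rewrite -[leRHS]real_normK ?num_real// ler_sqr ?nnegrE// ltW.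
  rewrite (bigD1 i)//= addrCA lerDl addr_ge0// sumr_ge0// => k _.
  by rewrite mulr_ge0 ?sqr_ge0.
have gE : g x = \sum_(j : {ffun 'I_n -> 'I_m.+2}) g x * wgt x j.
  by rewrite -mulr_sumr wgt_sum1 mulr1.
rewrite /T {1}gE -sumrB.
rewrite (le_trans (ler_norm_sum _ _ _))//.
apply: (@le_trans _ _ (\sum_(j : {ffun 'I_n -> 'I_m.+2})
   (e * wgt x j + \sum_i (2 * K / d ^+ 2) * (wgt x j * D j i ^+ 2)))).
  apply: ler_sum => j _; rewrite -mulrBl normrM (ger0_norm (wgt_ge0 _ _)).
  apply: le_trans (ler_wpM2r (wgt_ge0 _ _) (pw j)) _.
  rewrite mulrDl lerD// mulr_suml; apply: ler_sum => i _.
  by rewrite -[leLHS]mulrA (mulrC (_ ^+ 2)).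
rewrite big_split /= -mulr_sumr wgt_sum1 mulr1 lerD2l exchange_big /=.
apply: (@le_trans _ _ (\sum_(i < n) (2 * K / d ^+ 2) / m.+1%:R)).
  apply: ler_sum => i _; rewrite -mulr_sumr ler_wpM2l ?wgt_var//.
  by apply: divr_ge0; [exact: mulr_ge0|exact: sqr_ge0].
by rewrite sumr_const card_ord -[leLHS]mulr_natr [leRHS]mulrAC.
Qed.

(** Compactness of the box turns the pointwise estimates into one degree m that
    works everywhere.  A Bernstein mean of g is bounded by K on the whole space,
    which matters since nothing else is known about f outside the box. *)
Lemma trig_approx_box (eps : R) : 0 < eps ->
  exists f, [/\ trig_poly f, forall x, `|f x| <= K &
    forall x : 'rV[R]_n, (forall i, `|x 0 i| <= L) -> `|g x - f x| <= eps].
Proof.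
move=> eps0.
have cK : compact [set v : 'rV[R]_n | forall i, `[- L, L]%classic (v ord0 i)].
  exact: (@rV_compact R n (fun=> `[- L, L]%classic) (fun=> @segment_compact R _ _)).
move/compact_near_coveringP: cK => /(_ nat \oo (fun m x => `|g x - T m.+1 x| <= eps)).
have Foo : Filter (\oo : set_system nat) by exact: eventually_filter.
case/(_ Foo) => [x0 /= x0L|m _ hm].
  have x0L' i : `|x0 0 i| <= L by have := x0L i; rewrite in_itv /= ler_norml.
  have e2 : 0 < eps / 2 by rewrite divr_gt0.
  have [d d0 hd] := grid_local x0L' e2.
  have hm : \forall m \near \oo, 2 * K / d ^+ 2 * n%:R / (eps / 2) <= m%:R :> R.
    exact: nbhs_infty_ger.
  near=> x m.
  have hx : forall u : 'I_n -> R, (forall i, `|sin (x 0 i / L) - u i| < d) ->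
      `|g x - g (\row_i (L * asin (u i)))| <= eps / 2 by near: x.
  apply: (le_trans (gT m d0 hx)); rewrite [leRHS]splitr lerD2l.
  rewrite ler_pdivrMr// [leRHS]mulrC -ler_pdivrMr//.
  apply: (@le_trans _ _ m%:R); last by rewrite ler_nat.
  by near: m.
exists (T m.+1); split.
- apply: trig_sum => j; apply: trig_mul; first exact: trig_cst.
  apply: trig_prod => i; apply: trig_bern; rewrite /s.
  under eq_fun do rewrite mulrC.
  apply: trig_mul; first exact: trig_cst.
  apply: trig_add; first exact: trig_cst.
  rewrite (_ : (fun _ => _) = (fun x => 1 * cos (dot (L^-1 *: delta_mx 0 i) x + - (pi / 2)))).
    exact: trig_wave.
  by apply/funext => x; rewrite dot_delta mul1r cosBpihalf mulrC.
- move=> x; rewrite (le_trans (ler_norm_sum _ _ _))//.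
  have KE : K = \sum_(j : {ffun 'I_n -> 'I_m.+2}) K * wgt x j.
    by rewrite -mulr_sumr wgt_sum1 mulr1.
  rewrite {1}KE; apply: ler_sum => j _.
  by rewrite normrM (ger0_norm (wgt_ge0 _ _)) ler_wpM2r.
- move=> x xL; apply: (hm m) => //= i.
  by rewrite in_itv /= -ler_norml xL.
Unshelve. all: by end_near. Qed.

End trig_dense.

(** * Weak convergence from exponential moments *)

Section weak_convergence.
Context {R : realType} (n : nat).

(** This weight exceeds exp(L) outside the box of half-width L, and its mean
    involves only exponential moments. *)
Definition exp_weight (x : 'rV[R]_n) : R := 1 + \sum_i expw 1 (x 0 i).

Lemma expw_ge0 (c x : R) : 0 <= expw c x.
Proof. by rewrite addr_ge0 ?expR_ge0. Qed.

Lemma measurable_dot d (T : measurableType d) (Y : T -> 'rV[R]_n) a :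
  (forall k, measurable_fun setT (fun w => Y w 0 k)) ->
  measurable_fun setT (fun w => dot a (Y w)).
Proof.
by move=> mY; apply: measurable_sum => k; apply: measurable_funM.
Qed.

(** Outside a box so large that eps exp(L) >= 2K, the weight absorbs the trivial
    bound |g - f| <= 2K. *)
Lemma trig_dense (g : 'rV[R]_n -> R) (K eps : R) : continuous g ->
  (forall x, `|g x| <= K) -> 0 < eps ->
  exists2 f, trig_poly f & forall x, `|g x - f x| <= eps * exp_weight x.
Proof.
move=> cg gK eps0.
have K0 : 0 <= K by exact: le_trans (gK 0).
(* exp(L) >= 1 + L, so that eps exp(L) >= 2K *)
pose L := 1 + 2 * K / eps.
have L0 : 0 < L by rewrite ltr_wpDr// divr_ge0 ?(ltW eps0)// mulr_ge0.
have [f [tf fK fg]] := trig_approx_box cg gK L0 eps0.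
exists f => // x.
have [/forallP xL|] := boolP [forall i, `|x 0 i| <= L].
  apply: (le_trans (fg x xL)); rewrite ler_peMr ?(ltW eps0)//.
  by rewrite lerDl sumr_ge0// => i _; exact: expw_ge0.
rewrite negb_forall => /existsP[i]; rewrite -ltNge => xi.
apply: (@le_trans _ _ (2 * K)).
  have := gK x; have := fK x; have := ler_normB (g x) (f x); lra.
apply: (@le_trans _ _ (eps * expR L)).
  rewrite -ler_pdivrMl// [leLHS]mulrC (le_trans _ (expR_ge1Dx _))// /L; lra.
rewrite ler_pM2l//.
apply: (@le_trans _ _ (expw 1 (x 0 i))).
  by rewrite (le_trans _ (expw_ge1 _ _))// mul1r ler_expR ltW.
rewrite /exp_weight (bigD1 i)//= addrCA lerDl addr_ge0// sumr_ge0// => k _.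
exact: expw_ge0.
Qed.

Context (I : Type) (G : set_system I) {FG : ProperFilter G}.
Context (dO : I -> measure_display) (Omega : forall i, measurableType (dO i)).
Context (P : forall i, probability (Omega i) R).
Context d' (Omega' : measurableType d') (P' : probability Omega' R).
Context (X : forall i, Omega i -> 'rV[R]_n) (X' : Omega' -> 'rV[R]_n).
Arguments X : clear implicits.
Hypothesis mX : forall i k, measurable_fun setT (fun w => X i w 0 k).
Hypothesis mX' : forall k, measurable_fun setT (fun w => X' w 0 k).
Hypothesis cvg_exp : forall a, mean_cvg G P P'
  (fun i w => expR (dot a (X i w))) (fun w => expR (dot a (X' w))).

Let measurable_trig d (T : measurableType d) (Y : T -> 'rV[R]_n) f :
  (forall k, measurable_fun setT (fun w => Y w 0 k)) -> trig_poly f ->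
  measurable_fun setT (f \o Y).
Proof.
move=> mY; elim=> {f}[c a b|f g _ mf _ mg].
  apply: measurable_funM => //.
  apply: (measurableT_comp (continuous_measurable_fun (@continuous_cos R))).
  by apply: measurable_funD => //; exact: measurable_dot.
exact: measurable_funD.
Qed.

(** The trigonometric polynomials of [trig_dense] converge pointwise to g, and
    composed with Y they depend measurably on its coordinates. *)
Let measurable_continuous d (T : measurableType d) (Y : T -> 'rV[R]_n)
  (g : 'rV[R]_n -> R) (K : R) :
  (forall k, measurable_fun setT (fun w => Y w 0 k)) -> continuous g ->
  (forall x, `|g x| <= K) -> measurable_fun setT (g \o Y).
Proof.
move=> mY cg gK.
have /choice[f hf] : forall k : nat, exists f, trig_poly f /\
    forall x, `|g x - f x| <= k.+1%:R^-1 * exp_weight x.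
  move=> k; have [f tf hf] : exists2 f, trig_poly f &
      forall x, `|g x - f x| <= k.+1%:R^-1 * exp_weight x.
    by apply: trig_dense cg gK _; rewrite invr_gt0.
  by exists f.
apply: (measurable_fun_cvg (fun k => measurable_trig mY (hf k).1)) => w _.
apply/cvgrPdist_le => e e0; near=> k; rewrite /=.
apply: (le_trans ((hf k).2 _)).
have w0 : 0 < exp_weight (Y w).
  by rewrite ltr_wpDr// sumr_ge0// => i _; exact: expw_ge0.
rewrite -ler_pdivlMr// -[leRHS]invrK lef_pV2 ?posrE ?invr_gt0 ?divr_gt0//.
apply: (@le_trans _ _ k%:R); last by rewrite ler_nat.
by near: k; exact: nbhs_infty_ger.
Unshelve. all: by end_near. Qed.

Lemma mean_cvg_exp_weight :
  mean_cvg G P P' (fun i w => exp_weight (X i w)) (fun w => exp_weight (X' w)).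
Proof.
apply: mean_cvgD; first exact: mean_cvg_cst.
apply: mean_cvg_sum => k.
apply: mean_cvg_eq (mean_cvgD (cvg_exp (1 *: delta_mx 0 k))
  (cvg_exp ((- 1) *: delta_mx 0 k))) => [i w|w];
  by rewrite !dot_delta /expw mulNr.
Qed.

Lemma mean_cvg_trig f : trig_poly f ->
  mean_cvg G P P' (fun i w => f (X i w)) (fun w => f (X' w)).
Proof.
elim=> {f}[c a b|f g _ hf _ hg]; last exact: mean_cvgD.
apply: mean_cvgZ; apply: (mean_cvg_cos_of_exp (V := fun i w => dot a (X i w))
   (V' := fun w => dot a (X' w))).
- by move=> i; exact: measurable_dot.
- exact: measurable_dot.
- move=> t; have dZ x : dot (t *: a) x = t * dot a x.
    by rewrite /dot mulr_sumr; apply: eq_bigr => k _; rewrite mxE mulrA.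
  by apply: mean_cvg_eq (cvg_exp (t *: a)) => [i w|w]; rewrite dZ.
Qed.

(** A multivariate form of Curtiss' theorem: trigonometric polynomials have
    convergent means by [mean_cvg_cos_of_exp], and the closure principle
    [mean_cvg_approx] extends this to g because of [trig_dense]. *)
Theorem mean_cvg_bounded_continuous (g : 'rV[R]_n -> R) : continuous g ->
  (exists K, forall v, `|g v| <= K) ->
  mean_cvg G P P' (fun i w => g (X i w)) (fun w => g (X' w)).
Proof.
move=> cg [K gK].
apply: (mean_cvg_approx mean_cvg_exp_weight).
- by move=> i; exact: (measurable_continuous (@mX i) cg gK).
- exact: (measurable_continuous mX' cg gK).
- move=> e e0; have [f tf hf] := trig_dense cg gK e0.
  by exists (fun i w => f (X i w)), (fun w => f (X' w)); split => //; exact: mean_cvg_trig.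
Qed.

End weak_convergence.

Import HBNNSimple.

(** * Functionals determined by their values on indicators *)

Section integral_like.
Local Open Scope ereal_scope.
Context d (T : measurableType d) {R : realType}.
Implicit Types (m : set T -> \bar R) (f g : T -> \bar R).

(** The properties that determine an integral on nonnegative measurable
    functions: value m on indicators, additivity, homogeneity and monotone
    continuity.  Functionals such as f |-> E (int f dN) are identified with
    int f dm by checking these four properties. *)
Definition integral_like m (Phi : (T -> \bar R) -> \bar R) : Prop :=
  [/\ forall A, measurable A -> Phi (fun x => (\1_A x)%:E) = m A,
      forall f g, measurable_fun setT f -> (forall x, 0 <= f x) ->
        measurable_fun setT g -> (forall x, 0 <= g x) ->
        Phi (fun x => f x + g x) = Phi f + Phi g,
      forall (r : R) f, (0 <= r)%R -> measurable_fun setT f ->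
        (forall x, 0 <= f x) -> Phi (fun x => r%:E * f x) = r%:E * Phi f &
      forall f_ : nat -> T -> \bar R, (forall n, measurable_fun setT (f_ n)) ->
        (forall n x, 0 <= f_ n x) ->
        (forall x, {homo f_^~ x : n k / (n <= k)%N >-> n <= k}) ->
        Phi (f_ n) @[n --> \oo] --> Phi (fun x => limn (f_^~ x))].

Lemma integral_like_integral (m : {measure set T -> \bar R}) :
  integral_like m (fun f => \int[m]_x f x).
Proof.
split.
- by move=> A mA; rewrite integral_indic// setIT.
- by move=> f g mf f0 mg g0; rewrite ge0_integralD.
- by move=> r f r0 mf f0; rewrite ge0_integralZl_EFin.
- by move=> f_ mf f0 ndf; apply: cvg_monotone_convergence.
Qed.

(** Both functionals agree on simple functions, and every nonnegative measurable
    function is a monotone limit of simple ones. *)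
Lemma integral_like_eq m Phi Psi f : integral_like m Phi -> integral_like m Psi ->
  measurable_fun setT f -> (forall x, 0 <= f x) -> Phi f = Psi f.
Proof.
have sumE Q (A : R -> set T) (s : seq R) : integral_like m Q ->
    (forall y, measurable (A y)) -> all (fun y => 0 <= y)%R s ->
    Q (fun x => \sum_(y <- s) y%:E * (\1_(A y) x)%:E) = \sum_(y <- s) y%:E * m (A y).
  move=> [QI QD QZ _] mA; elim: s => [_|y s IH /= /andP[y0 s0]].
    rewrite big_nil; under eq_fun do rewrite big_nil.
    have -> : (fun=> 0) = (fun x => 0%:E * (\1_(A 0%R) x)%:E) :> (T -> \bar R).
      by apply/funext => x; rewrite mul0e.
    rewrite QZ ?mul0e//.
    exact/measurable_EFinP/measurable_indic.
  rewrite big_cons; under eq_fun do rewrite big_cons.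
  have mI z : measurable_fun setT (fun x => (\1_(A z) x)%:E : \bar R).
    exact/measurable_EFinP/measurable_indic.
  rewrite QD ?IH// ?QZ ?QI//.
  - exact: measurable_funeM.
  - by move=> x; rewrite mule_ge0// lee_fin.
  - by apply: emeasurable_sum => z; exact: measurable_funeM.
  - move=> x; rewrite big_seq; apply: sume_ge0 => z zs.
    by rewrite mule_ge0// lee_fin //; exact: (allP s0).
move=> hPhi hPsi mf f0.
pose h := nnsfun_approx measurableT mf.
have hE n : (fun x : T => (h n x)%:E) = (fun x => \sum_(y <- finmap.enum_fset (fset_set (range (h n))))
    y%:E * (\1_(h n @^-1` [set y]) x)%:E).
  apply/funext => x; rewrite (fimfunE (h n)) fsbig_finite//= -sumEFin.
  by apply: eq_bigr.
have PP n : Phi (fun x : T => (h n x)%:E) = Psi (fun x : T => (h n x)%:E).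
  rewrite hE !sumE//.
  - by apply/allP => y; rewrite in_fset_set// inE => -[x _ <-].
  - by apply/allP => y; rewrite in_fset_set// inE => -[x _ <-].
have fE : f = fun x : T => limn (fun n => (h n x)%:E).
  apply/funext => x; apply/esym/cvg_lim => //.
  exact: cvg_nnsfun_approx.
have mono (x : T) : {homo (fun n => (h n x)%:E) : n k / (n <= k)%N >-> n <= k}.
  by move=> n k nk; rewrite lee_fin; exact/lefP/nd_nnsfun_approx.
have lim Q : integral_like m Q -> Q (fun x : T => (h n x)%:E) @[n --> \oo] --> Q f.
  move=> [_ _ _ QL]; rewrite fE; apply: QL => // [n|n x].
    exact/measurable_EFinP.
  by rewrite lee_fin.
have c1 := lim _ hPhi; have c2 := lim _ hPsi.
rewrite -(cvg_lim _ c1)// -(cvg_lim _ c2)//.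
by under eq_fun do rewrite PP.
Qed.

Lemma integral_likeE (m : {measure set T -> \bar R}) Phi f : integral_like m Phi ->
  measurable_fun setT f -> (forall x, 0 <= f x) -> Phi f = \int[m]_x f x.
Proof.
move=> hPhi; exact: integral_like_eq hPhi (integral_like_integral m).
Qed.

Lemma ge0_integral_density (m n : {measure set T -> \bar R}) D (g : T -> R) f :
  measurable D -> measurable_fun D g -> (forall x, D x -> (0 <= g x)%R) ->
  (forall A, measurable A -> n A = \int[m]_(x in A `&` D) (g x)%:E) ->
  measurable_fun setT f -> (forall x, 0 <= f x) ->
  \int[n]_x f x = \int[m]_(x in D) (f x * (g x)%:E).
Proof.
move=> mD mg g0 nE mf f0.
apply/esym; apply: (integral_likeE (Phi := fun f => \int[m]_(x in D) (f x * (g x)%:E))) => //.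
have mfg h : measurable_fun setT h -> measurable_fun D (fun x => h x * (g x)%:E).
  by move=> mh; apply: emeasurable_funM; [exact: measurable_funTS|exact/measurable_EFinP].
split.
- move=> A mA; rewrite nE// setIC integral_mkcondr; apply: eq_integral => x _.
  by rewrite /patch indicE; case: (x \in A); rewrite ?mul1e ?mul0e.
- move=> h1 h2 mh1 h10 mh2 h20; rewrite -ge0_integralD//; last 4 first.
  - by move=> x Dx; rewrite mule_ge0// lee_fin g0.
  - exact: mfg.
  - by move=> x Dx; rewrite mule_ge0// lee_fin g0.
  - exact: mfg.
  by apply: eq_integral => x /set_mem Dx; rewrite ge0_muleDl.
- move=> r h r0 mh h0; rewrite -ge0_integralZl_EFin//.
  + by apply: eq_integral => x _; rewrite muleA.
  + by move=> x Dx; rewrite mule_ge0// lee_fin g0.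
  + exact: mfg.
- move=> h_ mh h0 ndh.
  have e : \int[m]_(x in D) (limn (h_^~ x) * (g x)%:E) =
      \int[m]_(x in D) limn (fun n => h_ n x * (g x)%:E).
    apply: eq_integral => x /set_mem Dx; apply/esym/cvg_lim => //.
    apply: cvgeZr => //; apply: ereal_nondecreasing_is_cvgn; exact: ndh.
  rewrite e; apply: (@cvg_monotone_convergence _ _ _ m D mD (fun n x => h_ n x * (g x)%:E)).
  - by move=> k; exact: mfg.
  - by move=> k x Dx; rewrite mule_ge0// lee_fin g0.
  - by move=> x Dx k l kl; rewrite lee_wpmul2r ?lee_fin ?g0// ndh.
Qed.

End integral_like.

(** * Poisson random measures: counts, Campbell's formula *)

Section poisson_series.
Context {R : realType}.
Local Open Scope ereal_scope.

Lemma nneseries_cvg (u : R^nat) (l : R) : series u @ \oo --> l ->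
  \sum_(k <oo) (u k)%:E = l%:E.
Proof.
move=> ul; apply/cvg_lim => //.
rewrite (_ : (fun n => _) = EFin \o series u).
  by apply: cvg_EFin; [exact: nearW|exact: ul].
by apply/funext => n; rewrite /= /series/= sumEFin.
Qed.

(** The exponential series at a exp(c).  The factor g is carried along for
    [poisson_mgf_step]. *)
Lemma poisson_mgf_series (a c g : R) :
  \sum_(k <oo) (g * (a ^+ k / k`!%:R * expR (- a)) * expR (c * k%:R))%:E =
  (g * expR (a * (expR c - 1)))%:E.
Proof.
apply: nneseries_cvg.
rewrite (_ : (g * _)%R = (expR (a * expR c) * (g * expR (- a)))%R); last first.
  by rewrite mulrCA mulrA -mulrA -expRD; congr (_ * expR _)%R; ring.
rewrite (_ : series _ = fun n =>
   (series (exp_coeff (a * expR c)) n * (g * expR (- a)))%R).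
  by apply: cvgMl; exact: is_cvg_series_exp_coeff.
apply/funext => n; rewrite /series /= mulr_suml; apply: eq_bigr => k _.
rewrite /exp_coeff /= exprMn expRM_natr; ring.
Qed.

Lemma poisson_mean_series (a : R) :
  \sum_(k <oo) (k%:R * (a ^+ k / k`!%:R * expR (- a)))%:E = a%:E.
Proof.
apply: nneseries_cvg.
rewrite -cvg_shiftS.
rewrite (_ : [sequence _]_n = fun n => (series (exp_coeff a) n * (a * expR (- a)))%R).
  have e : (expR a * (a * expR (- a)) = a)%R.
    by rewrite mulrCA -expRD subrr expR0 mulr1.
  have : (fun n => series (exp_coeff a) n * (a * expR (- a)))%R @ \oo -->
      (expR a * (a * expR (- a)))%R.
    by apply: cvgMl; exact: is_cvg_series_exp_coeff.
  by rewrite e.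
apply/funext => n; rewrite /series /= big_nat_recl //= mul0r add0r mulr_suml.
apply: eq_bigr => k _; rewrite /exp_coeff /= factS natrM exprS.
have k0 : k.+1%:R != 0%R :> R by rewrite pnatr_eq0.
have f0 : k`!%:R != 0%R :> R by rewrite gt_eqF// ltr0n fact_gt0.
move: k0 f0; move: (k.+1%:R : R) => u; move: (k`!%:R : R) => v u0 v0; field; rewrite ?u0 ?v0 //.
Qed.

End poisson_series.

Section poisson_process.
Local Open Scope ereal_scope.
Context {R : realType} d' (T : measurableType d') (m : {measure set T -> \bar R}).
Context d (Omega : measurableType d) (P : probability Omega R).
Context (N : Omega -> {measure set T -> \bar R}).
Hypothesis hN : poisson_random_measure P m N.

Let mN A : measurable A -> measurable_fun setT (fun w => N w A).
Proof. by case: hN => h _ _ _; exact: h. Qed.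

Let lvl A (k : nat) : set Omega := [set w | N w A = k%:R%:E].

Let mlvl A k : measurable A -> measurable (lvl A k).
Proof.
move=> mA; rewrite -[lvl A k]setTI.
exact: (mN mA measurableT (emeasurable_set1 _)).
Qed.

Let pmf (A : set T) (k : nat) : R :=
  (fine (m A) ^+ k / k`!%:R * expR (- fine (m A)))%R.

Let Plvl A k : measurable A -> m A < +oo -> P (lvl A k) = (pmf A k)%:E.
Proof. by move=> mA fA; case: hN => _ h _ _; rewrite h. Qed.

Let tlvl A : trivIset setT (lvl A).
Proof.
apply/trivIsetP => i j _ _ ij; apply/seteqP; split=> // w [/= Ni Nj].
by move: ij; rewrite -(eqr_nat R) -eqe -Ni -Nj eqxx.
Qed.

Let mUlvl A : measurable A -> measurable (\bigcup_k lvl A k).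
Proof. by move=> mA; apply: bigcupT_measurable => k; exact: mlvl. Qed.

Let PUlvl A : measurable A -> m A < +oo -> P (~` \bigcup_k lvl A k) = 0.
Proof.
move=> mA fA; have mU := mUlvl mA; rewrite probability_setC//.
rewrite (measure_semi_bigcup P (fun k => mlvl k mA) (@tlvl A) mU).
rewrite (eq_eseriesr (g := fun k => (1 * (fine (m A) ^+ k / k`!%:R *
   expR (- fine (m A))) * expR (0 * k%:R))%:E)); last first.
  by move=> k _; rewrite mul0r expR0 mulr1 mul1r; exact: Plvl.
by rewrite poisson_mgf_series expR0 subrr mulr0 expR0 mulr1 subee.
Qed.

(** The Poisson probabilities sum to 1, so no mass is left for other values. *)
Lemma poisson_count_ae A : measurable A -> m A < +oo ->
  {ae P, forall w, exists k : nat, N w A = k%:R%:E}.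
Proof.
move=> mA fA; exists (~` \bigcup_k lvl A k); split.
- by apply: measurableC; exact: mUlvl.
- exact: PUlvl.
- by move=> w /= h; apply: contra_not h => -[k _ wk]; exists k.
Qed.

Let integral_lvl A (F : Omega -> \bar R) : measurable A -> m A < +oo ->
  measurable_fun setT F -> (forall w, 0 <= F w) ->
  \int[P]_w F w = \sum_(k <oo) \int[P]_(w in lvl A k) F w.
Proof.
move=> mA fA mF F0.
rewrite (ge0_negligible_integral (N := ~` \bigcup_k lvl A k))//; last 2 first.
  by apply: measurableC; exact: mUlvl.
  exact: PUlvl.
rewrite setTD setCK ge0_integral_bigcup//.
  by move=> k; exact: mlvl.
exact: measurable_funTS.
Qed.

Let measurable_exp_count A (c : R) : measurable A ->
  measurable_fun setT (fun w => expR (c * fine (N w A))).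
Proof.
move=> mA; apply: measurableT_comp => //; apply: measurable_funM => //.
by apply: (measurableT_comp (f := fine)) => //; exact: mN.
Qed.

(** Splitting over the number of points in A.  The hypothesis on G expresses, in
    integrated form, its independence of N(A); g is the mean of G. *)
Lemma poisson_mgf_step A (G : Omega -> R) (g c : R) :
  measurable A -> m A < +oo -> measurable_fun setT G -> (forall w, 0 <= G w)%R ->
  (forall k, \int[P]_(w in lvl A k) (G w)%:E = (g * pmf A k)%:E) ->
  \int[P]_w (G w * expR (c * fine (N w A)))%:E =
  (g * expR (fine (m A) * (expR c - 1)))%:E.
Proof.
move=> mA fA mG G0 hG.
rewrite (integral_lvl mA fA); last 2 first.
- by apply/measurable_EFinP; apply: measurable_funM => //; exact: measurable_exp_count.
- by move=> w; rewrite lee_fin mulr_ge0// expR_ge0.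
rewrite -poisson_mgf_series; apply: eq_eseriesr => k _.
rewrite (eq_integral (fun w => (expR (c * k%:R))%:E * (G w)%:E)); last first.
  by move=> w /set_mem wk; rewrite wk /= mulrC EFinM.
rewrite ge0_integralZl_EFin ?expR_ge0//; last 2 first.
- by move=> w _; rewrite lee_fin.
- by apply/measurable_EFinP; exact: measurable_funTS.
by rewrite hG -EFinM mulrC.
exact: mlvl.
Qed.

Section product.
Context (n : nat) (A : 'I_n -> set T) (c : 'I_n -> R).
Hypothesis mA : forall i, measurable (A i).
Hypothesis fA : forall i, m (A i) < +oo.
Hypothesis tA : trivIset setT A.

Let Y (j : nat) (E : 'I_n -> set (\bar R)) (i : 'I_n) (w : Omega) : R :=
  if (i < j)%N then expR (c i * fine (N w (A i))) else \1_(E i) (N w (A i)).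

Let y (j : nat) (E : 'I_n -> set (\bar R)) (i : 'I_n) : R :=
  if (i < j)%N then expR (fine (m (A i)) * (expR (c i) - 1))
  else fine (P ((fun w => N w (A i)) @^-1` E i)).

Let Y0 j E i w : (0 <= Y j E i w)%R.
Proof. by rewrite /Y; case: ifP => // _; exact: expR_ge0. Qed.

Let mY j E i : measurable (E i) -> measurable_fun setT (Y j E i).
Proof.
move=> mE; rewrite /Y; case: (i < j)%N; first exact: measurable_exp_count.
exact: (measurableT_comp (measurable_indic mE) (mN (mA i))).
Qed.

(** Independence is given for events, and is transferred to exponentials one
    factor at a time: the first j factors are already exponentials and the
    others are still indicators of arbitrary events E i.  Step j takes E j to be
    the event that N(A_j) has a given value and sums over this value. *)
Let mgf_product j E : (j <= n)%N -> (forall i, measurable (E i)) ->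
  \int[P]_w (\prod_i Y j E i w)%:E = (\prod_i y j E i)%:E.
Proof.
elim: j E => [|j IH] E jn mE.
  have indep : mutually_independent P (fun i w => N w (A i)).
    by case: hN => _ _ _; apply.
  have fP (i : 'I_n) : P ((fun w => N w (A i)) @^-1` E i) =
      (fine (P ((fun w => N w (A i)) @^-1` E i)))%:E by rewrite fineK// fin_num_measure// -[X in measurable X]setTI; exact: mN.
  rewrite -prodEFin -(eq_bigr _ (fun i _ => fP i)) -(indep E mE).
  rewrite -(setIT (\bigcap_(i in _) _)) -integral_indic//.
    apply: eq_integral => w _; congr (_%:E).
    rewrite indicE; have [/set_mem h|] := boolP (w \in _).
      by rewrite big1// => i _; rewrite /Y /= indicE mem_set//; exact: h.
    move=> /negP h; have [i hi] : exists i, ~ E i (N w (A i)).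
      apply/existsNP => h'; apply: h; rewrite inE => i _; exact: h'.
    by rewrite (bigD1 i)//= /Y /= indicE memNset// mul0r.
  by apply: fin_bigcap_measurable => // i _; rewrite -[X in measurable X]setTI; exact: mN.
pose i0 := Ordinal jn.
pose G w := (\prod_(i | i != i0) Y j E i w)%R.
have eY w : (\prod_i Y j.+1 E i w)%R = (G w * expR (c i0 * fine (N w (A i0))))%R.
  rewrite (bigD1 i0)//= mulrC; congr (_ * _)%R; last by rewrite /Y ltnSn.
  apply: eq_bigr => i ii0; rewrite /Y ltnS leq_eqVlt.
  by rewrite -val_eqE /= in ii0; rewrite (negbTE ii0).
have ey : (\prod_i y j.+1 E i)%R = ((\prod_(i | i != i0) y j E i) *
    expR (fine (m (A i0)) * (expR (c i0) - 1)))%R.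
  rewrite (bigD1 i0)//= mulrC; congr (_ * _)%R; last by rewrite /y ltnSn.
  apply: eq_bigr => i ii0; rewrite /y ltnS leq_eqVlt.
  by rewrite -val_eqE /= in ii0; rewrite (negbTE ii0).
under eq_integral do rewrite eY.
rewrite ey; apply: poisson_mgf_step => //.
- rewrite /G; under eq_fun do rewrite big_mkcond.
  by apply: measurable_prod => i _; case: (i != i0) => //; exact: mY.
- by move=> w; exact: prodr_ge0.
move=> k.
(* the mean of G on the event N(A_j) = k is given by the induction hypothesis,
   with this event in place of E j *)
pose E' i := if i == i0 then [set k%:R%:E] else E i.
have mE' i : measurable (E' i).
  by rewrite /E'; case: ifP => // _; exact: emeasurable_set1.
have IH' := IH E' (ltnW jn) mE'.
have yi0 : y j E' i0 = pmf (A i0) k.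
  rewrite /y ltnn /E' eqxx.
  have -> : P ((fun w => N w (A i0)) @^-1` [set k%:R%:E]) = (pmf (A i0) k)%:E.
    by rewrite -Plvl.
  by [].
rewrite [in RHS](bigD1 i0)//= yi0 in IH'; rewrite mulrC.
have -> : (\prod_(i | i != i0) y j E i = \prod_(i | i != i0) y j E' i)%R.
  by apply: eq_bigr => i /negbTE ii0; rewrite /y /E' ii0.
rewrite -IH' integral_mkcond; apply: eq_integral => w _.
have Yi0 : Y j E' i0 w = (N w (A i0) \in [set k%:R%:E])%:R.
  by rewrite /Y ltnn /E' eqxx indicE.
rewrite (bigD1 i0)//= Yi0 /patch.
have -> : (\prod_(i < n | i != i0) Y j E' i w)%R = G w.
  by apply: eq_bigr => i /negbTE ii0; rewrite /Y /E' ii0.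
have -> : (w \in lvl (A i0) k) = (N w (A i0) \in [set k%:R%:E]).
  by apply/idP/idP; rewrite !inE.
by case: ifP => _; rewrite ?mul1r ?mul0r.
Qed.

Lemma poisson_mgf_product :
  \int[P]_w (\prod_i expR (c i * fine (N w (A i))))%:E =
  (\prod_i expR (fine (m (A i)) * (expR (c i) - 1)))%:E.
Proof.
have := mgf_product (leqnn n) (fun i => measurableT).
rewrite /Y /y; under eq_integral do under eq_bigr do rewrite ltn_ord.
by under [in RHS]eq_bigr do rewrite ltn_ord.
Qed.

End product.

(** The mean of a Poisson count, read off from the written-out probabilities;
    sets of infinite intensity contain infinitely many points almost surely. *)
Lemma poisson_mean A : measurable A -> \int[P]_w N w A = m A.
Proof.
move=> mA; have [fA|] := ltP (m A) +oo; last first.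
  rewrite leye_eq => /eqP mAoo; rewrite mAoo.
  case: hN => _ _ /(_ A mA mAoo) hoo _.
  rewrite (ge0_ae_eq_integral (g := cst +oo))//; last 3 first.
  - exact: mN.
  - by move=> w _ /=; exact: leey.
  - by apply: filterS hoo => w h _; rewrite h.
  by rewrite integral_cst//= [X in _ * X]probability_setT mule1.
rewrite (integral_lvl mA fA)//; last exact: mN.
have -> : m A = (fine (m A))%:E by rewrite fineK// ge0_fin_numE.
rewrite -[RHS]poisson_mean_series; apply: eq_eseriesr => k _.
rewrite (eq_integral (fun=> k%:R%:E)); last by move=> w /set_mem wk; rewrite wk.
rewrite integral_cst; last exact: mlvl.
by rewrite [X in _ * X](Plvl k mA fA).
Qed.

Lemma measurable_poisson_integral (f : T -> \bar R) : measurable_fun setT f ->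
  (forall x, 0 <= f x) -> measurable_fun setT (fun w => \int[N w]_x f x).
Proof. by move=> mf f0; apply: measurable_fun_integral_kernel. Qed.

(** Campbell's formula, by uniqueness of the integral: the case of indicators is
    [poisson_mean]. *)
Lemma campbell (f : T -> \bar R) : measurable_fun setT f ->
  (forall x, 0 <= f x) -> \int[P]_w \int[N w]_x f x = \int[m]_x f x.
Proof.
move=> mf f0.
apply: (integral_likeE (Phi := fun f => \int[P]_w \int[N w]_x f x)) => //; split.
- move=> A mA; rewrite -poisson_mean//; apply: eq_integral => w _.
  by rewrite integral_indic// setIT.
- move=> g1 g2 mg1 g10 mg2 g20; rewrite -ge0_integralD//; last 4 first.
  + by move=> w _; exact: integral_ge0.
  + exact: measurable_poisson_integral.
  + by move=> w _; exact: integral_ge0.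
  + exact: measurable_poisson_integral.
  by apply: eq_integral => w _; rewrite ge0_integralD.
- move=> r g r0 mg g0; rewrite -ge0_integralZl_EFin//; last 2 first.
  + by move=> w _; exact: integral_ge0.
  + exact: measurable_poisson_integral.
  by apply: eq_integral => w _; rewrite ge0_integralZl_EFin.
- move=> g_ mg g0 ndg.
  have e : \int[P]_w \int[N w]_x limn (g_^~ x) =
      \int[P]_w limn (fun n => \int[N w]_x g_ n x).
    apply: eq_integral => w _; apply/esym/cvg_lim => //.
    exact: cvg_monotone_convergence.
  rewrite e; apply: cvg_monotone_convergence => //.
  + by move=> n; exact: measurable_poisson_integral.
  + by move=> n w _; exact: integral_ge0.
  + by move=> w _ n k nk; apply: ge0_le_integral => // x _; exact: ndg.
Qed.

End poisson_process.

(** * Poisson integrals of step functions *)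

Section convergence_tools.
Context d (T : measurableType d) {R : realType} (mu : {measure set T -> \bar R}).

Lemma Rintegral_dominated (f_ : nat -> T -> R) (f g : T -> R) :
  (forall n, measurable_fun setT (f_ n)) -> measurable_fun setT f ->
  mu.-integrable setT (EFin \o g) ->
  {ae mu, forall x, f_ ^~ x @ \oo --> f x} ->
  {ae mu, forall x, forall n, `|f_ n x| <= g x} ->
  mu.-integrable setT (EFin \o f) /\
  \int[mu]_x f_ n x @[n --> \oo] --> \int[mu]_x f x.
Proof.
move=> mf_ mf ig cf fg.
have [] := @dominated_convergence _ _ _ mu setT measurableT (fun n => EFin \o f_ n)
  (EFin \o f) (EFin \o g).
- by move=> n; exact/measurable_EFinP.
- exact/measurable_EFinP.
- by apply: filterS cf => x h _; apply: cvg_EFin; [exact: nearW|exact: h].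
- exact: ig.
- by apply: filterS fg => x h n _; rewrite /= lee_fin.
move=> iF _ c; split => //.
apply: fine_cvg; rewrite fineK//; last exact: integrable_fin_num.
Qed.

Lemma integrable_bound (f g : T -> R) : measurable_fun setT f ->
  mu.-integrable setT (EFin \o g) -> (forall x, `|f x| <= g x) ->
  mu.-integrable setT (EFin \o f).
Proof.
move=> mf ig fg; apply: (le_integrable measurableT _ _ ig).
  exact/measurable_EFinP.
by move=> x _; rewrite /= lee_fin (le_trans (fg x))// ler_norm.
Qed.

Lemma integrable_indic_fin A : measurable A -> (mu A < +oo)%E ->
  mu.-integrable setT (fun x => (\1_A x)%:E).
Proof.
move=> mA fA; apply/integrableP; split.
  exact/measurable_EFinP/measurable_indic.
under eq_integral do rewrite gee0_abs ?lee_fin//.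
by rewrite integral_indic// setIT.
Qed.

Section steps.
Context (S : T -> R) (s : seq R).
Hypothesis mS : measurable_fun setT S.
Hypothesis us : uniq s.
Hypothesis s0 : 0 \notin s.
Hypothesis Ss : forall x, S x = 0 \/ S x \in s.
Hypothesis fS : forall y, y \in s -> (mu (S @^-1` [set y]) < +oo)%E.

Let A (i : 'I_(size s)) : set T := S @^-1` [set s`_i].

Let mA i : measurable (A i).
Proof. by rewrite -[A i]setTI; exact: mS. Qed.

Lemma Rintegral_steps (h : R -> R) : h 0 = 0 ->
  \int[mu]_x h (S x) = \sum_(i < size s) h s`_i * fine (mu (A i)).
Proof.
move=> h0.
have hE x : h (S x) = \sum_(i < size s) h s`_i * \1_(A i) x.
  have [Sx0|Sxs] := Ss x.
    rewrite Sx0 h0 big1// => i _; rewrite indicE memNset ?mulr0// /A /= Sx0 => e.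
    by move: s0; rewrite e mem_nth.
  have ix : (index (S x) s < size s)%N by rewrite index_mem.
  rewrite (bigD1 (Ordinal ix))//= big1 ?addr0 => [|i].
    by rewrite indicE mem_set ?mulr1 /A/= nth_index.
  rewrite -val_eqE /= => /eqP ne; rewrite indicE memNset ?mulr0// /A /= => e.
  by apply: ne; rewrite e index_uniq.
have iI (i : 'I_(size s)) : mu.-integrable setT (EFin \o (fun x => h s`_i * \1_(A i) x)).
  rewrite (_ : _ \o _ = fun x => ((h s`_i)%:E * (\1_(A i) x)%:E)%E)//.
  apply: integrableZl => //; apply: integrable_indic_fin => //.
  exact/fS/mem_nth.
rewrite /Rintegral.
rewrite (eq_integral (fun x => \sum_(i < size s) (h s`_i * \1_(A i) x)%:E)%E); last first.
  by move=> x _; rewrite sumEFin hE.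
rewrite (integral_sum measurableT iI).
rewrite (eq_bigr (fun i : 'I_(size s) => (h s`_i * fine (mu (A i)))%:E)) ?sumEFin// => i _.
rewrite -[LHS]fineK; last exact: integrable_fin_num.
congr (_%:E); rewrite [LHS]RintegralZl//; last first.
  by apply: integrable_indic_fin => //; exact/fS/mem_nth.
by congr (_ * _); rewrite /Rintegral integral_indic// setIT.
Qed.

End steps.
End convergence_tools.

Section poisson_mgf.
Context {R : realType} d' (T : measurableType d') (m : {measure set T -> \bar R}).
Context d (Omega : measurableType d) (P : probability Omega R).
Context (N : Omega -> {measure set T -> \bar R}).
Hypothesis hN : poisson_random_measure P m N.

Lemma measurable_poisson_Rintegral (f : T -> R) : measurable_fun setT f ->
  measurable_fun setT (fun w => \int[N w]_x f x).
Proof.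
move=> mf; have mF : measurable_fun setT (EFin \o f) by exact/measurable_EFinP.
apply: (measurableT_comp (f := fine)) => //.
under eq_fun do rewrite integralE.
apply: emeasurable_funB; apply: (measurable_poisson_integral hN) => //.
- exact: measurable_funepos.
- exact: measurable_funeneg.
Qed.

(** A step function has a Poisson integral that is a linear combination of
    independent Poisson counts on disjoint sets. *)
Lemma poisson_mgf_steps (S : T -> R) (s : seq R) : measurable_fun setT S ->
  uniq s -> 0 \notin s -> (forall x, S x = 0 \/ S x \in s) ->
  (forall y, y \in s -> (m (S @^-1` [set y]) < +oo)%E) ->
  (\int[P]_w (expR (\int[N w]_x S x))%:E = (expR (\int[m]_x (expR (S x) - 1)))%:E)%E.
Proof.
move=> mS us s0 Ss fS.
pose A (i : 'I_(size s)) : set T := S @^-1` [set s`_i].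
have mA i : measurable (A i) by rewrite -[A i]setTI; exact: mS.
have fA i : (m (A i) < +oo)%E by exact/fS/mem_nth.
have tA : trivIset setT A.
  apply/trivIsetP => i j _ _ ij; apply/seteqP; split=> // x [/= Si Sj].
  by move/eqP : ij; apply; apply/val_inj/eqP; rewrite -(nth_uniq 0 _ _ us)//= -Si Sj.
rewrite (Rintegral_steps mS us s0 Ss fS (h := fun y => expR y - 1)) ?expR0 ?subrr//.
have mN i : measurable_fun setT (fun w => N w (A i)) by case: hN => + _ _ _; apply.
have h : {ae P, forall w i, exists k : nat, N w (A i) = k%:R%:E}.
  by apply: filter_forall => i; exact: (poisson_count_ae hN).
have := poisson_mgf_product hN (fun i => s`_i) mA fA tA.
under [in RHS]eq_bigr do rewrite mulrC.
rewrite -expR_sum => <-; apply: ae_eq_integral => //.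
- apply/measurable_EFinP; apply: measurableT_comp => //.
  exact: measurable_poisson_Rintegral.
- apply/measurable_EFinP; apply: measurable_prod => i _.
  apply: measurableT_comp => //; apply: measurable_funM => //.
  exact: (measurableT_comp (f := fine)).
- apply: filterS h => w h _; rewrite -expR_sum; congr (expR _)%:E.
  apply: (Rintegral_steps mS us s0 Ss _ (h := id)) => // y ys.
  have iy : (index y s < size s)%N by rewrite index_mem.
  have [k] := h (Ordinal iy); rewrite /A /= nth_index// => ->.
  by rewrite ltry.
Qed.

End poisson_mgf.

(** * Integrability and expectation of Poisson integrals *)

Section poisson_integral.
Context {R : realType} d' (T : measurableType d') (m : {measure set T -> \bar R}).
Context d (Omega : measurableType d) (P : probability Omega R).
Context (N : Omega -> {measure set T -> \bar R}).
Hypothesis hN : poisson_random_measure P m N.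

Section integrable.
Context (f : T -> R).
Hypothesis mf : measurable_fun setT f.
Hypothesis fi : m.-integrable setT (EFin \o f).

Let mF : measurable_fun setT (EFin \o f). Proof. exact/measurable_EFinP. Qed.

Let parts (g : T -> \bar R) : measurable_fun setT g -> (forall x, 0 <= g x)%E ->
  (\int[m]_x g x < +oo)%E -> P.-integrable setT (fun w => \int[N w]_x g x)%E.
Proof.
move=> mg g0 fg; apply/integrableP; split.
  exact: (measurable_poisson_integral hN).
under eq_integral do rewrite gee0_abs ?integral_ge0//.
by rewrite (campbell hN).
Qed.

(** By Campbell's formula int |f| dN has finite mean, hence is almost surely
    finite. *)
Lemma poisson_integrable_ae : {ae P, forall w, (N w).-integrable setT (EFin \o f)}.
Proof.
have mA : measurable_fun setT (fun x => `|(f x)%:E|)%E by exact: measurableT_comp.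
have fA : (\int[m]_x `|(f x)%:E| < +oo)%E by case/integrableP : fi.
have := integrable_ae measurableT (parts mA (fun x => abse_ge0 _) fA).
apply: filterS => w /(_ I) h; apply/integrableP; split => //.
by rewrite ltey_eq h.
Qed.

Lemma poisson_expectation :
  P.-integrable setT (EFin \o (fun w => \int[N w]_x f x)) /\
  \int[P]_w \int[N w]_x f x = \int[m]_x f x.
Proof.
pose fp : T -> \bar R := ((EFin \o f)^\+)%E.
pose fn : T -> \bar R := ((EFin \o f)^\-)%E.
have mp : measurable_fun setT fp by exact: measurable_funepos.
have mn : measurable_fun setT fn by exact: measurable_funeneg.
have ip : (\int[m]_x fp x < +oo)%E.
  exact: (integrable_lty measurableT (integrable_funepos measurableT fi)).
have im : (\int[m]_x fn x < +oo)%E.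
  exact: (integrable_lty measurableT (integrable_funeneg measurableT fi)).
have iP := parts mp (fun x => funepos_ge0 _ x) ip.
have iM := parts mn (fun x => funeneg_ge0 _ x) im.
have ae : ae_eq P setT (fun w => \int[N w]_x fp x - \int[N w]_x fn x)%E
    (EFin \o (fun w => \int[N w]_x f x)).
  apply: filterS poisson_integrable_ae => w iw _.
  by rewrite -integralE /= fineK//; exact: integrable_fin_num.
have mJ : measurable_fun setT (EFin \o (fun w => \int[N w]_x f x)).
  by apply/measurable_EFinP; exact: (measurable_poisson_Rintegral hN).
have iB : P.-integrable setT (fun w => \int[N w]_x fp x - \int[N w]_x fn x)%E.
  exact: integrableB.
have mB : measurable_fun setT (fun w => \int[N w]_x fp x - \int[N w]_x fn x)%E.
  by case/integrableP : iB.
split.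
  apply/integrableP; split => //.
  rewrite (ae_eq_integral (fun w => `|\int[N w]_x fp x - \int[N w]_x fn x|)%E) => //.
  - by case/integrableP : iB.
  - exact: measurableT_comp.
  - exact: measurableT_comp.
  - by apply: filterS ae => w /(_ I) /= ->.
rewrite [LHS]/Rintegral -(ae_eq_integral _ _ measurableT mB mJ ae).
rewrite integralB// !(campbell hN)//.
  by rewrite -integralE.
- by move=> x; exact: funeneg_ge0.
- by move=> x; exact: funepos_ge0.
Qed.

End integrable.

(** The differences of two simple functions are the step functions used to
    approximate signed integrands.  A nonzero level y is attained on a set of
    finite intensity because |f| >= |y| there. *)
Lemma poisson_mgf_simple (p q : {nnsfun T >-> R}) (f : T -> R) :
  m.-integrable setT (EFin \o f) -> (forall x, `|p x - q x| <= `|f x|) ->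
  (\int[P]_w (expR (\int[N w]_x (p x - q x)))%:E =
   (expR (\int[m]_x (expR (p x - q x) - 1)))%:E)%E.
Proof.
move=> fi pqf.
pose s := undup [seq y <- [seq a - b | a <- finmap.enum_fset (fset_set (range p)),
  b <- finmap.enum_fset (fset_set (range q))] | y != 0].
have mS : measurable_fun setT (fun x => p x - q x) by exact: measurable_funB.
apply: (poisson_mgf_steps hN (s := s)) => //.
- exact: undup_uniq.
- by rewrite mem_undup mem_filter eqxx.
- move=> x; have [->|ne] := eqVneq (p x - q x) 0; [by left|right].
  rewrite mem_undup mem_filter ne /=; apply/allpairsP; exists (p x, q x); split => //=.
    by rewrite in_fset_set// inE; exists x.
  by rewrite in_fset_set// inE; exists x.
- move=> y; rewrite mem_undup mem_filter => /andP[y0 _].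
  set A := _ @^-1` _.
  have mA : measurable A by rewrite -[A]setTI; exact: mS.
  have : (`|y|%:E * m A < +oo)%E.
    apply: (@le_lt_trans _ _ (\int[m]_x `|(f x)%:E|)%E); last by case/integrableP : fi.
    rewrite -(setTI A) -(setIT (setT `&` A)) -integral_indic ?setTI// -ge0_integralZl_EFin//; last first.
      exact/measurable_EFinP/measurable_indic.
    apply: ge0_le_integral => //.
    - by apply: measurable_funeM; exact/measurable_EFinP/measurable_indic.
    - apply: measurableT_comp => //; by case/integrableP : fi.
    - move=> x _; rewrite -EFinM lee_fin indicE; have [|] := boolP (x \in A).
        by rewrite inE /A /= => <-; rewrite mulr1.
      by rewrite mulr0.
  have [//|] := ltP (m A) +oo%E; rewrite leye_eq => /eqP ->.
  by rewrite gt0_muley ?ltxx// lte_fin normr_gt0.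
Qed.

End poisson_integral.

(** * Exponential moments of Poisson integrals *)

Section approximation.
Context d (T : measurableType d) {R : realType} (g : T -> R).
Hypothesis mg : measurable_fun setT g.
Hypothesis g0 : forall x, 0 <= g x.

Lemma nnsfun_approx_real : exists p : nat -> {nnsfun T >-> R},
  (forall x, p ^~ x @ \oo --> g x) /\ (forall n x, p n x <= g x).
Proof.
have mG : measurable_fun setT (EFin \o g) by exact/measurable_EFinP.
pose p := nnsfun_approx measurableT mG.
have cp x : p ^~ x @ \oo --> g x.
  have : (EFin \o p ^~ x) n @[n --> \oo] --> (EFin \o g) x.
    by apply: cvg_nnsfun_approx => // y _ /=; rewrite lee_fin.
  by move/fine_cvg.
exists p; split => // n x; rewrite -(cvg_lim _ (cp x))//.
apply: nondecreasing_cvgn_le; last by apply/cvg_ex; exists (g x); exact: cp.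
by move=> i j ij; exact/lefP/nd_nnsfun_approx.
Qed.

End approximation.

Section poisson_mgf.
Context {R : realType} d' (T : measurableType d') (m : {measure set T -> \bar R}).
Context d (Omega : measurableType d) (P : probability Omega R).
Context (N : Omega -> {measure set T -> \bar R}).
Hypothesis hN : poisson_random_measure P m N.
Context (f : T -> R) (K : R).
Hypothesis mf : measurable_fun setT f.
Hypothesis fi : m.-integrable setT (EFin \o f).
Hypothesis fK : forall x, `|f x| <= K.

Let expRB1_bound (y z : R) : `|y| <= `|z| -> `|z| <= K -> `|expR y - 1| <= expR K * `|z|.
Proof.
move=> yz zK; apply: (le_trans (exp_taylor1 y)); rewrite mulrC.
by rewrite ler_pM ?expR_ge0// ler_expR (le_trans yz).
Qed.

Let iabs : m.-integrable setT (EFin \o (fun x => `|f x|)).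
Proof. exact: integrable_norm. Qed.

Let idom : m.-integrable setT (EFin \o (fun x => expR K * `|f x|)).
Proof.
exact: integrable_scale.
Qed.

Let mexp (g : T -> R) : measurable_fun setT g ->
  measurable_fun setT (fun x => expR (g x) - 1).
Proof. by move=> mg; apply: measurable_funB => //; exact: measurableT_comp. Qed.

Let aeN := poisson_integrable_ae hN mf fi.

(** Integrability of exp(int |f| dN), which will dominate: Fatou's lemma along
    simple functions increasing to |f|, whose exponential moments are bounded by
    exp(int exp(K) |f| dm). *)
Let dominator :
  P.-integrable setT (EFin \o (fun w => expR (\int[N w]_x `|f x|))).
Proof.
have mnf : measurable_fun setT (fun x => `|f x|) by exact: measurableT_comp.
have [p [cp pf]] := nnsfun_approx_real mnf (fun x => normr_ge0 _).
pose q : {nnsfun T >-> R} := nnsfun0.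
have q0 x : q x = 0 by [].
have pn (n : nat) (x : T) : `|p n x| <= `|f x| by rewrite ger0_norm// pf.
have mgf n : (\int[P]_w (expR (\int[N w]_x p n x))%:E =
    (expR (\int[m]_x (expR (p n x) - 1)))%:E)%E.
  have h : forall x, `|p n x - q x| <= `|f x| by move=> x; rewrite q0 subr0.
  have := poisson_mgf_simple hN fi h.
  have -> : (fun x => p n x - q x) = p n by apply/funext => x; rewrite q0 subr0.
  by have -> : (fun x => expR (p n x - q x) - 1) = fun x => expR (p n x) - 1
    by apply/funext => x; rewrite q0 subr0.
pose C := expR (\int[m]_x (expR K * `|f x|)).
have mgf_le n : (\int[P]_w (expR (\int[N w]_x p n x))%:E <= C%:E)%E.
  rewrite mgf lee_fin ler_expR; apply: le_Rintegral => //.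
    apply: (integrable_bound _ idom) => [|x]; first exact: mexp.
    exact: expRB1_bound.
  by move=> x _; apply: le_trans (ler_norm _) _; exact: expRB1_bound.
have mE n : measurable_fun setT (fun w => (expR (\int[N w]_x p n x))%:E).
  apply/measurable_EFinP; apply: measurableT_comp => //.
  exact: (measurable_poisson_Rintegral hN).
have mE' : measurable_fun setT (fun w => (expR (\int[N w]_x `|f x|))%:E).
  apply/measurable_EFinP; apply: measurableT_comp => //.
  exact: (measurable_poisson_Rintegral hN).
apply/integrableP; split => //.
under eq_integral do rewrite gee0_abs ?lee_fin ?expR_ge0//.
apply: (@le_lt_trans _ _ C%:E); last by rewrite ltry.
have -> : (\int[P]_w (expR (\int[N w]_x `|f x|))%:E =
    \int[P]_w limn_einf (fun n => (expR (\int[N w]_x p n x))%:E))%E.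
  apply: ae_eq_integral => //.
    rewrite (_ : (fun w => _) = (fun w => - limn_esup (fun n =>
       - (expR (\int[N w]_x p n x))%:E))%E).
      apply: measurableT_comp => //; apply: measurable_fun_limn_esup => n.
      exact: measurableT_comp.
    by apply/funext => w; rewrite -limn_einfN; congr limn_einf;
      apply/funext => n /=; rewrite opprK.
  apply: filterS aeN => w iw _.
  have [_ c] := @Rintegral_dominated _ T R (N w) (fun n => p n) (fun x => `|f x|)
    (fun x => `|f x|) (fun n => measurable_funPT (p n)) mnf (integrable_norm iw)
    (aeW _ cp) (aeW _ (fun x n => pn n x)).
  have c' : (fun n => (expR (\int[N w]_x p n x))%:E) @ \oo -->
      (expR (\int[N w]_x `|f x|))%:E.
    apply: cvg_EFin; first exact: nearW.
    by apply: continuous_cvg; [exact: continuous_expR|exact: c].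
  rewrite is_cvg_limn_einfE; last by apply/cvg_ex; eexists; exact: c'.
  by apply/esym/cvg_lim.
apply: le_trans (fatou P measurableT mE _) _ => //.
rewrite limn_einf_lim; apply: lime_le; first exact: is_cvg_einfs.
apply: nearW => n; apply: (le_trans _ (mgf_le n)).
by apply: ereal_inf_lbound; exists n => /=.
Qed.

(** The exponential moment formula extends from step functions to bounded
    integrable ones by dominated convergence, both under P and under m. *)
Theorem poisson_mgf :
  P.-integrable setT (EFin \o (fun w => expR (\int[N w]_x f x))) /\
  \int[P]_w expR (\int[N w]_x f x) = expR (\int[m]_x (expR (f x) - 1)).
Proof.
have mfp : measurable_fun setT (fun x => Num.max (f x) 0) by exact: measurable_maxr.
have mfn : measurable_fun setT (fun x => Num.max (- f x) 0).
  by apply: measurable_maxr => //; exact: measurableT_comp.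
have [p [cp pf]] := nnsfun_approx_real mfp (fun x => ltac:(by rewrite le_max lexx orbT)).
have [q [cq qf]] := nnsfun_approx_real mfn (fun x => ltac:(by rewrite le_max lexx orbT)).
pose S n x := p n x - q n x.
have Sf n x : `|S n x| <= `|f x|.
  have p0 : 0 <= p n x by []. have q0 : 0 <= q n x by [].
  have := pf n x; have := qf n x; rewrite /S ler_norml !maxEle.
  case: (lerP (f x) 0) => fx; case: (lerP (- f x) 0) => fx' *.
  - rewrite ler0_norm//; apply/andP; split; lra.
  - rewrite ler0_norm//; apply/andP; split; lra.
  - rewrite gtr0_norm//; apply/andP; split; lra.
  - rewrite gtr0_norm//; apply/andP; split; lra.
have cS x : S ^~ x @ \oo --> f x.
  have -> : f x = Num.max (f x) 0 - Num.max (- f x) 0.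
    by rewrite !maxEle oppr_le0; case: lerP => fx; case: lerP => fx'; lra.
  by apply: cvgB; [exact: cp|exact: cq].
have mS n : measurable_fun setT (S n) by exact: measurable_funB.
have [iE cE] : P.-integrable setT (EFin \o (fun w => expR (\int[N w]_x f x))) /\
   \int[P]_w expR (\int[N w]_x S n x) @[n --> \oo] -->
   \int[P]_w expR (\int[N w]_x f x).
  apply: (Rintegral_dominated _ _ dominator).
  - by move=> n; apply: measurableT_comp => //; exact: (measurable_poisson_Rintegral hN).
  - by apply: measurableT_comp => //; exact: (measurable_poisson_Rintegral hN).
  - apply: filterS aeN => w iw.
    have [_ c] := @Rintegral_dominated _ T R (N w) S f (fun x => `|f x|) mS mf
      (integrable_norm iw) (aeW _ cS) (aeW _ (fun x n => Sf n x)).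
    by apply: continuous_cvg; [exact: continuous_expR|exact: c].
  - apply: filterS aeN => w iw n; rewrite ger0_norm ?expR_ge0// ler_expR.
    have iS : (N w).-integrable setT (EFin \o S n).
      by apply: (integrable_bound (mS n) (integrable_norm iw)) => x; exact: Sf.
    apply: le_Rintegral => //; first exact: (integrable_norm iw).
    by move=> x _; apply: le_trans (ler_norm _) (Sf n x).
split => //.
have [_ cm] : m.-integrable setT (EFin \o (fun x => expR (f x) - 1)) /\
   \int[m]_x (expR (S n x) - 1) @[n --> \oo] --> \int[m]_x (expR (f x) - 1).
  apply: (Rintegral_dominated _ _ idom).
  - by move=> n; exact: mexp.
  - exact: mexp.
  - apply: aeW => x; apply: cvgB; last exact: cvg_cst.
    by apply: continuous_cvg; [exact: continuous_expR|exact: cS].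
  - by apply: aeW => x n; exact: expRB1_bound.
have cm' : expR (\int[m]_x (expR (S n x) - 1)) @[n --> \oo] -->
    expR (\int[m]_x (expR (f x) - 1)).
  by apply: continuous_cvg; [exact: continuous_expR|exact: cm].
have e n : expR (\int[m]_x (expR (S n x) - 1)) = \int[P]_w expR (\int[N w]_x S n x).
  by rewrite [RHS]/Rintegral (poisson_mgf_simple hN fi (Sf n)).
rewrite (_ : (fun n => _) = fun n => \int[P]_w expR (\int[N w]_x S n x)) in cm'.
  exact: (cvg_unique _ cE cm').
by apply/funext.
Qed.

End poisson_mgf.

(** * Scaling of Lebesgue measure *)

(** Bundles the push-forward as a measure without making it canonical. *)
Lemma pushforward_measure_exists d1 d2 (T1 : measurableType d1) (T2 : measurableType d2)
    (R : realType) (m : {measure set T1 -> \bar R}) (f : T1 -> T2) :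
  measurable_fun setT f ->
  exists nu : {measure set T2 -> \bar R}, (nu : set T2 -> \bar R) = pushforward m f.
Proof.
move=> mf; unshelve eexists.
  unshelve refine (pushforward m f : {measure set T2 -> \bar R}).
  exact: mf.
by [].
Qed.

Section scaling.
Context {R : realType}.
Local Open Scope ereal_scope.
Notation leb := (@lebesgue_measure R).

Let mscale_fun (r : R) : measurable_fun setT (fun x : measurableTypeR R => (r * x)%R : measurableTypeR R).
Proof. exact: measurable_funM. Qed.

(** Lebesgue measure is determined by its values on half-open intervals. *)
Let lebesgue_scale (r : R) (r0 : (0 < r)%R) (A : set (measurableTypeR R)) : measurable A ->
  leb A = r%:E * leb [set x | A (r * x)%R].
Proof.
move=> mA.
have [nu0 nu0E] := pushforward_measure_exists leb (mscale_fun r).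
have nu0X X : nu0 X = leb [set x | X (r * x)%R] by exact: (congr1 (fun F => F X) nu0E).
pose nu : {measure set (measurableTypeR R) -> \bar R} := mscale (NngNum (ltW r0)) nu0.
have nuE X : nu X = r%:E * leb [set x | X (r * x)%R].
  by rewrite -nu0X.
rewrite (@lebesgue_measure_unique _ nu)// => X [[a b] /= ab <-].
rewrite nuE.
have -> : [set x | `]a, b]%classic (r * x)%R] = `](a / r)%R, (b / r)%R]%classic.
  apply/seteqP; split => x /=; rewrite !in_itv /= ltr_pdivrMr// ler_pdivlMr// mulrC//.
rewrite !lebesgue_measure_itv /= !lte_fin ltr_pM2r ?invr_gt0//.
case: ifP => _; last by rewrite mule0.
by rewrite -!EFinB -EFinM -mulrBl mulrCA divff ?mulr1// gt_eqF.
Qed.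

Lemma integral_lebesgue_scale (r : R) (h : R -> \bar R) : (0 < r)%R ->
  measurable_fun setT h -> (forall x, 0 <= h x) ->
  \int[leb]_x h x = r%:E * \int[leb]_x h (r * x)%R.
Proof.
move=> r0 mh h0.
have [nu0 nu0E] := pushforward_measure_exists leb (mscale_fun r).
have nu0X X : nu0 X = leb [set x | X (r * x)%R] by exact: (congr1 (fun F => F X) nu0E).
rewrite (eq_measure_integral (mscale (NngNum (ltW r0)) nu0)); last first.
  move=> A mA _; have := lebesgue_scale r0 mA; rewrite -nu0X => e.
  by first [exact: e | exact: esym e].
rewrite ge0_integral_mscale//= nu0E.
by rewrite ge0_integral_pushforward//.
Qed.

Lemma integral_leb2 (h : plane R -> \bar R) : measurable_fun setT h ->
  (forall x, 0 <= h x) -> \int[leb2]_z h z = \int[leb]_x \int[leb]_y h (x, y).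
Proof. by move=> mh h0; rewrite fubini_tonelli1. Qed.

Lemma measurable_plane_scale (r : R) :
  measurable_fun setT (fun z : plane R => ((r * z.1)%R, (r * z.2)%R) : plane R).
Proof. by apply: measurable_fun_pair; apply: measurable_funM. Qed.

Lemma integral_leb2_scale (r : R) (h : plane R -> \bar R) : (0 < r)%R ->
  measurable_fun setT h -> (forall x, 0 <= h x) ->
  \int[leb2]_z h z = (r ^+ 2)%:E * \int[leb2]_z h ((r * z.1)%R, (r * z.2)%R).
Proof.
move=> r0 mh h0.
have mhs := measurableT_comp mh (measurable_plane_scale r).
rewrite !integral_leb2//.
have mF : measurable_fun setT (fun x : measurableTypeR R => \int[leb]_y h (x, y)).
  exact: (measurable_fun_fubini_tonelli_F (m2 := leb)).
rewrite (integral_lebesgue_scale r0 mF); last by move=> x; exact: integral_ge0.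
rewrite expr2 EFinM -muleA; congr (_ * _).
rewrite -ge0_integralZl_EFin//; last 3 first.
- by move=> x _; exact: integral_ge0.
- apply: (@measurable_fun_fubini_tonelli_F _ _ _ _ _ leb
    (fun z : plane R => h ((r * z.1)%R, (r * z.2)%R))) => //.
- exact: ltW.
apply: eq_integral => x _ /=.
by rewrite (integral_lebesgue_scale r0 (h := fun y => h ((r * x)%R, y)))//; exact: measurableT_comp.
Qed.

Lemma integral_leb2_prod (g1 g2 : R -> \bar R) :
  measurable_fun setT g1 -> (forall x, 0 <= g1 x) ->
  measurable_fun setT g2 -> (forall x, 0 <= g2 x) ->
  \int[leb2]_z (g1 z.1 * g2 z.2) = \int[leb]_x g1 x * \int[leb]_y g2 y.
Proof.
move=> mg1 g10 mg2 g20; rewrite integral_leb2; last 2 first.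
- by apply: emeasurable_funM; apply: measurableT_comp.
- by move=> z; rewrite mule_ge0.
rewrite (eq_integral (fun x : measurableTypeR R => g1 x * \int[leb]_y g2 y)); last first.
  by move=> x _ /=; rewrite ge0_integralZl.
by rewrite ge0_integralZr//; exact: integral_ge0.
Qed.

End scaling.

(** * Power tails on the half-line *)

Section one_dimensional_tails.
Context {R : realType}.
Notation leb := (@lebesgue_measure R).

(** The power density of the limit, extended by 0. *)
Definition tail (gamma u : R) : R := if 0 < u then u `^ (- gamma - 1) else 0.
(** The bound in each direction allowed by the index space of the field. *)
Definition wmin (alpha u : R) : R := Num.min u (u `^ alpha).
(** Extending a density by 0 lets all integrals run over the whole line. *)
Definition halfline (f : R -> R) : R -> R := f \_ `]0, +oo[%classic.

Lemma tail_ge0 gamma u : 0 <= tail gamma u.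
Proof. by rewrite /tail; case: ifP => // _; exact: powR_ge0. Qed.

Lemma measurable_tail gamma : measurable_fun setT (tail gamma).
Proof.
rewrite /tail; apply: (measurable_fun_ifT (measurable_fun_ltr _ _)) => //.
Qed.

Lemma measurable_wmin alpha : measurable_fun setT (wmin alpha).
Proof. by apply: measurable_minr => //; exact: measurable_powR. Qed.

Lemma wmin_ge0 alpha u : 0 <= u -> 0 <= wmin alpha u.
Proof. by move=> u0; rewrite le_min u0 powR_ge0. Qed.

Lemma halflineE f u : halfline f u = if 0 < u then f u else 0.
Proof.
rewrite /halfline patchE; case: ifPn => [|].
  by rewrite inE /= in_itv /= andbT => ->.
by move=> /negP h; case: ifPn => // u0; exfalso; apply: h; rewrite inE /= in_itv /= u0.
Qed.

(** The fundamental theorem of calculus is applied on the compact intervals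
    [A/n, A], which exhaust ]0, A]. *)
Lemma integral_pow_near0 (beta A : R) : 0 < beta -> 0 < A ->
  (\int[leb]_(u in `]0%R, A]) (u `^ (beta - 1))%:E < +oo)%E.
Proof.
move=> b0 A0.
pose F (n : nat) : set R := `[A / n.+2%:R, A]%classic.
have UF : \bigcup_n F n = `]0, A]%classic.
  apply/seteqP; split => [u [n _]|u]; rewrite /F /= !in_itv /=.
    by move=> /andP[h ->]; rewrite andbT (lt_le_trans _ h)// divr_gt0.
  move=> /andP[u0 uA]; have [n hn] : exists n : nat, A / u <= n%:R.
    exists (Num.truncn (A / u)).+1; apply/ltW/truncnS_gt.
  exists n => //; rewrite /= in_itv /= uA andbT ler_pdivrMr// mulrC -ler_pdivrMr//.
  by rewrite (le_trans hn)// ler_nat -addn2 leq_addr.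
rewrite -UF.
have mf (D : set (measurableTypeR R)) : measurable_fun D (fun u : R => (u `^ (beta - 1))%:E).
  by apply/measurable_EFinP; apply: measurable_funTS; exact: measurable_powR.
have dpow (p x : R) : 0 < x -> derivable (fun u : R => u `^ p) x 1.
  by move=> x0; apply: derivable_powR; rewrite in_itv /= x0.
have dF (x : R) : 0 < x -> derivable (fun u : R => u `^ beta * beta^-1) x 1.
  by move=> x0; apply: derivableM; [exact: dpow|exact: derivable_cst].
have cF (x : R) : 0 < x -> (fun u : R => u `^ beta * beta^-1) @ x --> x `^ beta * beta^-1.
  by move=> /dF/derivable1_diffP/differentiable_continuous.
have bound n : (\int[leb]_(u in F n) (u `^ (beta - 1))%:E <= (A `^ beta / beta)%:E)%E.
  have a0 : 0 < A / n.+2%:R by rewrite divr_gt0.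
  have aA : A / n.+2%:R < A by rewrite ltr_pdivrMr// ltr_pMr// ltr1n.
  rewrite (@continuous_FTC2 _ _ (fun u => u `^ beta * beta^-1))//.
  - rewrite -EFinB lee_fin lerBlDr lerDl.
    by rewrite divr_ge0 ?powR_ge0 ?ltW.
  - apply: derivable_within_continuous => x; rewrite in_itv /= => /andP[h _].
    by apply: dpow; exact: lt_le_trans h.
  - split.
    + by move=> x; rewrite in_itv /= => /andP[h _]; apply: dF; exact: lt_trans h.
    + by apply: cvg_at_right_filter; exact: cF.
    + by apply: cvg_at_left_filter; exact: cF.
  - move=> x; rewrite in_itv /= => /andP[h _]; have x0 : 0 < x by exact: lt_trans h.
    rewrite (derive1Mr _ (dpow beta x x0)) powR_derive1 ?in_itv /= ?x0//.
    by rewrite mulrAC divff ?mul1r// gt_eqF.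
apply: (@le_lt_trans _ _ (A `^ beta / beta)%:E); last by rewrite ltry.
have c : (fun n => \int[leb]_(u in F n) (u `^ (beta - 1))%:E)%E @ \oo -->
    (\int[leb]_(u in \bigcup_n F n) (u `^ (beta - 1))%:E)%E.
  apply: ge0_nondecreasing_set_cvg_integral => //.
  - move=> i j ij; apply/subsetPset => u; rewrite /F /= !in_itv /= => /andP[h ->].
    rewrite andbT (le_trans _ h)// ler_pM2l// lef_pV2 ?posrE// ler_nat.
    by rewrite -(addn2 i) -(addn2 j) leq_add2r.
  - by move=> i; exact: measurable_itv.
  - by move=> i u _; rewrite lee_fin powR_ge0.
rewrite -(cvg_lim _ c)//; apply: lime_le; first by apply/cvg_ex; eexists; exact: c.
by apply: nearW => n; exact: bound.
Qed.

Context (gamma alpha : R) (f : R -> R).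
Hypothesis gamma1 : 1 < gamma.
Hypothesis ga : gamma < alpha.
Hypothesis hf : edge_density gamma f.

Notation fh := (halfline f).

Lemma halfline_ge0 u : 0 <= fh u.
Proof. by rewrite halflineE; case: ifP => // u0; case: hf => _ h _ _; exact: h. Qed.

Lemma measurable_halfline : measurable_fun setT fh.
Proof.
by case: hf => mf _ _ _; apply/(measurable_restrictT f) => //; exact: measurable_itv.
Qed.

(** Asymptotic equivalence is used only through these two-sided bounds, except
    for the pointwise limit in [rescaled_density_cvg]. *)
Lemma edge_density_threshold : exists2 A, 0 < A & forall u, A < u ->
  f u <= 2 * tail gamma u /\ tail gamma u <= 2 * f u.
Proof.
case: hf => _ f0 cf _.
have h1 : \forall u \near +oo, f u / u `^ (- gamma - 1) <= 2.
  by apply: (cvgr_le _ cf); rewrite ltr1n.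
have h2 : \forall u \near +oo, 1 / 2 <= f u / u `^ (- gamma - 1).
  by apply: (cvgr_ge _ cf); rewrite mul1r invf_lt1// ltr1n.
have [M [Mr hM]] : \forall u \near +oo, f u / u `^ (- gamma - 1) <= 2 /\
  1 / 2 <= f u / u `^ (- gamma - 1).
  by near=> u; split; near: u.
exists (Num.max 1 M); first by rewrite lt_max ltr01.
move=> u; rewrite gt_max => /andP[u1 uM]; have u0 : 0 < u by rewrite (lt_trans _ u1).
have [] := hM _ uM; rewrite /tail u0.
have p0 : 0 < u `^ (- gamma - 1) by exact: powR_gt0.
rewrite ler_pdivrMr// => -> ; rewrite ler_pdivlMr// => h; split => //.
lra.
Unshelve. all: by end_near. Qed.

Lemma edge_mean_fin : (\int[leb]_u (u * fh u)%:E < +oo)%E.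
Proof.
case: hf => _ _ _; rewrite integral_mkcond => /le_lt_trans; apply.
rewrite le_eqVlt; apply/orP; left; apply/eqP; apply: eq_integral => u _.
rewrite /halfline !patchE; case: ifP => //; by rewrite mulr0.
Qed.

Let K1 := (\int[leb]_u (u * fh u)%:E)%E.

Let K1_fin : (K1 < +oo)%E. Proof. exact: edge_mean_fin. Qed.

Lemma edge_mean_ge0 u : 0 <= u * fh u.
Proof.
have := halfline_ge0 u; rewrite halflineE; case: ifPn => [u0 h|_ _]; last by rewrite mulr0.
by rewrite mulr_ge0// ltW.
Qed.

Lemma wmin_tail_ge0 u : 0 <= wmin alpha u * tail gamma u.
Proof.
rewrite /tail; case: ifPn => [u0|_]; last by rewrite mulr0.
by rewrite mulr_ge0 ?powR_ge0// wmin_ge0// ltW.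
Qed.

(** Near 0 the integrand is u^(alpha - gamma - 1), integrable as gamma < alpha;
    far away it is at most 2 u f(u), integrable since edges have finite mean. *)
Lemma wmin_tail_integrable :
  (\int[leb]_u (wmin alpha u * tail gamma u)%:E < +oo)%E.
Proof.
have [A A0 hA] := edge_density_threshold.
have b0 : 0 < alpha - gamma by rewrite subr_gt0.
have mg : measurable_fun setT (fun u : R => (u * fh u)%:E).
  by apply/measurable_EFinP; apply: measurable_funM => //; exact: measurable_halfline.
pose p : R -> \bar R := (fun u : R => (u `^ (alpha - gamma - 1))%:E) \_ `]0, A]%classic.
have mp : measurable_fun setT p.
  apply/(measurable_restrictT (fun u : R => (u `^ (alpha - gamma - 1))%:E)) => //.
  by apply/measurable_EFinP; apply: measurable_funTS; exact: measurable_powR.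
have pge0 (u : R) : (0 <= p u)%E.
  by rewrite /p patchE; case: ifP => // _; rewrite lee_fin powR_ge0.
apply: (@le_lt_trans _ _ (\int[leb]_u (p u + 2%:E * (u * fh u)%:E))%E).
  apply: ge0_le_integral => //.
  - by move=> u _; rewrite lee_fin wmin_tail_ge0.
  - apply/measurable_EFinP; apply: measurable_funM; first exact: measurable_wmin.
    exact: measurable_tail.
  - by apply: emeasurable_funD => //; exact: measurable_funeM.
  - move=> u _; have [u0|u0] := ltP 0 u; last first.
      by rewrite /tail ltNge u0 /= mulr0 adde_ge0 ?mule_ge0 ?lee_fin ?edge_mean_ge0.
    have [uA|uA] := leP u A.
      rewrite /p patchE mem_set; last by rewrite /= in_itv /= u0.
      rewrite -EFinM -EFinD lee_fin -[leLHS]addr0 lerD//; last by rewrite mulr_ge0 ?edge_mean_ge0.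
      rewrite /tail u0 /wmin.
      rewrite (_ : alpha - gamma - 1 = alpha + (- gamma - 1)); last by ring.
      rewrite powRD; last by rewrite (gt_eqF u0) implybT.
      by rewrite ler_wpM2r ?powR_ge0// ge_min lexx orbT.
    rewrite -[leLHS]add0e leeD// lee_fin mulrCA halflineE u0.
    apply: ler_pM; rewrite ?tail_ge0 ?wmin_ge0 ?(ltW u0)//.
      by rewrite ge_min lexx.
    by have [] := hA _ uA.
rewrite ge0_integralD//; last 2 first.
- by move=> u _; rewrite mule_ge0 ?lee_fin ?edge_mean_ge0.
- exact: measurable_funeM.
rewrite lte_add_pinfty//.
  by rewrite -integral_mkcond; exact: integral_pow_near0.
rewrite ge0_integralZl_EFin//; last by move=> u _; rewrite lee_fin edge_mean_ge0.
by rewrite lte_mul_pinfty// lee_fin.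
Qed.

(** For u <= A, (rho u)^alpha <= rho^alpha A^(alpha-1) u, and u f(u) is
    integrable.  After division by rho^gamma this vanishes as rho -> 0. *)
Lemma small_edges_bound (A rho : R) : 0 < A -> 0 < rho ->
  (\int[leb]_u (wmin alpha (rho * u) * (if u <= A then fh u else 0))%:E <=
   (rho `^ alpha * A `^ (alpha - 1))%:E * K1)%E.
Proof.
move=> A0 r0.
have mi : measurable_fun setT (fun u : R => if u <= A then fh u else 0).
  apply: (measurable_fun_ifT (measurable_fun_ler _ _)) => //; exact: measurable_halfline.
rewrite -ge0_integralZl_EFin//; last 3 first.
- by move=> u _; rewrite lee_fin edge_mean_ge0.
- by apply/measurable_EFinP; apply: measurable_funM => //; exact: measurable_halfline.
- by rewrite mulr_ge0 ?powR_ge0.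
have a1 : 0 < alpha - 1 by rewrite subr_gt0 (lt_trans gamma1).
apply: ge0_le_integral => //.
- move=> u _; rewrite lee_fin; case: ifP => _; last by rewrite mulr0.
  have := halfline_ge0 u; rewrite halflineE; case: ifP => [u0 h|_ _]; last by rewrite mulr0.
  by rewrite mulr_ge0// wmin_ge0// mulr_ge0 ?(ltW r0) ?(ltW u0).
- apply/measurable_EFinP; apply: measurable_funM => //.
  by apply: (measurableT_comp (measurable_wmin alpha)); exact: measurable_funM.
- by apply: measurable_funeM; apply/measurable_EFinP; apply: measurable_funM => //; exact: measurable_halfline.
- move=> u _; rewrite -EFinM lee_fin; case: ifPn => uA; last first.
    by rewrite mulr0 mulr_ge0 ?edge_mean_ge0// mulr_ge0 ?powR_ge0.
  have [u0|u0] := ltP 0 u; last first.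
    by rewrite halflineE ltNge u0 /= !mulr0.
  rewrite mulrA ler_wpM2r ?halfline_ge0//.
  apply: (@le_trans _ _ ((rho * u) `^ alpha)); first by rewrite ge_min lexx orbT.
  rewrite powRM ?(ltW r0) ?(ltW u0)// -mulrA ler_wpM2l ?powR_ge0//.
  rewrite -(mulr_powRB1 (ltW u0)) ?(lt_trans _ a1)//; last by rewrite (lt_trans _ ga)// (lt_trans _ gamma1).
  rewrite [leLHS]mulrC ler_wpM2r ?(ltW u0)//.
  by apply: ge0_ler_powR; rewrite ?nnegrE ?(ltW a1) ?(ltW u0) ?(ltW A0).
Qed.

Lemma tail_scale (rho u : R) : 0 < rho -> tail gamma (rho * u) = rho `^ (- gamma - 1) * tail gamma u.
Proof.
move=> r0; rewrite /tail pmulr_rgt0//; case: ifP => [u0|_]; last by rewrite mulr0.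
by rewrite powRM ?ltW.
Qed.

(** For u > A the density is at most twice its tail, and the tail scales exactly. *)
Lemma large_edges_bound (A rho : R) : 0 < rho ->
  (forall u, A < u -> f u <= 2 * tail gamma u /\ tail gamma u <= 2 * f u) ->
  (\int[leb]_u (wmin alpha (rho * u) * (if u <= A then 0 else fh u))%:E <=
   (2 * rho `^ gamma)%:E * \int[leb]_u (wmin alpha u * tail gamma u)%:E)%E.
Proof.
move=> r0 hA.
have mi : measurable_fun setT (fun u : R => if u <= A then 0 else fh u).
  apply: (measurable_fun_ifT (measurable_fun_ler _ _)) => //; exact: measurable_halfline.
have mwt : measurable_fun setT (fun u : R => (wmin alpha u * tail gamma u)%:E).
  by apply/measurable_EFinP; apply: measurable_funM; [exact: measurable_wmin|exact: measurable_tail].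
rewrite (@integral_lebesgue_scale _ rho (fun u => (wmin alpha u * tail gamma u)%:E))//; last first.
  by move=> u; rewrite lee_fin wmin_tail_ge0.
rewrite muleA -EFinM -ge0_integralZl_EFin//; last 3 first.
- by move=> u _; rewrite lee_fin wmin_tail_ge0.
- by apply: (measurableT_comp mwt); exact: measurable_funM.
- by rewrite !mulr_ge0 ?powR_ge0 ?ltW.
apply: ge0_le_integral => //.
- move=> u _; rewrite lee_fin; case: ifP => _; first by rewrite mulr0.
  have := halfline_ge0 u; rewrite halflineE; case: ifP => [u0 h|_ _]; last by rewrite mulr0.
  by rewrite mulr_ge0// wmin_ge0// mulr_ge0 ?(ltW r0) ?(ltW u0).
- apply/measurable_EFinP; apply: measurable_funM => //.
  by apply: (measurableT_comp (measurable_wmin alpha)); exact: measurable_funM.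
- by apply: measurable_funeM; apply: (measurableT_comp mwt); exact: measurable_funM.
- move=> u _; rewrite -EFinM lee_fin; case: ifPn => [uA|].
    by rewrite mulr0 mulr_ge0 ?wmin_tail_ge0// mulr_ge0 ?(ltW r0)// mulr_ge0 ?powR_ge0.
  rewrite -ltNge => uA; have [u0|u0] := ltP 0 u; last first.
    by rewrite halflineE ltNge u0 /= mulr0 mulr_ge0 ?wmin_tail_ge0// mulr_ge0 ?(ltW r0)// mulr_ge0 ?powR_ge0.
  rewrite halflineE u0 tail_scale//.
  rewrite [leRHS](_ : _ = wmin alpha (rho * u) * (2 * tail gamma u) *
      (rho `^ gamma * rho * rho `^ (- gamma - 1))); last by ring.
  have -> : rho `^ gamma * rho * rho `^ (- gamma - 1) = 1.
    rewrite -{2}(powRr1 (ltW r0)) -!powRD ?(gt_eqF r0) ?implybT//.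
    by rewrite (_ : _ + 1 + _ = 0) ?powRr0//; ring.
  rewrite mulr1 ler_wpM2l ?wmin_ge0 ?mulr_ge0 ?(ltW r0) ?(ltW u0)//.
  by have [] := hA _ uA.
Qed.

End one_dimensional_tails.

(** * The rescaled edge density *)

Section rescaled_density.
Context {R : realType} (gamma : R) (f : R -> R).
Hypothesis hf : edge_density gamma f.
Context (A : R).
Hypothesis A0 : 0 < A.
Hypothesis hA : forall u, A < u -> f u <= 2 * tail gamma u /\ tail gamma u <= 2 * f u.

Definition large_part (f : R -> R) (A u : R) : R := if u <= A then 0 else halfline f u.
Definition small_part (f : R -> R) (A u : R) : R := if u <= A then halfline f u else 0.

Lemma large_small_partE u : halfline f u = large_part f A u + small_part f A u.
Proof. by rewrite /large_part /small_part; case: ifP; rewrite ?add0r ?addr0. Qed.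

Lemma large_part_ge0 u : 0 <= large_part f A u.
Proof. by rewrite /large_part; case: ifP => // _; exact: (halfline_ge0 hf). Qed.

Lemma small_part_ge0 u : 0 <= small_part f A u.
Proof. by rewrite /small_part; case: ifP => // _; exact: (halfline_ge0 hf). Qed.

Lemma measurable_large_part : measurable_fun setT (large_part f A).
Proof.
by apply: (measurable_fun_ifT (measurable_fun_ler _ _)) => //; exact: (measurable_halfline hf).
Qed.

Lemma measurable_small_part : measurable_fun setT (small_part f A).
Proof.
by apply: (measurable_fun_ifT (measurable_fun_ler _ _)) => //; exact: (measurable_halfline hf).
Qed.

Lemma large_part_le u : large_part f A u <= 2 * tail gamma u.
Proof.
rewrite /large_part; case: ifPn => [_|]; first by rewrite mulr_ge0 ?tail_ge0.
rewrite -ltNge => uA; rewrite halflineE (lt_trans A0 uA).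
by have [] := hA uA.
Qed.

(** The density of rho u for edges u > A, multiplied by rho^-gamma; its limit is
    the pure power density. *)
Definition rescaled_density (r v : R) : R := r `^ (- gamma - 1) * large_part f A (v / r).

Lemma rescaled_density_ge0 r v : 0 <= rescaled_density r v.
Proof. by rewrite mulr_ge0 ?powR_ge0 ?large_part_ge0. Qed.

Lemma measurable_rescaled_density r : measurable_fun setT (rescaled_density r).
Proof.
apply: measurable_funM => //; apply: (measurableT_comp measurable_large_part).
exact: measurable_funM.
Qed.

Lemma rescaled_density_le r v : 0 < r -> rescaled_density r v <= 2 * tail gamma v.
Proof.
move=> r0; rewrite /rescaled_density.
have -> : 2 * tail gamma v = r `^ (- gamma - 1) * (2 * tail gamma (v / r)).
  have e : r * (v / r) = v by rewrite mulrC divfK// gt_eqF.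
  by rewrite [RHS]mulrCA -tail_scale// e.
by rewrite ler_wpM2l ?powR_ge0// large_part_le.
Qed.

Lemma rescaled_density_cvg (r : nat -> R) v : (forall n, 0 < r n) ->
  r @ \oo --> 0 -> rescaled_density (r n) v @[n --> \oo] --> tail gamma v.
Proof.
move=> r0 cr; have [v0|v0] := ltP 0 v; last first.
  have -> : tail gamma v = 0 by rewrite /tail ltNge v0.
  rewrite (_ : (fun n => _) = fun=> 0); first exact: cvg_cst.
  apply/funext => n; rewrite /rescaled_density /large_part halflineE.
  by rewrite pmulr_lgt0 ?invr_gt0// ltNge v0 /= if_same mulr0.
have cvr : v / r n @[n --> \oo] --> +oo.
  apply/cvgryPge => M; near=> n.
  rewrite ler_pdivlMr// (le_trans (ler_wpM2r (ltW (r0 n)) (ler_norm M)))//.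
  rewrite (@le_trans _ _ ((`|M| + 1) * r n))//; first by rewrite ler_wpM2r ?(ltW (r0 n))// lerDl.
  rewrite mulrC -ler_pdivlMr ?ltr_wpDl//.
  near: n; apply: (cvgr_le _ cr); rewrite divr_gt0// ltr_wpDl//.
have -> : tail gamma v = 1 * v `^ (- gamma - 1) by rewrite /tail v0 mul1r.
have c : f (v / r n) / (v / r n) `^ (- gamma - 1) * v `^ (- gamma - 1) @[n --> \oo] -->
    1 * v `^ (- gamma - 1).
  apply: cvgMl; case: hf => _ _ cf _.
  exact: (cvg_comp (fun n => v / r n) _ cvr cf).
apply: cvg_trans c; apply: near_eq_cvg; near=> n.
rewrite /rescaled_density /large_part halflineE divr_gt0// ifF; last first.
  apply/negbTE; rewrite -ltNge; near: n.
  by move/cvgryPgt : cvr; apply.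
have p0 : (v / r n) `^ (- gamma - 1) != 0 by rewrite gt_eqF// powR_gt0// divr_gt0.
have -> : v `^ (- gamma - 1) = r n `^ (- gamma - 1) * (v / r n) `^ (- gamma - 1).
  rewrite -powRM ?divr_ge0 ?ltW//.
  by rewrite mulrC divfK// gt_eqF.
by field.
Unshelve. all: by end_near. Qed.

End rescaled_density.

Section density_limit.
Context {R : realType} (gamma1 gamma2 alpha1 alpha2 : R) (f1 f2 : R -> R).
Hypothesis gamma1_gt1 : 1 < gamma1.
Hypothesis gamma2_gt1 : 1 < gamma2.
Hypothesis ga1 : gamma1 < alpha1.
Hypothesis ga2 : gamma2 < alpha2.
Hypothesis hf1 : edge_density gamma1 f1.
Hypothesis hf2 : edge_density gamma2 f2.
Context (H : plane R -> R) (C : R).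
Hypothesis mH : measurable_fun setT H.
Hypothesis H0 : forall u, 0 <= H u.
Hypothesis HC : forall u, quadrant u -> H u <= C * (wmin alpha1 u.1 * wmin alpha2 u.2).
Notation leb := (@lebesgue_measure R).
Notation leb2 := (@leb2 R).

Let C0 : 0 <= C.
Proof.
have q1 : quadrant ((1, 1) : plane R) by split; rewrite /= ltr01.
by have := le_trans (H0 _) (HC q1); rewrite /wmin /= powR1 minxx !mulr1.
Qed.

Let HCprod (g1 g2 : R -> R) (rho : R) (z : plane R) : 0 < rho ->
  (forall u, 0 <= g1 u) -> (forall u, 0 <= g2 u) ->
  (forall u, u <= 0 -> g1 u = 0) -> (forall u, u <= 0 -> g2 u = 0) ->
  H (rho * z.1, rho * z.2) * (g1 z.1 * g2 z.2) <=
  C * ((wmin alpha1 (rho * z.1) * g1 z.1) * (wmin alpha2 (rho * z.2) * g2 z.2)).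
Proof.
move=> r0 g10 g20 g1N g2N.
have [z1|z1] := ltP 0 z.1; last by rewrite (g1N _ z1) !(mul0r, mulr0).
have [z2|z2] := ltP 0 z.2; last by rewrite (g2N _ z2) !(mul0r, mulr0).
apply: (@le_trans _ _ (C * (wmin alpha1 (rho * z.1) * wmin alpha2 (rho * z.2)) * (g1 z.1 * g2 z.2))).
  by rewrite ler_wpM2r ?mulr_ge0// HC//; split; rewrite /= mulr_gt0.
by rewrite -mulrA ler_wpM2l// mulrACA.
Qed.

Let I1 (alpha : R) (g : R -> R) (rho : R) : \bar R :=
  (\int[leb]_u (wmin alpha (rho * u) * g u)%:E)%E.

Let mwg (alpha : R) (g : R -> R) (rho : R) : measurable_fun setT g ->
  measurable_fun setT (fun u : R => (wmin alpha (rho * u) * g u)%:E).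
Proof.
move=> mg; apply/measurable_EFinP; apply: measurable_funM => //.
by apply: (measurableT_comp (measurable_wmin alpha)); exact: measurable_funM.
Qed.

Let wg0 (alpha : R) (g : R -> R) (rho u : R) : 0 < rho -> (forall u, 0 <= g u) ->
  (forall u, u <= 0 -> g u = 0) -> 0 <= wmin alpha (rho * u) * g u.
Proof.
move=> r0 g0 gN; have [u0|u0] := ltP 0 u; last by rewrite gN// mulr0.
by rewrite mulr_ge0// wmin_ge0// mulr_ge0 ?(ltW r0) ?(ltW u0).
Qed.

Let mHg (g1 g2 : R -> R) rho : measurable_fun setT g1 -> measurable_fun setT g2 ->
  measurable_fun setT (fun z : plane R => (H ((rho * z.1)%R, (rho * z.2)%R) * (g1 z.1 * g2 z.2))%:E).
Proof.
move=> mg1 mg2; apply/measurable_EFinP; apply: measurable_funM.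
  exact: (measurableT_comp mH (measurable_plane_scale rho)).
by apply: measurable_funM; apply: measurableT_comp.
Qed.

(** The bound on H is a product, so the double integral is at most a product of
    one-dimensional ones. *)
Let prod_bound (g1 g2 : R -> R) (rho : R) : 0 < rho ->
  measurable_fun setT g1 -> measurable_fun setT g2 ->
  (forall u, 0 <= g1 u) -> (forall u, 0 <= g2 u) ->
  (forall u, u <= 0 -> g1 u = 0) -> (forall u, u <= 0 -> g2 u = 0) ->
  (\int[leb2]_z (H ((rho * z.1)%R, (rho * z.2)%R) * (g1 z.1 * g2 z.2))%:E <=
   C%:E * (I1 alpha1 g1 rho * I1 alpha2 g2 rho))%E.
Proof.
move=> r0 mg1 mg2 g10 g20 g1N g2N.
rewrite /I1 -integral_leb2_prod//; last 4 first.
- exact: mwg.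
- by move=> u; rewrite lee_fin wg0.
- exact: mwg.
- by move=> u; rewrite lee_fin wg0.
have mm : measurable_fun setT (fun z : plane R =>
   ((wmin alpha1 (rho * z.1) * g1 z.1)%:E * (wmin alpha2 (rho * z.2) * g2 z.2)%:E)%E).
  apply: emeasurable_funM.
    by apply: (measurableT_comp (mwg alpha1 rho mg1)).
  by apply: (measurableT_comp (mwg alpha2 rho mg2)).
rewrite -ge0_integralZl_EFin//; last first.
  by move=> z _; rewrite -EFinM lee_fin mulr_ge0// wg0.
apply: ge0_le_integral => //.
- by move=> z _; rewrite lee_fin !mulr_ge0.
- exact: mHg.
- exact: measurable_funeM.
- by move=> z _; rewrite -!EFinM lee_fin; exact: HCprod.
Qed.

Let halfN (f : R -> R) (u : R) : u <= 0 -> halfline f u = 0.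
Proof. by move=> u0; rewrite halflineE ltNge u0. Qed.
Let tailN (gamma u : R) : u <= 0 -> tail gamma u = 0.
Proof. by move=> u0; rewrite /tail ltNge u0. Qed.
Let largeN (f : R -> R) (A u : R) : u <= 0 -> large_part f A u = 0.
Proof. by move=> u0; rewrite /large_part halfN// if_same. Qed.
Let smallN (f : R -> R) (A u : R) : u <= 0 -> small_part f A u = 0.
Proof. by move=> u0; rewrite /small_part halfN// if_same. Qed.

Lemma limit_integral_fin :
  (\int[leb2]_z (H z * (tail gamma1 z.1 * tail gamma2 z.2))%:E < +oo)%E.
Proof.
have := prod_bound ltr01 (measurable_tail gamma1) (measurable_tail gamma2)
  (tail_ge0 gamma1) (tail_ge0 gamma2) (@tailN gamma1) (@tailN gamma2).
have -> : (\int[leb2]_z (H ((1 * z.1)%R, (1 * z.2)%R) * (tail gamma1 z.1 * tail gamma2 z.2))%:E =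
   \int[leb2]_z (H z * (tail gamma1 z.1 * tail gamma2 z.2))%:E)%E.
  by apply: eq_integral => z _; rewrite !mul1r -surjective_pairing.
move=> /le_lt_trans; apply.
have I1E alpha g : I1 alpha g 1 = (\int[leb]_u (wmin alpha u * g u)%:E)%E.
  by apply: eq_integral => u _; rewrite mul1r.
rewrite !I1E lte_mul_pinfty// ?lee_fin// lte_mul_pinfty//.
- by apply: integral_ge0 => u _; rewrite lee_fin wmin_tail_ge0.
- rewrite ge0_fin_numE; last by apply: integral_ge0 => u _; rewrite lee_fin wmin_tail_ge0.
  exact: wmin_tail_integrable hf1.
- exact: wmin_tail_integrable hf2.
Qed.

(** Small edges are negligible at the scale rho^gamma. *)
Let small_bound (gamma alpha A : R) (f : R -> R) : 1 < gamma -> gamma < alpha ->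
  edge_density gamma f -> 0 < A -> exists2 c, 0 <= c & forall rho, 0 < rho ->
  (I1 alpha (small_part f A) rho <= (rho `^ gamma * (c * rho `^ (alpha - gamma)))%:E)%E.
Proof.
move=> g1 ga hf A0.
have K0 : (0 <= \int[leb]_u (u * halfline f u)%:E)%E.
  by apply: integral_ge0 => u _; rewrite lee_fin (edge_mean_ge0 hf).
have Kfin := edge_mean_fin hf.
exists (A `^ (alpha - 1) * fine (\int[leb]_u (u * halfline f u)%:E)%E).
  by rewrite mulr_ge0 ?powR_ge0// fine_ge0.
move=> rho r0; apply: (le_trans (small_edges_bound g1 ga hf A0 r0)).
rewrite -[in leLHS](@fineK _ (\int[leb]_u (u * halfline f u)%:E)%E) ?ge0_fin_numE//.
rewrite -EFinM lee_fin le_eqVlt; apply/orP; left; apply/eqP.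
rewrite [RHS](_ : _ = (rho `^ gamma * rho `^ (alpha - gamma)) * A `^ (alpha - 1) *
  fine (\int[leb]_u (u * halfline f u)%:E)%E); last by ring.
by rewrite -powRD ?(gt_eqF r0) ?implybT// (addrC gamma) subrK.
Qed.

Let large_bound (gamma alpha A : R) (f : R -> R) : gamma < alpha ->
  edge_density gamma f ->
  (forall u, A < u -> f u <= 2 * tail gamma u /\ tail gamma u <= 2 * f u) ->
  exists2 W, 0 <= W & forall rho, 0 < rho ->
  (I1 alpha (large_part f A) rho <= (rho `^ gamma * W)%:E)%E.
Proof.
move=> ga hf hA.
have W0 : (0 <= \int[leb]_u (wmin alpha u * tail gamma u)%:E)%E.
  by apply: integral_ge0 => u _; rewrite lee_fin wmin_tail_ge0.
have Wfin := wmin_tail_integrable ga hf.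
exists (2 * fine (\int[leb]_u (wmin alpha u * tail gamma u)%:E)%E).
  by rewrite mulr_ge0// fine_ge0.
move=> rho r0; apply: (le_trans (large_edges_bound alpha hf r0 hA)).
rewrite -[in leLHS](@fineK _ (\int[leb]_u (wmin alpha u * tail gamma u)%:E)%E) ?ge0_fin_numE//.
by rewrite -EFinM lee_fin mulrA (mulrC 2).
Qed.

(** Both densities are split at their thresholds.  The product of the large parts
    converges by dominated convergence, with the dominating function given by
    [limit_integral_fin]; every term with a small part is O(rho^(alpha - gamma))
    relative to the normalisation. *)
Theorem density_limit (rho : nat -> R) : (forall n, 0 < rho n) -> rho @ \oo --> 0 ->
  (((rho n) `^ (- gamma1 - gamma2))%:E * \int[leb2]_z (H ((rho n * z.1)%R, (rho n * z.2)%R) *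
     (halfline f1 z.1 * halfline f2 z.2))%:E)%E @[n --> \oo] -->
  (\int[leb2]_z (H z * (tail gamma1 z.1 * tail gamma2 z.2))%:E)%E.
Proof.
move=> r0 cr.
have [A1 A10 hA1] := edge_density_threshold hf1.
have [A2 A20 hA2] := edge_density_threshold hf2.
have [c1 c10 hs1] := small_bound gamma1_gt1 ga1 hf1 A10.
have [c2 c20 hs2] := small_bound gamma2_gt1 ga2 hf2 A20.
have [W1 W10 hl1] := large_bound ga1 hf1 hA1.
have [W2 W20 hl2] := large_bound ga2 hf2 hA2.
pose L1 := large_part f1 A1; pose L2 := large_part f2 A2.
pose S1 := small_part f1 A1; pose S2 := small_part f2 A2.
have mL1 : measurable_fun setT L1 by exact: (measurable_large_part hf1).
have mL2 : measurable_fun setT L2 by exact: (measurable_large_part hf2).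
have mS1 : measurable_fun setT S1 by exact: (measurable_small_part hf1).
have mS2 : measurable_fun setT S2 by exact: (measurable_small_part hf2).
have mf2 := measurable_halfline hf2.
have L10 : forall u, 0 <= L1 u by exact: (large_part_ge0 hf1).
have L20 : forall u, 0 <= L2 u by exact: (large_part_ge0 hf2).
have S10 : forall u, 0 <= S1 u by exact: (small_part_ge0 hf1).
have S20 : forall u, 0 <= S2 u by exact: (small_part_ge0 hf2).
have f20 := halfline_ge0 hf2.
pose Q (g1 g2 : R -> R) n := (((rho n) `^ (- gamma1 - gamma2))%:E *
  \int[leb2]_z (H ((rho n * z.1)%R, (rho n * z.2)%R) * (g1 z.1 * g2 z.2))%:E)%E.
have rp n : 0 <= rho n `^ (- gamma1 - gamma2) by exact: powR_ge0.
have Qsplit n : Q (halfline f1) (halfline f2) n =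
    (Q L1 L2 n + (Q S1 (halfline f2) n + Q L1 S2 n))%E.
  have int0 g1 g2 : (forall u, 0 <= g1 u) -> (forall u, 0 <= g2 u) ->
      (0 <= \int[leb2]_z (H ((rho n * z.1)%R, (rho n * z.2)%R) * (g1 z.1 * g2 z.2))%:E)%E.
    by move=> g10 g20; apply: integral_ge0 => z _; rewrite lee_fin !mulr_ge0.
  have iL := int0 _ _ L10 L20; have iSf := int0 _ _ S10 f20.
  have iLS := int0 _ _ L10 S20; have iSum := adde_ge0 iSf iLS.
  rewrite /Q -(ge0_muleDr _ iSf iLS) -(ge0_muleDr _ iL iSum); congr (_ * _)%E.
  rewrite -!ge0_integralD//; try by [exact: mHg|move=> z _; rewrite lee_fin !mulr_ge0].
  - apply: eq_integral => z _; rewrite -!EFinD; congr (_%:E).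
    by rewrite (large_small_partE f1 A1 z.1) (large_small_partE f2 A2 z.2) /L1 /L2 /S1 /S2; ring.
  - by move=> z _; rewrite -EFinD lee_fin addr_ge0// !mulr_ge0.
  - by apply: emeasurable_funD; exact: mHg.
have rpow n : rho n `^ (- gamma1 - gamma2) * rho n `^ gamma1 * rho n `^ gamma2 = 1.
  rewrite -!powRD ?(gt_eqF (r0 n)) ?implybT//.
  by rewrite (_ : _ + gamma2 = 0) ?powRr0//; ring.
have Qbound (g1 g2 : R -> R) n a1 a2 : measurable_fun setT g1 -> measurable_fun setT g2 ->
    (forall u, 0 <= g1 u) -> (forall u, 0 <= g2 u) ->
    (forall u, u <= 0 -> g1 u = 0) -> (forall u, u <= 0 -> g2 u = 0) ->
    (I1 alpha1 g1 (rho n) <= (rho n `^ gamma1 * a1)%:E)%E ->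
    (I1 alpha2 g2 (rho n) <= (rho n `^ gamma2 * a2)%:E)%E ->
    (Q g1 g2 n <= (C * (a1 * a2))%:E)%E.
  move=> mg1 mg2 g10 g20 g1N g2N b1 b2.
  apply: (@le_trans _ _ (((rho n) `^ (- gamma1 - gamma2))%:E *
      (C%:E * ((rho n `^ gamma1 * a1)%:E * (rho n `^ gamma2 * a2)%:E)))%E).
    rewrite lee_wpmul2l ?lee_fin//.
    apply: (le_trans (prod_bound (r0 n) mg1 mg2 g10 g20 g1N g2N)).
    rewrite lee_wpmul2l ?lee_fin// lee_pmul//.
    - by apply: integral_ge0 => u _; rewrite lee_fin wg0.
    - by apply: integral_ge0 => u _; rewrite lee_fin wg0.
  rewrite -!EFinM lee_fin le_eqVlt; apply/orP; left; apply/eqP.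
  rewrite [LHS](_ : _ = (rho n `^ (- gamma1 - gamma2) * rho n `^ gamma1 * rho n `^ gamma2) *
    (C * (a1 * a2))); last by ring.
  by rewrite rpow mul1r.
pose s1 n := c1 * rho n `^ (alpha1 - gamma1); pose s2 n := c2 * rho n `^ (alpha2 - gamma2).
have pow0 (p : R) : 0 < p -> rho n `^ p @[n --> \oo] --> 0.
  move=> p0; have /cvg_at_rightP := powR_cvg0 p0; apply; split => //.
have cs1 : s1 @ \oo --> 0.
  by rewrite -[X in _ --> X](mulr0 c1); apply: cvgMr; apply: pow0; rewrite subr_gt0.
have cs2 : s2 @ \oo --> 0.
  by rewrite -[X in _ --> X](mulr0 c2); apply: cvgMr; apply: pow0; rewrite subr_gt0.
have I1f2 n : (I1 alpha2 (halfline f2) (rho n) <= (rho n `^ gamma2 * (W2 + s2 n))%:E)%E.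
  have -> : I1 alpha2 (halfline f2) (rho n) = (I1 alpha2 L2 (rho n) + I1 alpha2 S2 (rho n))%E.
    rewrite /I1 -ge0_integralD//; try exact: mwg.
    - by apply: eq_integral => u _; rewrite -EFinD -mulrDr -large_small_partE.
    - by move=> u _; rewrite lee_fin wg0//; exact: largeN.
    - by move=> u _; rewrite lee_fin wg0//; exact: smallN.
  by rewrite mulrDr EFinD leeD// ?hl2 ?hs2.
have cmain : Q L1 L2 n @[n --> \oo] -->
    (\int[leb2]_z (H z * (tail gamma1 z.1 * tail gamma2 z.2))%:E)%E.
  pose psi1 := rescaled_density gamma1 f1 A1.
  pose psi2 := rescaled_density gamma2 f2 A2.
  have mpsi n : measurable_fun setT (fun z : plane R =>
      (H z * (psi1 (rho n) z.1 * psi2 (rho n) z.2))%:E).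
    apply/measurable_EFinP; apply: measurable_funM => //.
    apply: measurable_funM.
      by apply: (measurableT_comp (measurable_rescaled_density hf1 A1 (rho n))).
    by apply: (measurableT_comp (measurable_rescaled_density hf2 A2 (rho n))).
  have psi10 n u : 0 <= psi1 (rho n) u by exact: (rescaled_density_ge0 hf1).
  have psi20 n u : 0 <= psi2 (rho n) u by exact: (rescaled_density_ge0 hf2).
  (* change of variables: the Jacobian rho^2 and the normalisation combine to
     rho^(-gamma-1) for each edge *)
  have QE n : Q L1 L2 n = (\int[leb2]_z (H z * (psi1 (rho n) z.1 * psi2 (rho n) z.2))%:E)%E.
    rewrite (integral_leb2_scale (r0 n)) => //; last first.
      by move=> z; rewrite lee_fin mulr_ge0// mulr_ge0.
    have re u : (rho n * u) / rho n = u by rewrite mulrAC divff ?mul1r// gt_eqF.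
    rewrite /psi1 /psi2 /rescaled_density.
    under [in RHS]eq_integral do rewrite /= !re.
    rewrite (eq_integral (fun z : plane R => (rho n `^ (- gamma1 - 1) * rho n `^ (- gamma2 - 1))%:E *
       (H ((rho n * z.1)%R, (rho n * z.2)%R) * (L1 z.1 * L2 z.2))%:E)%E); last first.
      by move=> z _; rewrite -EFinM; congr (_%:E); rewrite /L1 /L2; ring.
    rewrite ge0_integralZl_EFin ?mulr_ge0 ?powR_ge0//; last 2 first.
    - by move=> z _; rewrite lee_fin !mulr_ge0.
    - exact: mHg.
    rewrite muleA -EFinM; congr (_%:E * _)%E.
    rewrite -powR_mulrn ?(ltW (r0 n))// -!powRD ?(gt_eqF (r0 n)) ?implybT//.
    by congr (_ `^ _); ring.
  under eq_fun do rewrite QE.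
  have ig : leb2.-integrable setT (fun z : plane R =>
      (4%:E * (H z * (tail gamma1 z.1 * tail gamma2 z.2))%:E)%E).
    apply: integrableZl => //; apply/integrableP; split.
      apply/measurable_EFinP; apply: measurable_funM => //.
      by apply: measurable_funM; apply: (measurableT_comp (measurable_tail _)).
    under eq_integral do rewrite gee0_abs ?lee_fin ?mulr_ge0 ?tail_ge0//.
    exact: limit_integral_fin.
  have [] := @dominated_convergence _ _ _ leb2 setT measurableT
    (fun n (z : plane R) => (H z * (psi1 (rho n) z.1 * psi2 (rho n) z.2))%:E)
    (fun z : plane R => (H z * (tail gamma1 z.1 * tail gamma2 z.2))%:E)
    (fun z : plane R => (4%:E * (H z * (tail gamma1 z.1 * tail gamma2 z.2))%:E)%E) => //.
  - apply/measurable_EFinP; apply: measurable_funM => //.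
    by apply: measurable_funM; apply: (measurableT_comp (measurable_tail _)).
  - apply: aeW => z _; apply: cvg_EFin; first exact: nearW.
    apply: cvgMr; apply: cvgM.
      exact: (@rescaled_density_cvg _ gamma1 f1 hf1 A1 rho z.1 r0 cr).
    exact: (@rescaled_density_cvg _ gamma2 f2 hf2 A2 rho z.2 r0 cr).
  - apply: aeW => z n _; rewrite -EFinM abse_EFin lee_fin.
    rewrite ger0_norm; last by rewrite mulr_ge0// mulr_ge0.
    rewrite [leRHS]mulrCA ler_wpM2l// (_ : 4 * _ = (2 * tail gamma1 z.1) * (2 * tail gamma2 z.2)); last by ring.
    rewrite ler_pM//.
      exact: (rescaled_density_le A10 hA1 _ (r0 n)).
    exact: (rescaled_density_le A20 hA2 _ (r0 n)).
have crem : (Q S1 (halfline f2) n + Q L1 S2 n)%E @[n --> \oo] --> 0%E.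
  have cb : (C * (s1 n * (W2 + s2 n)) + C * (W1 * s2 n))%:E @[n --> \oo] --> 0%E.
    apply: cvg_EFin; first exact: nearW.
    rewrite -[X in _ --> X](_ : C * (0 * (W2 + 0)) + C * (W1 * 0) = 0); last by ring.
    apply: cvgD; apply: cvgMr.
      by apply: cvgM => //; apply: cvgD => //; exact: cvg_cst.
    exact: cvgMr.
  apply: (squeeze_cvge _ (cvg_cst _) cb); apply: nearW => n.
  apply/andP; split.
    by rewrite /Q adde_ge0// mule_ge0 ?lee_fin//; apply: integral_ge0 => z _;
      rewrite lee_fin !mulr_ge0.
  rewrite EFinD leeD//.
    by apply: Qbound => //; [exact: smallN|exact: halfN|exact: hs1].
  by apply: Qbound => //; [exact: largeN|exact: smallN|exact: hl1|exact: hs2].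
set L := (X in _ --> X).
have : (Q L1 L2 n + (Q S1 (halfline f2) n + Q L1 S2 n))%E @[n --> \oo] --> (L + 0)%E.
  by apply: cvgeD => //; rewrite fin_num_adde_defl.
rewrite adde0; apply: cvg_trans; apply: near_eq_cvg; apply: nearW => n.
by rewrite -Qsplit.
Qed.

End density_limit.

(** * Exponential moments of Gaussian variables *)

Section gaussian_mgf.
Context {R : realType}.

(** Completing the square: exp(t x) times the normal density of mean m is, up to a
    constant, the normal density of mean m + t s^2. *)
Lemma normal_mgf (m s t : R) : s != 0 ->
  (\int[normal_prob m s]_x (expR (t * x))%:E = (expR (t * m + t ^+ 2 * s ^+ 2 / 2))%:E)%E.
Proof.
move=> s0.
rewrite (ge0_integral_density (m := lebesgue_measure) (D := setT) (g := normal_pdf m s)) //.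
- rewrite (eq_integral (fun x : measurableTypeR R => (expR (t * m + t ^+ 2 * s ^+ 2 / 2))%:E *
     (normal_pdf (m + t * s ^+ 2) s x)%:E)%E).
    rewrite ge0_integralZl_EFin ?expR_ge0//.
    - by rewrite integral_normal_pdf mule1.
    - by move=> x _; rewrite lee_fin normal_pdf_ge0.
    - by apply/measurable_EFinP; exact: measurable_normal_pdf.
  move=> x _; rewrite -!EFinM; congr (_%:E); rewrite /normal_pdf (negbTE s0) /normal_fun.
  rewrite mulrCA [RHS]mulrCA -!expRD; congr (_ * expR _).
  by field.
- exact: measurable_normal_pdf.
- by move=> x _; exact: normal_pdf_ge0.
- by move=> A mA; rewrite setIT.
- by apply/measurable_EFinP; apply: measurableT_comp => //; exact: measurable_funM.
Qed.

Context d (T : measurableType d) (P : probability T R) (X : {RV P >-> R}).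

(** Both for nondegenerate and for Dirac laws (s = 0). *)
Lemma gaussian_exp : gaussian P X -> exists m s : R, forall t,
  (\int[P]_w (expR (t * X w))%:E = (expR (t * m + t ^+ 2 * s ^+ 2 / 2))%:E)%E.
Proof.
move=> [m [s [s0 law]]]; exists m, s => t.
have mX : measurable_fun setT (X : T -> measurableTypeR R).
  by move=> mT Y mY; exact: (measurable_funPT X).
have mh : measurable_fun setT (fun x : measurableTypeR R => (expR (t * x))%:E).
  by apply/measurable_EFinP; apply: measurableT_comp => //; exact: measurable_funM.
have [nu nuE] := pushforward_measure_exists P mX.
have nuX A : measurable A -> nu A = if s == 0 then \d_(m : measurableTypeR R) A
    else normal_prob m s A.
  by move=> mA; rewrite -law// nuE.
have -> : (\int[P]_w (expR (t * X w))%:E = \int[nu]_x (expR (t * x))%:E)%E.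
  by rewrite nuE ge0_integral_pushforward// => x _; rewrite lee_fin expR_ge0.
have [s00|s00] := eqVneq s 0.
  rewrite (eq_measure_integral (@dirac _ (measurableTypeR R) m R)).
    by rewrite integral_dirac// diracT mul1e s00 expr0n mulr0 mul0r addr0.
  by move=> A mA _; rewrite nuX// s00 eqxx.
rewrite -(normal_mgf m t s00); apply: eq_measure_integral => A mA _.
by rewrite nuX// (negbTE s00).
Qed.

Let small_zero (a K : R) : (forall h, 0 < h -> h <= 1 -> `|a| <= K * h) -> a = 0.
Proof.
move=> hK; apply/eqP; rewrite -normr_le0 leNgt; apply/negP => a0.
have K0 : 0 <= K by have := hK 1 ltr01 (lexx _); rewrite mulr1; exact: le_trans.
pose h := Num.min 1 (`|a| / (2 * (K + 1))).
have K1 : 0 < K + 1 by rewrite ltr_wpDl.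
have h0 : 0 < h by rewrite lt_min ltr01 divr_gt0// mulr_gt0.
have h1 : h <= 1 by rewrite ge_min lexx.
have hh : h * (2 * (K + 1)) <= `|a|.
  by rewrite -ler_pdivlMr ?mulr_gt0// ge_min lexx orbT.
have := hK h h0 h1; nra.
Qed.

(** The parameters m and s of the law are identified with mean and variance by
    expanding the known exponential moment at t = 0 to second order. *)
Lemma gaussian_mgf (v : R) : gaussian P X -> ('E_P[X] = 0)%E ->
  covariance P X X = v%:E -> forall t,
  P.-integrable setT (EFin \o (fun w => expR (t * X w))) /\
  \int[P]_w expR (t * X w) = expR (t ^+ 2 * v / 2).
Proof.
move=> gX EX covX.
have [m [s mgf]] := gaussian_exp gX.
have mX : measurable_fun setT (X : T -> R) by exact: measurable_funPT.
have mexp t : measurable_fun setT (fun w => expR (t * X w)).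
  by apply: measurableT_comp => //; exact: measurable_funM.
have iexp t : P.-integrable setT (EFin \o (fun w => expR (t * X w))).
  apply/integrableP; split; first exact/measurable_EFinP.
  under eq_integral do rewrite gee0_abs ?lee_fin ?expR_ge0//.
  by rewrite mgf ltry.
have Rexp t : \int[P]_w expR (t * X w) = expR (t * m + t ^+ 2 * s ^+ 2 / 2).
  by rewrite /Rintegral mgf.
have iw c : P.-integrable setT (EFin \o (fun w => expw c (X w))).
  rewrite (_ : _ \o _ = (EFin \o (fun w => expR (c * X w))) \+ (EFin \o (fun w => expR (- c * X w))))%E.
    exact: integrableD.
  by apply/funext => w /=; rewrite /expw mulNr EFinD.
have ipow (k : nat) : P.-integrable setT (EFin \o (fun w => X w ^+ k)).
  have iZ : P.-integrable setT (EFin \o (fun w => k`!%:R * expw 1 (X w))).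
    exact: integrable_scale.
  apply: (integrable_bound _ iZ); first exact: measurable_funX.
  move=> w; rewrite normrX (le_trans (pow_le_exp _ _))// ler_wpM2l//.
  by rewrite (le_trans _ (expw_ge1 _ _))// mul1r.
have iX : P.-integrable setT (EFin \o X).
  by have := ipow 1; under eq_fun do rewrite expr1.
have RX : \int[P]_w X w = 0.
  by move: EX; rewrite unlock /Rintegral => ->.
have RX2 : \int[P]_w (X w ^+ 2) = v.
  move: covX; rewrite unlock EX /= => h; rewrite /Rintegral.
  rewrite (_ : (\int[P]_w (X w ^+ 2)%:E)%E = v%:E)//.
  rewrite -h unlock; apply: eq_integral => w _ /=.
  by congr (_%:E); rewrite expr2 -(subr0 (X w)).
pose W := \int[P]_w expw 2 (X w).
have bnd (phi : R -> R) c : measurable_fun setT phi -> 0 <= c ->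
    (forall x, `|phi x| <= c * expw 2 x) -> `|\int[P]_w phi (X w)| <= c * W.
  move=> mphi c0 hphi.
  have iZ : P.-integrable setT (EFin \o (fun w => c * expw 2 (X w))).
    exact: integrable_scale.
  have ip : P.-integrable setT (EFin \o (fun w => phi (X w))).
    by apply: (integrable_bound _ iZ) => [|w]; [exact: measurableT_comp|exact: hphi].
  apply: (le_trans (le_normr_Rintegral measurableT ip)).
  rewrite /W -RintegralZl//; apply: le_Rintegral => //; exact: (integrable_norm ip).
have mexpt (t : R) : measurable_fun setT (fun x : R => expR (t * x)).
  by apply: measurableT_comp => //; exact: measurable_funM.
have exp2 (h x : R) : `|h| <= 1 -> expR `|h * x| * expR `|x| <= expw 2 x.
  move=> h1; rewrite (le_trans _ (expw_ge1 _ _))// -expRD ler_expR.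
  by rewrite mulrDl mul1r lerD2r normrM ler_piMl.
have i1 h : P.-integrable setT (EFin \o (fun w => expR (h * X w) - 1)).
  rewrite (_ : _ \o _ = (EFin \o (fun w => expR (h * X w))) \- (EFin \o cst 1%R))%E//.
  by apply: integrableB => //; exact: finite_measure_integrable_cst.
have ihX h : P.-integrable setT (EFin \o (fun w => h * X w)).
  exact: integrable_scale.
have mh1 (h : R) : measurable_fun setT (fun x : R => expR (h * x) - 1 - h * x).
  by apply: measurable_funB; [exact: measurable_funB|exact: measurable_funM].
have E1 h : \int[P]_w (expR (h * X w) - 1) = expR (h * m + h ^+ 2 * s ^+ 2 / 2) - 1.
  rewrite RintegralB//; last exact: finite_measure_integrable_cst.
  by rewrite Rexp Rintegral_cst// [fine _](congr1 fine (probability_setT _)) mulr1.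
(* applied at h and at -h, this gives m = O(h) *)
have first_order (h : R) : `|h| <= 1 -> h * m <= 2 * W * h ^+ 2.
  move=> h1.
  have hb : `|\int[P]_w (expR (h * X w) - 1 - h * X w)| <= 2 * h ^+ 2 * W.
    apply: (@bnd (fun x => expR (h * x) - 1 - h * x) (2 * h ^+ 2)) => //.
    - by rewrite mulr_ge0 ?sqr_ge0.
    - move=> x; apply: (le_trans (exp_taylor2 _)).
      have := pow_le_exp x 2; rewrite (_ : 2`!%:R = 2 :> R)// => p2.
      rewrite -normrX exprMn normrM (ger0_norm (sqr_ge0 h)) normrX.
      rewrite [leRHS](_ : _ = h ^+ 2 * (2 * expw 2 x)); last by ring.
      rewrite -[leLHS]mulrA ler_wpM2l ?sqr_ge0//.
      apply: (@le_trans _ _ ((2 * expR `|x|) * expR `|h * x|)).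
        by rewrite ler_wpM2r ?expR_ge0.
      by rewrite -mulrA ler_wpM2l// mulrC exp2.
  move: hb; rewrite RintegralB// RintegralZl// RX mulr0 subr0 E1.
  have ge := expR_ge1Dx (h * m + h ^+ 2 * s ^+ 2 / 2).
  have sq : 0 <= h ^+ 2 * s ^+ 2 by rewrite mulr_ge0 ?sqr_ge0.
  move=> /(le_trans (ler_norm _)); lra.
have m0 : m = 0.
  apply: (@small_zero _ (2 * W)) => h h0 h1.
  have n1 : `|h| <= 1 by rewrite gtr0_norm.
  have n2 : `|- h| <= 1 by rewrite normrN.
  have := first_order _ n1; have := first_order _ n2; rewrite sqrrN expr2 => b2 b1.
  rewrite ler_norml; apply/andP; split; rewrite -(ler_pM2l h0); lra.
have s2 : s ^+ 2 = v.
  apply/eqP; rewrite -subr_eq0; apply/eqP.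
  apply: (@small_zero _ (12 * W + s ^+ 4 * expR (s ^+ 2 / 2) / 2)) => h h0 h1.
  have n1 : `|h| <= 1 by rewrite gtr0_norm.
  pose z := h ^+ 2 * s ^+ 2 / 2.
  have iq : P.-integrable setT (EFin \o (fun w => h ^+ 2 / 2 * X w ^+ 2)).
    exact: integrable_scale.
  have i2 : P.-integrable setT (EFin \o (fun w => expR (h * X w) - 1 - h * X w)).
    rewrite (_ : _ \o _ = (EFin \o (fun w => (expR (h * X w) - 1)%R)) \- (EFin \o (fun w => (h * X w)%R)))%E//.
    exact: integrableB.
  have hb : `|\int[P]_w (expR (h * X w) - 1 - h * X w - h ^+ 2 / 2 * X w ^+ 2)| <= 6 * h ^+ 3 * W.
    apply: (@bnd (fun x => expR (h * x) - 1 - h * x - h ^+ 2 / 2 * x ^+ 2) (6 * h ^+ 3)).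
    - apply: measurable_funB => //; apply: measurable_funM => //; exact: measurable_funX.
    - by rewrite mulr_ge0// exprn_ge0// ltW.
    - move=> x; have := exp_taylor3 (h * x).
      rewrite exprMn [_ / 2]mulrAC => /le_trans; apply.
      have := pow_le_exp x 3; rewrite (_ : 3`!%:R = 6 :> R)// => p3.
      have -> : `|h * x| ^+ 3 = h ^+ 3 * `|x| ^+ 3.
        by rewrite normrM (gtr0_norm h0) exprMn.
      rewrite [leRHS](_ : _ = h ^+ 3 * (6 * expw 2 x)); last by ring.
      rewrite -[leLHS]mulrA ler_wpM2l ?exprn_ge0 ?(ltW h0)//.
      apply: (@le_trans _ _ ((6 * expR `|x|) * expR `|h * x|)).
        by rewrite ler_wpM2r ?expR_ge0.
      by rewrite -mulrA ler_wpM2l// mulrC exp2.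
  move: hb; rewrite RintegralB// RintegralB// E1.
  rewrite !RintegralZl// RX RX2 mulr0 subr0 m0 mulr0 add0r -/z.
  have := exp_taylor2 z.
  have z0 : 0 <= z by rewrite divr_ge0// mulr_ge0 ?sqr_ge0.
  have zs : expR z <= expR (s ^+ 2 / 2).
    rewrite ler_expR /z ler_pM2r ?invr_gt0// ler_piMl ?sqr_ge0//.
    by rewrite expr_le1// ltW.
  rewrite (ger0_norm z0) => t2 t3.
  have z2 : z ^+ 2 * expR z <= h ^+ 4 * s ^+ 4 / 4 * expR (s ^+ 2 / 2).
    have -> : h ^+ 4 * s ^+ 4 / 4 = z ^+ 2 by rewrite /z; field.
    by rewrite ler_wpM2l ?sqr_ge0.
  have h4 : h ^+ 4 <= h ^+ 3 by rewrite exprS ler_piMl ?exprn_ge0 ?(ltW h0).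
  have E0 : 0 <= s ^+ 4 * expR (s ^+ 2 / 2) / 4.
    by rewrite divr_ge0// mulr_ge0 ?expR_ge0// (exprM s 2 2) sqr_ge0.
  have z3 : z ^+ 2 * expR z <= h ^+ 3 * (s ^+ 4 * expR (s ^+ 2 / 2) / 4).
    apply: (le_trans z2); rewrite [leLHS](_ : _ = h ^+ 4 * (s ^+ 4 * expR (s ^+ 2 / 2) / 4)); last by ring.
    by rewrite ler_wpM2r.
  (* second order: z = h^2 s^2 / 2 is compared with h^2 v / 2 up to O(h^3) *)
  have key : `|z - h ^+ 2 / 2 * v| <= h ^+ 3 * (6 * W + s ^+ 4 * expR (s ^+ 2 / 2) / 4).
    have -> : z - h ^+ 2 / 2 * v = (expR z - 1 - h ^+ 2 / 2 * v) - (expR z - 1 - z) by ring.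
    apply: (le_trans (ler_normB _ _)); lra.
  have h20 : 0 < h ^+ 2 / 2 by rewrite divr_gt0// exprn_gt0.
  rewrite -(ler_pM2l h20) -{1}(gtr0_norm h20) -normrM.
  have -> : h ^+ 2 / 2 * (s ^+ 2 - v) = z - h ^+ 2 / 2 * v by rewrite /z; field.
  apply: (le_trans key); rewrite le_eqVlt; apply/orP; left; apply/eqP; by field.
by move=> t; split => //; rewrite Rexp m0 mulr0 add0r s2.
Qed.

End gaussian_mgf.

(** * Charges evaluated on rectangles *)

Section rectangle_mass.
Context {R : realType}.
Local Open Scope ereal_scope.

(** Incidence of a point and a rectangle, jointly in centre, edges and point:
    four weak inequalities between measurable functions. *)
Lemma measurable_incidence :
  measurable [set q : (plane R * plane R) * plane R | B q.1.1 q.1.2 q.2].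
Proof.
have mle (f g : (plane R * plane R) * plane R -> R) :
    measurable_fun setT f -> measurable_fun setT g -> measurable [set q | (f q <= g q)%R].
  by move=> mf mg; rewrite -[X in measurable X]setTI; exact: (measurable_fun_ler mf mg _ (Y := [set true])).
have m11 : measurable_fun setT (fun q : (plane R * plane R) * plane R => q.1.1.1 : R).
  by apply: (measurableT_comp measurable_fst); apply: (measurableT_comp measurable_fst).
have m12 : measurable_fun setT (fun q : (plane R * plane R) * plane R => q.1.1.2 : R).
  by apply: (measurableT_comp measurable_snd); apply: (measurableT_comp measurable_fst).
have m21 : measurable_fun setT (fun q : (plane R * plane R) * plane R => q.1.2.1 : R).
  by apply: (measurableT_comp measurable_fst); apply: (measurableT_comp measurable_snd).
have m22 : measurable_fun setT (fun q : (plane R * plane R) * plane R => q.1.2.2 : R).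
  by apply: (measurableT_comp measurable_snd); apply: (measurableT_comp measurable_snd).
have m31 : measurable_fun setT (fun q : (plane R * plane R) * plane R => q.2.1 : R).
  by apply: (measurableT_comp measurable_fst).
have m32 : measurable_fun setT (fun q : (plane R * plane R) * plane R => q.2.2 : R).
  by apply: (measurableT_comp measurable_snd).
rewrite (_ : [set q | _] =
  ([set q : (plane R * plane R) * plane R | (q.1.1.1 - q.1.2.1 / 2 <= q.2.1)%R] `&`
   [set q : (plane R * plane R) * plane R | (q.2.1 <= q.1.1.1 + q.1.2.1 / 2)%R]) `&`
  ([set q : (plane R * plane R) * plane R | (q.1.1.2 - q.1.2.2 / 2 <= q.2.2)%R] `&`
   [set q : (plane R * plane R) * plane R | (q.2.2 <= q.1.1.2 + q.1.2.2 / 2)%R])); last first.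
  apply/seteqP; split => -[[x u] y]; rewrite /B /= !in_itv /=.
    by move=> [/andP[? ?] /andP[? ?]].
  by move=> [[-> ->] [-> ->]].
have half (f : (plane R * plane R) * plane R -> R) :
    measurable_fun setT f -> measurable_fun setT (fun q => f q / 2)%R.
  by move=> mf; apply: measurable_funM.
apply: measurableI; apply: measurableI.
- exact: (mle _ _ (measurable_funB m11 (half _ m21)) m31).
- exact: (mle _ _ m31 (measurable_funD m11 (half _ m21))).
- exact: (mle _ _ (measurable_funB m12 (half _ m22)) m32).
- exact: (mle _ _ m32 (measurable_funD m12 (half _ m22))).
Qed.

Lemma measurable_B (x u : plane R) : measurable (B x u).
Proof. by apply: measurableX; exact: measurable_itv. Qed.

Lemma measurable_quadrant : measurable (@quadrant R).
Proof.
rewrite (_ : quadrant = `]0%R, +oo[%classic `*` `]0%R, +oo[%classic); last first.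
  by apply/seteqP; split => -[x y]; rewrite /quadrant /= !in_itv /= !andbT.
by apply: measurableX; exact: measurable_itv.
Qed.

Lemma measurable_rectangles : measurable (@rectangles R).
Proof. by apply: measurableX => //; exact: measurable_quadrant. Qed.

(** Jordan decomposition; it reduces questions about charges to finite measures,
    to which Tonelli's theorem applies. *)
Lemma charge_split (nu : signed_measure R) :
  exists p n : {finite_measure set (plane R) -> \bar R},
    forall A, measurable A -> nu A = p A - n A.
Proof.
have [D [E DE]] := Hahn_decomposition nu.
exists (jordan_pos DE), (jordan_neg DE) => A mA.
by rewrite (jordan_decomp DE mA) /cadd/= /cscale /= EFinN mulN1e.
Qed.

(** B(x,u) contains y if and only if B(y,u) contains x. *)
Lemma volume_of_centres (u y : plane R) : quadrant u ->
  leb2 [set x | B x u y] = (u.1 * u.2)%:E.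
Proof.
move=> [u1 u2].
rewrite (_ : [set x | _] = [set` (`[(y.1 : R) - u.1 / 2, (y.1 : R) + u.1 / 2]%R)] `*`
    [set` (`[(y.2 : R) - u.2 / 2, (y.2 : R) + u.2 / 2]%R)]); last first.
  apply/seteqP; split => -[a b]; rewrite /B /= !in_itv /=.
    by move=> [/andP[? ?] /andP[? ?]]; split; apply/andP; split; lra.
  by move=> [/andP[? ?] /andP[? ?]]; split; apply/andP; split; lra.
rewrite /leb2 product_measure1E//; try exact: measurable_itv.
have side (c l : R) : (0 < l)%R ->
    lebesgue_measure [set` (`[(c - l / 2)%R, (c + l / 2)%R])] = l%:E.
  move=> l0; rewrite lebesgue_measure_itv /= lte_fin ifT; last by lra.
  by rewrite -EFinB; congr (_%:E); lra.
by rewrite EFinM -(side y.1 _ u1) -(side y.2 _ u2).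
Qed.

Lemma measurable_measure_B (p : {finite_measure set (plane R) -> \bar R}) :
  measurable_fun setT (fun z : plane R * plane R => p (B z.1 z.2)).
Proof.
have := measurable_fun_xsection p measurable_incidence.
rewrite (_ : _ \o _ = fun z : plane R * plane R => p (B z.1 z.2))//.
apply/funext => z; congr (p _); apply/seteqP; split => y; rewrite /xsection /= inE//=.
Qed.

(** Tonelli's theorem for the incidence relation between centres and points. *)
Lemma integral_measure_B (p : {finite_measure set (plane R) -> \bar R}) (u : plane R) :
  quadrant u -> \int[leb2]_x p (B x u) = (u.1 * u.2)%:E * p setT.
Proof.
move=> qu.
pose G (q : plane R * plane R) : \bar R := (\1_[set q : plane R * plane R | B q.1 u q.2] q)%:E.
have mG0 : measurable [set q : plane R * plane R | B q.1 u q.2].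
  have mt : measurable_fun setT (fun q : plane R * plane R => ((q.1, u), q.2)).
    by apply: measurable_fun_pair => //; exact: measurable_fun_pair.
  by rewrite -[X in measurable X]setTI; exact: (mt measurableT _ measurable_incidence).
have mG : measurable_fun setT G by apply/measurable_EFinP; exact: measurable_indic.
have G0 q : 0 <= G q by rewrite lee_fin.
transitivity (\int[leb2]_x \int[p]_y G (x, y)).
  apply: eq_integral => x _; by rewrite -[in LHS](setIT (B x u)) -integral_indic//; exact: measurable_B.
rewrite (@fubini_tonelli _ _ _ _ _ leb2 p G mG G0).
transitivity (\int[p]_y (cst (u.1 * u.2)%:E) y).
  apply: eq_integral => y _; rewrite -(volume_of_centres y qu).
  have my : measurable [set x | B x u y].
    have mt : measurable_fun setT (fun x : plane R => (x, y)).
      exact: measurable_fun_pair.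
    by rewrite -[X in measurable X]setTI; exact: (mt measurableT _ mG0).
  by rewrite -[in RHS](setIT [set x | B x u y]) -integral_indic.
by rewrite integral_cst.
Qed.

(** The value of a charge on a rectangle as a real function of centre and edges,
    with value 0 at degenerate edge lengths. *)
Definition mass (mu : signed_measure R) : plane R * plane R -> R :=
  (fun z => fine (mu (B z.1 z.2))) \_ rectangles.

Lemma massE mu z : rectangles z -> (mass mu z)%:E = mu (B z.1 z.2).
Proof.
move=> rz; rewrite /mass patchE mem_set// fineK//.
exact: (fin_num_measure mu _ (measurable_B _ _)).
Qed.

Lemma mass_out mu z : ~ rectangles z -> mass mu z = 0%R.
Proof. by move=> rz; rewrite /mass patchE memNset. Qed.

Lemma mass_combination (a b : R) (mu nu : signed_measure R) z :
  mass (cadd (cscale a mu) (cscale b nu)) z = (a * mass mu z + b * mass nu z)%R.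
Proof.
have [rz|rz] := pselect (rectangles z); last by rewrite !mass_out// !mulr0 addr0.
by apply: EFin_inj; rewrite EFinD !EFinM !massE.
Qed.

Lemma measurable_mass mu : measurable_fun setT (mass mu).
Proof.
apply/(measurable_restrictT _ measurable_rectangles); apply: measurable_funTS.
have [p [n pn]] := charge_split mu.
apply: (measurableT_comp (f := fine)) => //.
rewrite (_ : (fun z => _) = fun z : plane R * plane R => p (B z.1 z.2) - n (B z.1 z.2)).
  by apply: emeasurable_funB; exact: measurable_measure_B.
by apply/funext => z; rewrite pn//; exact: measurable_B.
Qed.

Lemma mass_dominated mu :
  exists p n : {finite_measure set (plane R) -> \bar R},
    forall z, (`|mass mu z|%:E <= p (B z.1 z.2) + n (B z.1 z.2)).
Proof.
have [p [n pn]] := charge_split mu.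
exists p, n => z.
have mB := measurable_B z.1 z.2.
have [rz|rz] := pselect (rectangles z); last by rewrite mass_out// normr0 adde_ge0.
rewrite -abse_EFin massE// pn//.
apply: (le_trans (lee_abs_sub _ _)).
by rewrite !gee0_abs.
Qed.

Lemma mass_bounded mu : exists2 K : R, (0 <= K)%R & forall z, (`|mass mu z| <= K)%R.
Proof.
have [p [n hp]] := mass_dominated mu.
have fin : p setT + n setT \is a fin_num by rewrite fin_numD !fin_num_measure.
exists (fine (p setT + n setT)) => [|z]; first by apply: fine_ge0; rewrite adde_ge0.
rewrite -lee_fin fineK//.
apply: (le_trans (hp z)); apply: leeD;
  apply: le_measure; rewrite ?inE//; exact: measurable_B.
Qed.

(** Translates of B(0,u) see each point of the total variation with weight u1 u2. *)
Lemma integral_mass_le mu : exists2 K : R, (0 <= K)%R & forall u, quadrant u ->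
  \int[leb2]_x `|mass mu (x, u)|%:E <= (K * (u.1 * u.2))%:E.
Proof.
have [p [n hp]] := mass_dominated mu.
have fin : p setT + n setT \is a fin_num by rewrite fin_numD !fin_num_measure.
exists (fine (p setT + n setT)) => [|u qu]; first by apply: fine_ge0; rewrite adde_ge0.
have mu0 : measurable_fun setT (fun x : plane R => (x, u)).
  exact: measurable_fun_pair.
have mc (q : {finite_measure set (plane R) -> \bar R}) :
    measurable_fun setT (fun x : plane R => q (B x u)).
  exact: (measurableT_comp (measurable_measure_B q) mu0).
rewrite EFinM fineK// muleC ge0_muleDr// -!(integral_measure_B _ qu) -ge0_integralD//.
apply: ge0_le_integral => //.
- apply/measurable_EFinP; apply: measurableT_comp => //.
  exact: (measurableT_comp (measurable_mass mu) mu0).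
- by apply: emeasurable_funD; exact: mc.
Qed.

End rectangle_mass.

(** * The intensity measure *)

Section intensity_integral.
Context {R : realType}.
Local Open Scope ereal_scope.

Lemma density_integral (F : probability (plane R) R) (gamma1 gamma2 : R) f1 f2 :
  edge_density gamma1 f1 -> edge_density gamma2 f2 -> has_product_density F f1 f2 ->
  forall h : plane R -> \bar R, measurable_fun setT h -> (forall u, 0 <= h u) ->
    \int[F]_u h u = \int[leb2]_u (h u * (halfline f1 u.1 * halfline f2 u.2)%:E).
Proof.
move=> hf1 hf2 hF h mh h0.
apply: (ge0_integral_density measurableT) => //.
- apply: measurable_funM.
    exact: (measurableT_comp (measurable_halfline hf1)).
  exact: (measurableT_comp (measurable_halfline hf2)).
- by move=> u _; rewrite mulr_ge0 ?(halfline_ge0 hf1) ?(halfline_ge0 hf2).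
move=> A mA; apply: (eq_trans (hF A mA)); rewrite setIT integral_mkcondr.
apply: eq_integral => u _; rewrite !halflineE patchE.
case: ifPn => [|].
  by rewrite inE => -[-> ->].
move=> /negP; rewrite inE => q.
case: ifPn => u1; last by rewrite mul0r.
by case: ifPn => u2; [exfalso; apply: q|rewrite mulr0].
Qed.

(** Under the intensity measure, centres are Lebesgue-distributed and edges are
    rho times an edge vector of law F. *)
Lemma intensity_measure (F : probability (plane R) R) (l rho : R) : (0 < l)%R ->
  exists m : {measure set (plane R * plane R) -> \bar R},
    (m : set _ -> \bar R) = intensity l F rho /\
    forall h : plane R * plane R -> \bar R, measurable_fun setT h -> (forall z, 0 <= h z) ->
      \int[m]_z h z =
      l%:E * \int[F]_u \int[leb2]_x h (x, ((rho * u.1)%R, (rho * u.2)%R)).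
Proof.
move=> l0.
pose sc : plane R -> plane R := fun u => ((rho * u.1)%R, (rho * u.2)%R).
have msc : measurable_fun setT sc by exact: measurable_plane_scale.
pose X : {mfun plane R >-> plane R} := HB.pack sc (isMeasurableFun.Build _ _ _ _ sc msc).
pose G := distribution F X.
exists (mscale (NngNum (ltW l0)) (leb2 \x G)); split.
  by apply/funext => A.
move=> h mh h0.
rewrite ge0_integral_mscale//=; congr (_ * _).
rewrite (@fubini_tonelli2 _ _ _ _ _ leb2 G h mh h0).
rewrite /G /distribution ge0_integral_pushforward//.
  exact: (@measurable_fun_fubini_tonelli_G _ _ _ _ _ leb2 h).
by move=> u _; exact: integral_ge0.
Qed.

End intensity_integral.

(** * The energy of a charge and the limit covariance *)

Section energy.
Context {R : realType}.
Local Open Scope ereal_scope.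

(** The quantity that is bounded in the definition of the index space. *)
Definition energy (mu : signed_measure R) (u : plane R) : R :=
  fine (\int[leb2]_x (mass mu (x, u) ^+ 2)%R%:E).

Let msq (mu : signed_measure R) : measurable_fun setT (fun z => (mass mu z ^+ 2)%R%:E).
Proof. by apply/measurable_EFinP/measurable_funX; exact: measurable_mass. Qed.

Let sq0 (mu : signed_measure R) z : 0 <= (mass mu z ^+ 2)%R%:E.
Proof. by rewrite lee_fin sqr_ge0. Qed.

Lemma energy_ge0 (mu : signed_measure R) u : (0 <= energy mu u)%R.
Proof. by apply/fine_ge0/integral_ge0. Qed.

Lemma measurable_energy (mu : signed_measure R) : measurable_fun setT (energy mu).
Proof.
apply: (measurableT_comp (f := fine)) => //.
exact: (@measurable_fun_fubini_tonelli_G _ _ _ _ _ leb2 (fun z => (mass mu z ^+ 2)%R%:E)).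
Qed.

Lemma mass_off_quadrant (mu : signed_measure R) x u : ~ quadrant u -> mass mu (x, u) = 0%R.
Proof. by move=> qu; apply: mass_out => -[]. Qed.

Context (gamma1 gamma2 : R).

Lemma energy_le mu : M gamma1 gamma2 mu ->
  exists C alpha1 alpha2 : R, [/\ (gamma1 < alpha1)%R, (gamma2 < alpha2)%R &
    forall u, quadrant u -> (energy mu u <= C * (wmin alpha1 u.1 * wmin alpha2 u.2))%R].
Proof.
move=> [C [a1 [a2 [C0 /andP[ga1 _] /andP[ga2 _] h]]]].
exists C, a1, a2; split => // u qu; have := h u qu.
rewrite (eq_integral (fun x => (mass mu (x, u) ^+ 2)%R%:E)); last first.
  by move=> x _; rewrite EFin_expe massE.
rewrite -mulrA => hle; rewrite -lee_fin fineK//.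
by rewrite ge0_fin_numE ?integral_ge0//; exact: (le_lt_trans hle (ltry _)).
Qed.

Lemma energyE mu u : M gamma1 gamma2 mu ->
  (energy mu u)%:E = \int[leb2]_x (mass mu (x, u) ^+ 2)%R%:E.
Proof.
move=> [C [a1 [a2 [C0 _ _ h]]]].
have [qu|qu] := pselect (quadrant u); last first.
  rewrite /energy integral0_eq// => x _.
  by rewrite mass_off_quadrant// expr0n.
have := h u qu.
rewrite (eq_integral (fun x => (mass mu (x, u) ^+ 2)%R%:E)); last first.
  by move=> x _; rewrite EFin_expe massE.
move=> hle; rewrite fineK// ge0_fin_numE ?integral_ge0//; exact: (le_lt_trans hle (ltry _)).
Qed.

Definition tails (u : plane R) : R := tail gamma1 u.1 * tail gamma2 u.2.

Lemma tails_ge0 u : (0 <= tails u)%R.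
Proof. by rewrite mulr_ge0 ?tail_ge0. Qed.

Lemma measurable_tails : measurable_fun setT tails.
Proof.
apply: measurable_funM.
  exact: (measurableT_comp (measurable_tail gamma1)).
exact: (measurableT_comp (measurable_tail gamma2)).
Qed.

Let mtails2 : measurable_fun setT (fun z : plane R * plane R => tails z.2).
Proof. exact: (measurableT_comp measurable_tails). Qed.

Lemma integral_sqr_mass_tails mu : M gamma1 gamma2 mu ->
  \int[(leb2 \x leb2)%E]_z (mass mu z ^+ 2 * tails z.2)%R%:E =
  \int[leb2]_u (energy mu u * tails u)%R%:E.
Proof.
move=> hmu.
rewrite (@fubini_tonelli2 _ _ _ _ _ leb2 leb2
  (fun z => (mass mu z ^+ 2 * tails z.2)%R%:E)); last 2 first.
- by apply/measurable_EFinP; apply: measurable_funM => //; apply: measurable_funX; exact: measurable_mass.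
- by move=> z; rewrite lee_fin mulr_ge0 ?tails_ge0// sqr_ge0.
apply: eq_integral => u _; rewrite EFinM energyE// -ge0_integralZr//.
- exact: (measurableT_comp (msq mu) (measurable_pair2 u)).
- by rewrite lee_fin tails_ge0.
Qed.

Lemma C_Z_integrandE mu nu z : rectangles z ->
  C_Z_integrand gamma1 gamma2 mu nu z = (mass mu z * mass nu z * tails z.2)%R%:E.
Proof.
move=> rz; rewrite /C_Z_integrand -!massE// -!EFinM /tails /tail; congr (_%:E).
case: rz => _ [u1 u2]; rewrite u1 u2 !div1r -!powRN.
by rewrite !opprD.
Qed.

Context (f1 f2 : R -> R).
Hypothesis hf1 : edge_density gamma1 f1.
Hypothesis hf2 : edge_density gamma2 f2.

(** This is the finiteness of C_Z(mu,mu). *)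
Lemma energy_tails_fin mu : M gamma1 gamma2 mu ->
  \int[leb2]_u (energy mu u * tails u)%R%:E < +oo.
Proof.
move=> hmu; have [C [a1 [a2 [ga1 ga2 hC]]]] := energy_le hmu.
exact: (limit_integral_fin ga1 ga2 hf1 hf2 (measurable_energy mu) (energy_ge0 mu) hC).
Qed.

Let integrable_sqr mu : M gamma1 gamma2 mu ->
  (leb2 \x leb2)%E.-integrable setT (fun z => (mass mu z ^+ 2 * tails z.2)%R%:E).
Proof.
move=> hmu; apply/integrableP; split.
  by apply/measurable_EFinP; apply: measurable_funM => //; apply: measurable_funX; exact: measurable_mass.
under eq_integral => z _ do rewrite gee0_abs ?lee_fin ?(mulr_ge0 (sqr_ge0 _) (tails_ge0 _))//.
by rewrite integral_sqr_mass_tails//; exact: energy_tails_fin.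
Qed.

(** By |ab| <= a^2 + b^2 the covariance integrand is dominated by two variance
    integrands. *)
Lemma C_Z_integrable mu nu : M gamma1 gamma2 mu -> M gamma1 gamma2 nu ->
  (leb2 \x leb2)%E.-integrable rectangles (C_Z_integrand gamma1 gamma2 mu nu).
Proof.
move=> hmu hnu.
apply: (eq_integrable measurable_rectangles (fun z => (mass mu z * mass nu z * tails z.2)%R%:E)).
  by move=> z; rewrite inE => rz; rewrite C_Z_integrandE.
apply: (integrableS measurableT measurable_rectangles) => //.
apply: (le_integrable measurableT _ _ (integrableD measurableT (integrable_sqr hmu) (integrable_sqr hnu))).
  apply/measurable_EFinP; apply: measurable_funM => //.
  by apply: measurable_funM; exact: measurable_mass.
move=> z _ /=; rewrite lee_fin -mulrDl !(normrM _ (tails z.2)) (normrM (mass mu z)).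
rewrite (ger0_norm (tails_ge0 _)) ler_wpM2r ?tails_ge0//.
rewrite [X in (_ <= X)%R]ger0_norm ?addr_ge0 ?sqr_ge0//.
rewrite -(real_normK (num_real (mass mu z))) -(real_normK (num_real (mass nu z))).
have ab (a b : R) : (a * b <= a ^+ 2 + b ^+ 2)%R.
  have := sqr_ge0 (a - b)%R; have := sqr_ge0 a; have := sqr_ge0 b.
  by move=> ? ? ?; nra.
exact: ab.
Qed.

Lemma C_Z_diag mu : M gamma1 gamma2 mu ->
  C_Z gamma1 gamma2 mu mu = \int[leb2]_u (energy mu u * tails u)%R%:E.
Proof.
move=> hmu; rewrite -integral_sqr_mass_tails// /C_Z integral_mkcond.
apply: eq_integral => z _; rewrite patchE; case: ifPn => [|/negP].
  by rewrite inE => rz; rewrite C_Z_integrandE.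
by rewrite inE => rz; rewrite mass_out// expr0n/= mul0r.
Qed.

End energy.

(** * Exponential moments of the centred field *)

Lemma ae_eq_mean (R : realType) d (T : measurableType d) (P : {measure set T -> \bar R})
    (X Y : T -> R) : measurable_fun setT Y -> {ae P, forall w, X w = Y w} ->
  P.-integrable setT (EFin \o X) ->
  P.-integrable setT (EFin \o Y) /\ \int[P]_w X w = \int[P]_w Y w.
Proof.
move=> mY ae iX; have mX : measurable_fun setT (EFin \o X) by case/integrableP : iX.
have mEY : measurable_fun setT (EFin \o Y) by exact/measurable_EFinP.
split.
  apply/integrableP; split => //.
  rewrite (ae_eq_integral (fun w => `|(X w)%:E|)%E) => //.
  - by case/integrableP : iX.
  - exact: measurableT_comp.
  - exact: measurableT_comp.
  - by apply: filterS ae => w /= ->.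
by congr fine; apply: ae_eq_integral => //; apply: filterS ae => w /= ->.
Qed.

Section exponent.
Context {R : realType} d (T : measurableType d) (m : {measure set T -> \bar R}).
Context (f : T -> R) (K : R).
Hypothesis mf : measurable_fun setT f.
Hypothesis fi : m.-integrable setT (EFin \o f).
Hypothesis fK : forall x, `|f x| <= K.

Let K0 (x : T) : 0 <= K. Proof. exact: le_trans (normr_ge0 _) (fK x). Qed.

Let normi (c : R) : m.-integrable setT (EFin \o (fun x => c * `|f x|)).
Proof.
rewrite (_ : _ \o _ = fun x => (c%:E * (abse \o (EFin \o f)) x)%E)//.
by apply: integrableZl => //; exact: integrable_abse.
Qed.

Lemma integrable_sqr_of_bounded : m.-integrable setT (EFin \o (fun x => f x ^+ 2)).
Proof.
apply: (integrable_bound (g := fun x => K * `|f x|)) => // [|x].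
  exact: measurable_funX.
by rewrite normrX expr2 ler_wpM2r.
Qed.

Lemma integrable_exp_sub1 (t : R) : m.-integrable setT (EFin \o (fun x => expR (t * f x) - 1)).
Proof.
apply: (integrable_bound (g := fun x => (expR (`|t| * K) * `|t|) * `|f x|)) => // [|x].
  apply: measurable_funB => //; apply: measurableT_comp => //; exact: measurable_funM.
apply: (le_trans (exp_taylor1 _)); rewrite normrM mulrC mulrA.
rewrite ler_wpM2r// ler_wpM2r// ler_expR.
by rewrite ler_wpM2l.
Qed.

(** The exponent of the centred exponential moment is t^2/2 int f^2 dm up to a
    third-order Taylor remainder, in which one factor |f| is absorbed by the
    bound K. *)
Lemma compensated_exponent_bound (t : R) :
  `|\int[m]_x (expR (t * f x) - 1) - t * \int[m]_x f x - t ^+ 2 / 2 * \int[m]_x (f x ^+ 2)| <=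
  `|t| ^+ 3 * K * expR (`|t| * K) * \int[m]_x (f x ^+ 2).
Proof.
have i2 := integrable_sqr_of_bounded.
have iZ (c : R) g : m.-integrable setT (EFin \o g) -> m.-integrable setT (EFin \o (fun x => c * g x)).
  move=> ig; exact: integrable_scale.
have iB g h : m.-integrable setT (EFin \o g) -> m.-integrable setT (EFin \o h) ->
    m.-integrable setT (EFin \o (fun x => g x - h x)).
  move=> ig ih; rewrite (_ : _ \o _ = (EFin \o g) \- (EFin \o h))%E//.
  exact: integrableB.
rewrite -(RintegralZl t measurableT fi) -(RintegralZl (t ^+ 2 / 2) measurableT i2).
rewrite -(RintegralB measurableT (integrable_exp_sub1 t) (iZ t _ fi)).
rewrite -(RintegralB measurableT (iB _ _ (integrable_exp_sub1 t) (iZ t _ fi)) (iZ _ _ i2)).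
have i1 := iB _ _ (iB _ _ (integrable_exp_sub1 t) (iZ t _ fi)) (iZ (t ^+ 2 / 2) _ i2).
apply: (le_trans (le_normr_Rintegral _ i1)) => //.
rewrite -(RintegralZl _ measurableT i2).
apply: le_Rintegral => //; [exact: (integrable_abse i1)|exact: iZ|].
move=> x _; have := exp_taylor3 (t * f x).
rewrite exprMn [_ / 2]mulrAC => /le_trans; apply.
rewrite -(real_normK (num_real (f x))) normrM.
have b0 := normr_ge0 (f x); have a0 := normr_ge0 t; have bK := fK x.
move: (`|f x|) (`|t|) b0 a0 bK => b a b0 a0 bK.
rewrite (_ : (a * b) ^+ 3 * expR (a * b) = a ^+ 3 * b ^+ 2 * (b * expR (a * b))); last by ring.
rewrite (_ : a ^+ 3 * K * expR (a * K) * b ^+ 2 = a ^+ 3 * b ^+ 2 * (K * expR (a * K))); last by ring.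
apply: ler_wpM2l; first by apply: mulr_ge0; exact: exprn_ge0.
by apply: ler_pM => //; rewrite ler_expR ler_wpM2l.
Qed.

End exponent.

Section poisson_field.
Context {R : realType} (gamma1 gamma2 : R) (f1 f2 : R -> R).
Hypothesis hf1 : edge_density gamma1 f1.
Hypothesis hf2 : edge_density gamma2 f2.
Context (F : probability (plane R) R).
Hypothesis hF : has_product_density F f1 f2.
Local Notation leb := (@lebesgue_measure R).

Definition edge_weight (u : plane R) : R := halfline f1 u.1 * halfline f2 u.2.

Lemma edge_weight_ge0 u : 0 <= edge_weight u.
Proof. by apply: mulr_ge0; [exact: (halfline_ge0 hf1)|exact: (halfline_ge0 hf2)]. Qed.

Lemma measurable_edge_weight : measurable_fun setT edge_weight.
Proof.
apply: measurable_funM.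
  exact: (measurableT_comp (measurable_halfline hf1)).
exact: (measurableT_comp (measurable_halfline hf2)).
Qed.

Section one_scale.
Context (l rho : R).
Hypothesis l0 : 0 < l.
Hypothesis rho0 : 0 < rho.
Context (m : {measure set (plane R * plane R) -> \bar R}).
Hypothesis hm : forall h : plane R * plane R -> \bar R,
  measurable_fun setT h -> (forall z, 0 <= h z)%E ->
  (\int[m]_z h z =
   l%:E * \int[F]_u \int[leb2]_x h (x, ((rho * u.1)%R, (rho * u.2)%R)))%E.

Lemma intensity_integral (h : plane R * plane R -> \bar R) :
  measurable_fun setT h -> (forall z, 0 <= h z)%E ->
  (\int[m]_z h z = l%:E * \int[leb2]_u
    ((\int[leb2]_x h (x, ((rho * u.1)%R, (rho * u.2)%R))) * (edge_weight u)%:E))%E.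
Proof.
move=> mh h0; rewrite hm//; congr (_ * _)%E.
have mG := @measurable_fun_fubini_tonelli_G _ _ _ _ _ leb2 h mh h0.
apply: (density_integral hf1 hf2 hF (measurableT_comp mG (measurable_plane_scale rho))).
by move=> u; exact: integral_ge0.
Qed.

(** The integral of |f| is at most lambda K rho^2 times the product of the mean
    edge lengths. *)
Lemma mass_integrable (mu : signed_measure R) : m.-integrable setT (EFin \o mass mu).
Proof.
have mm : measurable_fun setT (mass mu) by exact: measurable_mass.
apply/integrableP; split; first exact/measurable_EFinP.
have [K K0 hK] := integral_mass_le mu.
have mabs : measurable_fun setT (fun z => `|(EFin \o mass mu) z|)%E.
  by apply: measurableT_comp => //; apply/measurable_EFinP.
rewrite intensity_integral//.
rewrite lte_mul_pinfty ?lee_fin ?(ltW l0)//.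
have mean0 u : (0 <= (K * rho ^+ 2)%:E * ((u.1 * halfline f1 u.1)%:E * (u.2 * halfline f2 u.2)%:E))%E.
  rewrite -!EFinM lee_fin; apply: mulr_ge0; first by rewrite mulr_ge0 ?exprn_ge0 ?(ltW rho0).
  by apply: mulr_ge0; [exact: (edge_mean_ge0 hf1)|exact: (edge_mean_ge0 hf2)].
have mmean gamma f (hf : edge_density gamma f) : measurable_fun setT (fun u : R => (u * halfline f u)%:E).
  by apply/measurable_EFinP; apply: measurable_funM => //; exact: (measurable_halfline hf).
have mprod : measurable_fun setT (fun u : plane R =>
    ((u.1 * halfline f1 u.1)%:E * (u.2 * halfline f2 u.2)%:E)%E).
  apply: emeasurable_funM.
    exact: (measurableT_comp (mmean _ _ hf1)).
  exact: (measurableT_comp (mmean _ _ hf2)).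
apply: (@le_lt_trans _ _ (\int[leb2]_u ((K * rho ^+ 2)%:E *
    ((u.1 * halfline f1 u.1)%:E * (u.2 * halfline f2 u.2)%:E)))%E).
  apply: ge0_le_integral => //.
  - by move=> u _; rewrite mule_ge0 ?lee_fin ?edge_weight_ge0// integral_ge0.
  - apply: emeasurable_funM; last by apply/measurable_EFinP; exact: measurable_edge_weight.
    have mG := @measurable_fun_fubini_tonelli_G _ _ _ _ _ leb2
      (fun z => `|(EFin \o mass mu) z|)%E mabs (fun=> abse_ge0 _).
    exact: (measurableT_comp mG (measurable_plane_scale rho)).
  - exact: measurable_funeM.
  - move=> u _; have [[u1 u2]|qu] := pselect (quadrant u); last first.
      rewrite (_ : edge_weight u = 0) ?mule0//.
      rewrite /edge_weight !halflineE; case: ifPn => u1; last by rewrite mul0r.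
      by case: ifPn => u2; [exfalso; apply: qu|rewrite mulr0].
    have qr : quadrant ((rho * u.1, rho * u.2) : plane R) by split; exact: mulr_gt0.
    apply: (le_trans (lee_wpmul2r _ (hK _ qr))); first by rewrite lee_fin edge_weight_ge0.
    rewrite -!EFinM lee_fin /edge_weight le_eqVlt; apply/orP; left; apply/eqP => /=.
    by ring.
rewrite ge0_integralZl_EFin//; last 2 first.
- by move=> u _; apply: mule_ge0; rewrite lee_fin; [exact: (edge_mean_ge0 hf1)|exact: (edge_mean_ge0 hf2)].
- by rewrite mulr_ge0 ?exprn_ge0 ?(ltW rho0).
rewrite (integral_leb2_prod (mmean _ _ hf1) _ (mmean _ _ hf2)); last 2 first.
- by move=> u; rewrite lee_fin (edge_mean_ge0 hf1).
- by move=> u; rewrite lee_fin (edge_mean_ge0 hf2).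
have fin gamma f (hf : edge_density gamma f) :
    (\int[leb]_u (u * halfline f u)%:E)%E \is a fin_num.
  rewrite ge0_fin_numE ?(edge_mean_fin hf)// integral_ge0// => u _.
  by rewrite lee_fin (edge_mean_ge0 hf).
by rewrite ltey_eq !fin_numM// ?(fin _ _ hf1) ?(fin _ _ hf2).
Qed.

Lemma integral_mass_sqr (mu : signed_measure R) : M gamma1 gamma2 mu ->
  (\int[m]_z ((mass mu z) ^+ 2)%:E = l%:E * \int[leb2]_u
     (energy mu ((rho * u.1)%R, (rho * u.2)%R) * edge_weight u)%:E)%E.
Proof.
move=> hmu; rewrite intensity_integral//.
- congr (_ * _)%E; apply: eq_integral => u _.
  by rewrite [RHS]EFinM (energyE _ hmu).
- by apply/measurable_EFinP/measurable_funX; exact: measurable_mass.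
- by move=> z; rewrite lee_fin sqr_ge0.
Qed.

Context d (Omega : measurableType d) (P : probability Omega R).
Context (N : Omega -> {measure set (plane R * plane R) -> \bar R}).
Hypothesis hN : poisson_random_measure P m N.

Lemma JE (mu : signed_measure R) w : J N mu w = \int[N w]_z mass mu z.
Proof.
rewrite /J integral_mkcond; congr fine; apply: eq_integral => z _.
rewrite patchE; case: ifPn => [|/negP]; rewrite inE => rz; first by rewrite massE.
by rewrite mass_out.
Qed.

(** Integrals against N are handled for every w; the default value of [fine]
    makes both sides agree also where the integral diverges. *)
Lemma J_centredE (mu : signed_measure R) w :
  J_centred P N mu w = \int[N w]_z mass mu z - \int[m]_z mass mu z.
Proof.
have mm : measurable_fun setT (mass mu) by exact: measurable_mass.
have [_ eJ] := poisson_expectation hN mm (mass_integrable mu).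
have JfE : J N mu = (fun w => \int[N w]_z mass mu z) by apply/funext => v; exact: JE.
by rewrite /J_centred JfE -eJ /Rintegral unlock.
Qed.

Lemma measurable_J_centred (mu : signed_measure R) : measurable_fun setT (J_centred P N mu).
Proof.
rewrite (_ : J_centred P N mu = fun w => \int[N w]_z mass mu z - \int[m]_z mass mu z).
  apply: measurable_funB; last exact: measurable_cst.
  by apply: (measurable_poisson_Rintegral hN); exact: measurable_mass.
by apply/funext => w; rewrite J_centredE.
Qed.

(** The Poisson formula for t f, with the deterministic centring taken out. *)
Lemma J_centred_mgf (mu : signed_measure R) (t : R) :
  P.-integrable setT (EFin \o (fun w => expR (t * J_centred P N mu w))) /\
  \int[P]_w expR (t * J_centred P N mu w) =
  expR (\int[m]_z (expR (t * mass mu z) - 1) - t * \int[m]_z mass mu z).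
Proof.
have mm : measurable_fun setT (mass mu) by exact: measurable_mass.
have mtm : measurable_fun setT (fun z => t * mass mu z) by exact: measurable_funM.
have im := mass_integrable mu.
have itm : m.-integrable setT (EFin \o (fun z => t * mass mu z)).
  exact: integrable_scale.
have [K K0 hK] := mass_bounded mu.
have bK z : `|t * mass mu z| <= `|t| * K by rewrite normrM ler_wpM2l.
have [iE eE] := poisson_mgf hN mtm itm bK.
pose c := expR (- (t * \int[m]_z mass mu z)).
have ae : {ae P, forall w, c * expR (\int[N w]_z (t * mass mu z)) =
    expR (t * J_centred P N mu w)}.
  apply: filterS (poisson_integrable_ae hN mm im) => w iw.
  by rewrite J_centredE mulrBr [RHS]expRD [RHS]mulrC (RintegralZl t measurableT iw).
have iZ : P.-integrable setT (EFin \o (fun w => c * expR (\int[N w]_z (t * mass mu z)))).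
  exact: integrable_scale.
have mL : measurable_fun setT (fun w => expR (t * J_centred P N mu w)).
  apply: measurableT_comp => //; apply: measurable_funM => //.
  exact: measurable_J_centred.
have [iL <-] := ae_eq_mean mL ae iZ.
by split => //; rewrite (RintegralZl c measurableT iE) eE [LHS]mulrC -expRD.
Qed.

Lemma J_centred_linear (D : set (signed_measure R)) : linear_field P D (J_centred P N).
Proof.
move=> a b mu nu _ _.
have integrable_comb (n : {measure set (plane R * plane R) -> \bar R}) :
    n.-integrable setT (EFin \o mass mu) -> n.-integrable setT (EFin \o mass nu) ->
    \int[n]_z mass (cadd (cscale a mu) (cscale b nu)) z =
    a * \int[n]_z mass mu z + b * \int[n]_z mass nu z.
  move=> imu inu; rewrite -(RintegralZl a measurableT imu) -(RintegralZl b measurableT inu).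
  rewrite -RintegralD//.
  - by apply: eq_Rintegral => z _; rewrite mass_combination.
  - exact: integrable_scale.
  - exact: integrable_scale.
apply: filterS2 (poisson_integrable_ae hN (measurable_mass mu) (mass_integrable mu))
  (poisson_integrable_ae hN (measurable_mass nu) (mass_integrable nu)) => w imu inu.
rewrite !J_centredE (integrable_comb _ imu inu) (integrable_comb _ (mass_integrable mu) (mass_integrable nu)).
by ring.
Qed.

End one_scale.
End poisson_field.

(** * The limit for one charge *)

Lemma fine_mulEFin (R : realType) (r : R) (x : \bar R) : fine (r%:E * x)%E = r * fine x.
Proof.
case: x => [x| |] //; rewrite mulr_infty /= mulr0;
by case: (sgrP r) => _; rewrite ?mul0e ?mul1e ?mulN1e.
Qed.

Section scaling_limit.
Context {R : realType} (gamma1 gamma2 : R).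
Hypothesis hgamma1 : 1 < gamma1.
Hypothesis hgamma2 : 1 < gamma2.
Context (f1 f2 : R -> R).
Hypothesis hf1 : edge_density gamma1 f1.
Hypothesis hf2 : edge_density gamma2 f2.
Context (F : probability (plane R) R).
Hypothesis hF : has_product_density F f1 f2.
Context (lambda : R -> R).
Hypothesis hlambda : forall rho : R, 0 < rho -> 0 < lambda rho.
Context (dO : R -> measure_display) (Omega : forall rho, measurableType (dO rho)).
Context (P : forall rho, probability (Omega rho) R).
Context (N : forall rho, Omega rho -> {measure set (plane R * plane R) -> \bar R}).
Arguments N : clear implicits.
Hypothesis hN : forall rho : R, 0 < rho ->
  poisson_random_measure (P rho) (intensity (lambda rho) F rho) (N rho).
Hypothesis hlambda_rho_oo :
  lambda rho * rho `^ (gamma1 + gamma2) @[rho --> 0^'+] --> +oo.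

Definition scale (rho : R) := Num.sqrt (lambda rho * rho `^ (gamma1 + gamma2)).

Lemma scale_gt0 rho : 0 < rho -> 0 < scale rho.
Proof. by move=> r0; rewrite sqrtr_gt0 mulr_gt0 ?hlambda ?powR_gt0. Qed.

Lemma inv_scale_cvg : (scale rho)^-1 @[rho --> 0^'+] --> 0.
Proof.
apply/gtr0_cvgV0.
  by near=> rho; apply: scale_gt0; near: rho; exact: nbhs_right_gt.
apply/cvgryPge => A; near=> rho.
apply: (le_trans (ler_norm A)); rewrite -sqrtr_sqr /scale ler_wsqrtr//.
near: rho; move/cvgryPge : hlambda_rho_oo; exact.
Unshelve. all: by end_near. Qed.

Section one_charge.
Context (mu : signed_measure R).
Hypothesis hmu : M gamma1 gamma2 mu.

Definition limit_variance : R :=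
  fine (\int[leb2]_u (energy mu u * tails gamma1 gamma2 u)%:E)%E.

Lemma limit_varianceE :
  (limit_variance)%:E = (\int[leb2]_u (energy mu u * tails gamma1 gamma2 u)%:E)%E.
Proof.
rewrite fineK// ge0_fin_numE ?(energy_tails_fin hf1 hf2)//.
by apply: integral_ge0 => u _; rewrite lee_fin mulr_ge0 ?energy_ge0 ?tails_ge0.
Qed.

Let q (rho : R) : R := rho `^ (- gamma1 - gamma2) *
  fine (\int[leb2]_u (energy mu ((rho * u.1)%R, (rho * u.2)%R) * edge_weight f1 f2 u)%:E)%E.

(** Convergence from the right is tested on sequences, as in [density_limit]. *)
Let q_cvg : q rho @[rho --> 0^'+] --> limit_variance.
Proof.
apply/cvg_at_rightP => u [u0 cu].
have [C [a1 [a2 [ga1 ga2 hC]]]] := energy_le hmu.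
have := density_limit hgamma1 hgamma2 ga1 ga2 hf1 hf2 (measurable_energy mu)
  (energy_ge0 mu) hC u0 cu.
have vE : (\int[leb2]_u (energy mu u * (tail gamma1 u.1 * tail gamma2 u.2))%:E)%E =
  limit_variance%:E by exact: esym limit_varianceE.
rewrite vE => /fine_cvg h; apply: cvg_trans h; apply: near_eq_cvg.
by apply: nearW => n; rewrite /q /= fine_mulEFin.
Qed.

(** With t = 1/s the factor lambda of the intensity cancels. *)
Let sqr_q (m : {measure set (plane R * plane R) -> \bar R}) (rho : R) : 0 < rho ->
  (\int[m]_z ((mass mu z) ^+ 2)%:E = (lambda rho)%:E * \int[leb2]_u
     (energy mu ((rho * u.1)%R, (rho * u.2)%R) * edge_weight f1 f2 u)%:E)%E ->
  (scale rho)^-1 ^+ 2 * \int[m]_z ((mass mu z) ^+ 2) = q rho.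
Proof.
move=> r0; have l0 := hlambda r0; rewrite /Rintegral => ->.
rewrite fine_mulEFin exprVn sqr_sqrtr; last by rewrite mulr_ge0 ?powR_ge0 ?(ltW l0).
rewrite /q -opprD powRN.
by field; rewrite !gt_eqF ?powR_gt0.
Qed.

(** The relative error of the exponent is O(1/s). *)
Lemma exponent_near (K : R) : (forall z, `|mass mu z| <= K) -> forall rho, 0 < rho ->
  exists2 e : R, \int[P rho]_w expR ((scale rho)^-1 * J_centred (P rho) (N rho) mu w) = expR e
    & `|e - q rho / 2| <= (scale rho)^-1 * K * expR ((scale rho)^-1 * K) * q rho.
Proof.
move=> hK rho r0; have l0 := hlambda r0.
have [m [mE hm]] := intensity_measure F rho l0.
have hNm : poisson_random_measure (P rho) m (N rho) by rewrite mE; exact: hN.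
have mm : measurable_fun setT (mass mu) by exact: measurable_mass.
have im := mass_integrable hf1 hf2 hF l0 r0 hm mu.
set t := (scale rho)^-1; have t0 : 0 < t by rewrite invr_gt0 scale_gt0.
have [_ e] := J_centred_mgf hf1 hf2 hF l0 r0 hm hNm mu t.
rewrite e; eexists; first reflexivity.
have sq := sqr_q r0 (integral_mass_sqr hf1 hf2 hF hm hmu).
have := compensated_exponent_bound mm im hK t.
rewrite (ger0_norm (ltW t0)) -/t in sq *.
rewrite [t ^+ 2 / 2 * _]mulrAC sq => /le_trans; apply.
by rewrite -sq le_eqVlt; apply/orP; left; apply/eqP; ring.
Qed.

(** The exponent tends to half of the limit variance since the error term is a
    product of the vanishing factor K/s and bounded ones. *)
Lemma J_centred_mgf_cvg :
  \int[P rho]_w expR ((scale rho)^-1 * J_centred (P rho) (N rho) mu w) @[rho --> 0^'+] -->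
  expR (limit_variance / 2).
Proof.
have [K K0 hK] := mass_bounded mu.
pose e rho := ln (\int[P rho]_w expR ((scale rho)^-1 * J_centred (P rho) (N rho) mu w)).
pose err rho := (scale rho)^-1 * K * expR ((scale rho)^-1 * K) * q rho.
have err0 : err rho @[rho --> 0^'+] --> 0.
  have tK : (scale rho)^-1 * K @[rho --> 0^'+] --> 0 * K.
    by apply: cvgM; [exact: inv_scale_cvg|exact: cvg_cst].
  rewrite mul0r in tK.
  have eK : expR ((scale rho)^-1 * K) @[rho --> 0^'+] --> expR 0.
    exact: (cvg_comp _ _ tK (@continuous_expR R 0)).
  have := cvgM (cvgM tK eK) q_cvg.
  by rewrite !mul0r => h; exact: h.
have near_e : \forall rho \near 0^'+,
    \int[P rho]_w expR ((scale rho)^-1 * J_centred (P rho) (N rho) mu w) = expR (e rho) /\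
    `|e rho - q rho / 2| <= err rho.
  near=> rho; have r0 : 0 < rho by near: rho; exact: nbhs_right_gt.
  have [x xE hx] := exponent_near hK r0.
  by rewrite /e xE expRK.
have ce : e rho @[rho --> 0^'+] --> limit_variance / 2.
  have cd : e rho - q rho / 2 @[rho --> 0^'+] --> 0.
    apply: (@squeeze_cvgr _ _ _ _ (fun rho => - err rho) err).
    - by near=> rho; rewrite -ler_norml; near: rho; apply: filterS near_e => rho [].
    - by have := cvgN err0; rewrite oppr0 => h; exact: h.
    - exact: err0.
  have cq : q rho / 2 @[rho --> 0^'+] --> limit_variance / 2.
    by apply: cvgM; [exact: q_cvg|exact: cvg_cst].
  rewrite (_ : e = fun rho => (e rho - q rho / 2) + q rho / 2); last first.
    by apply/funext => rho; rewrite subrK.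
  by rewrite -[limit_variance / 2]add0r; exact: cvgD.
have := cvg_comp _ _ ce (@continuous_expR R (limit_variance / 2)).
move=> h; apply: cvg_trans h; apply: near_eq_cvg.
by apply: filterS near_e => rho [].
Unshelve. all: by end_near. Qed.

End one_charge.
End scaling_limit.

(** * Linear combinations of charges *)

Section combinations.
Context {R : realType} (gamma1 gamma2 : R).
Hypothesis hgamma1 : 1 < gamma1 < 2.
Hypothesis hgamma2 : 1 < gamma2 < 2.

(** Taking the smaller of two exponents preserves the bounds, so the index space
    is closed under addition. *)
Lemma wmin_antitone (alpha alpha' u : R) : 0 < u -> 1 <= alpha' <= alpha ->
  wmin alpha u <= wmin alpha' u.
Proof.
move=> u0 /andP[a1 aa]; rewrite /wmin le_min ge_min lexx /=.
have [u1|u1] := leP 1 u.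
  apply: (@le_trans _ _ u); first by rewrite ge_min lexx.
  by rewrite -[leLHS]powRr1 ?(ltW u0)// ler_powR.
by rewrite ge_min (ger_powR _ aa) ?u0 ?(ltW u1)// orbT.
Qed.

Lemma M_iff (mu : signed_measure R) : M gamma1 gamma2 mu <->
  exists C alpha1 alpha2 : R, [/\ 0 < C, gamma1 < alpha1 <= 2, gamma2 < alpha2 <= 2 &
    forall u, quadrant u -> (\int[leb2]_x (mass mu (x, u) ^+ 2)%:E <=
       (C * (wmin alpha1 u.1 * wmin alpha2 u.2))%:E)%E].
Proof.
have e u : quadrant u -> (\int[leb2]_x (mu (B x u) ^+ 2) =
    \int[leb2]_x (mass mu (x, u) ^+ 2)%R%:E)%E.
  by move=> qu; apply: eq_integral => x _; rewrite EFin_expe massE.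
split=> -[C [a1 [a2 [C0 ga1 ga2 h]]]]; exists C, a1, a2; split => // u qu;
  by have := h u qu; rewrite e// mulrA.
Qed.

Lemma M_czero : M gamma1 gamma2 (czero : signed_measure R).
Proof.
apply/M_iff; exists 1, 2, 2; split => // [||u [u1 u2]].
- by case/andP : hgamma1 => _ ->/=.
- by case/andP : hgamma2 => _ ->/=.
rewrite integral0_eq; first by rewrite lee_fin !mulr_ge0 ?wmin_ge0 ?(ltW u1) ?(ltW u2).
move=> x _; have -> : mass (czero : signed_measure R) (x, u) = 0; last by rewrite expr0n.
by apply: EFin_inj; rewrite massE.
Qed.

(** From (a m + b n)^2 <= 2 a^2 m^2 + 2 b^2 n^2, with the smaller exponents. *)
Lemma M_combination (a b : R) (mu nu : signed_measure R) :
  M gamma1 gamma2 mu -> M gamma1 gamma2 nu ->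
  M gamma1 gamma2 (cadd (cscale a mu) (cscale b nu)).
Proof.
move=> /M_iff[C [c1 [c2 [C0 /andP[gc1 c12] /andP[gc2 c22] hC]]]].
move=> /M_iff[D [d1 [d2 [D0 /andP[gd1 d12] /andP[gd2 d22] hD]]]].
apply/M_iff; exists (2 * a ^+ 2 * C + 2 * b ^+ 2 * D + 1), (Num.min c1 d1), (Num.min c2 d2).
have a0 : 0 <= 2 * a ^+ 2 by apply: mulr_ge0 => //; exact: sqr_ge0.
have b0 : 0 <= 2 * b ^+ 2 by apply: mulr_ge0 => //; exact: sqr_ge0.
have ge1 (g : R) (h : 1 < g < 2) (c d : R) : g < c -> g < d -> 1 <= Num.min c d.
  by case/andP : h => h _ gc gd; rewrite le_min !ltW ?(lt_trans h).
have le1 := ge1 _ hgamma1 _ _ gc1 gd1; have le2 := ge1 _ hgamma2 _ _ gc2 gd2.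
split.
- by apply: ltr_wpDl => //; apply: addr_ge0; apply: mulr_ge0 => //; exact: ltW.
- by rewrite lt_min gc1 gd1 ge_min c12.
- by rewrite lt_min gc2 gd2 ge_min c22.
move=> u qu; have [u1 u2] := qu.
set w := wmin _ _ * wmin _ _.
have wge : wmin c1 u.1 * wmin c2 u.2 <= w /\ wmin d1 u.1 * wmin d2 u.2 <= w.
  split; apply: ler_pM; rewrite ?wmin_ge0 ?(ltW u1) ?(ltW u2)//; apply: wmin_antitone => //;
    by rewrite ?le1 ?le2 /= ge_min lexx ?orbT.
have msq (n : signed_measure R) : measurable_fun setT (fun x => (mass n (x, u) ^+ 2)%:E).
  apply/measurable_EFinP; apply: measurable_funX.
  exact: (measurableT_comp (measurable_mass n) (measurable_pair2 u)).
have mZ (c : R) (n : signed_measure R) :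
    measurable_fun setT (fun x => c%:E * (mass n (x, u) ^+ 2)%:E)%E by exact: measurable_funeM.
apply: (@le_trans _ _ (\int[leb2]_x ((2 * a ^+ 2)%:E * (mass mu (x, u) ^+ 2)%:E +
   (2 * b ^+ 2)%:E * (mass nu (x, u) ^+ 2)%:E))%E).
  apply: ge0_le_integral => //.
  - by move=> x _; rewrite lee_fin sqr_ge0.
  - by apply: emeasurable_funD; exact: mZ.
  move=> x _; rewrite -!EFinM -EFinD lee_fin mass_combination.
  have := sqr_ge0 (a * mass mu (x, u) - b * mass nu (x, u)).
  by rewrite -subr_ge0 => h; rewrite -subr_ge0; apply: (le_trans h); rewrite le_eqVlt; apply/orP; left; apply/eqP; ring.
rewrite ge0_integralD//; last 2 first.
- by move=> x _; rewrite -EFinM lee_fin; apply: mulr_ge0 => //; exact: sqr_ge0.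
- by move=> x _; rewrite -EFinM lee_fin; apply: mulr_ge0 => //; exact: sqr_ge0.
rewrite !ge0_integralZl_EFin//; try by move=> x _; rewrite lee_fin sqr_ge0.
apply: (@le_trans _ _ ((2 * a ^+ 2)%:E * (C * w)%:E + (2 * b ^+ 2)%:E * (D * w)%:E)%E).
  apply: leeD; apply: lee_wpmul2l; rewrite ?lee_fin//.
    apply: (le_trans (hC _ qu)); rewrite lee_fin ler_wpM2l ?(ltW C0)//; exact: wge.1.
  apply: (le_trans (hD _ qu)); rewrite lee_fin ler_wpM2l ?(ltW D0)//; exact: wge.2.
have w0 : 0 <= w by rewrite mulr_ge0 ?wmin_ge0 ?(ltW u1) ?(ltW u2).
rewrite -!EFinM -EFinD lee_fin.
by rewrite [leRHS]mulrDl mul1r [in leRHS]mulrDl !mulrA lerDl.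
Qed.

(** Built from the binary combinations of [linear_field].  The empty combination
    is 0 czero + 0 czero and not czero, so that linearity applies to it. *)
Fixpoint combination (n : nat) : ('I_n -> signed_measure R) -> ('I_n -> R) -> signed_measure R :=
  match n with
  | 0 => fun _ _ => cadd (cscale 0 czero) (cscale 0 czero)
  | n'.+1 => fun t a => cadd (cscale (a ord0) (t ord0))
      (cscale 1 (combination (fun i => t (lift ord0 i)) (fun i => a (lift ord0 i))))
  end.

Lemma M_combinations n (t : 'I_n -> signed_measure R) (a : 'I_n -> R) :
  (forall i, M gamma1 gamma2 (t i)) -> M gamma1 gamma2 (combination t a).
Proof.
elim: n t a => [|n IH] t a ht /=; apply: M_combination => //; try exact: M_czero.
exact: IH.
Qed.

(** The exceptional set depends on the combination, but there are only finitely
    many steps.  The lemma is applied both to the centred Poisson field and to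
    the Gaussian field. *)
Lemma linear_field_combination d (Omega : measurableType d) (P : probability Omega R)
    (W : signed_measure R -> Omega -> R) : linear_field P (M gamma1 gamma2) W ->
  forall n (t : 'I_n -> signed_measure R) (a : 'I_n -> R), (forall i, M gamma1 gamma2 (t i)) ->
  {ae P, forall w, W (combination t a) w = \sum_(i < n) a i * W (t i) w}.
Proof.
move=> lW; elim => [|n IH] t a ht /=.
  apply: filterS (lW 0 0 _ _ M_czero M_czero) => w ->.
  by rewrite big_ord0 !mul0r addr0.
have hM := M_combinations (fun i => a (lift ord0 i)) (fun i => ht (lift ord0 i)).
apply: filterS2 (lW (a ord0) 1 _ _ (ht ord0) hM)
  (IH _ (fun i => a (lift ord0 i)) (fun i => ht (lift ord0 i))) => w -> ->.
by rewrite big_ord_recl mul1r.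
Qed.

End combinations.

(** * Convergence of the finite-dimensional distributions *)

Section finite_dimensional_limit.
Context {R : realType} (gamma1 gamma2 : R).
Hypothesis hgamma1 : 1 < gamma1 < 2.
Hypothesis hgamma2 : 1 < gamma2 < 2.
Context (f1 f2 : R -> R).
Hypothesis hf1 : edge_density gamma1 f1.
Hypothesis hf2 : edge_density gamma2 f2.
Context (F : probability (plane R) R).
Hypothesis hF : has_product_density F f1 f2.
Context (lambda : R -> R).
Hypothesis hlambda : forall rho : R, 0 < rho -> 0 < lambda rho.
Context (dO : R -> measure_display) (Omega : forall rho, measurableType (dO rho)).
Context (P : forall rho, probability (Omega rho) R).
Context (N : forall rho, Omega rho -> {measure set (plane R * plane R) -> \bar R}).
Arguments N : clear implicits.
Hypothesis hN : forall rho : R, 0 < rho ->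
  poisson_random_measure (P rho) (intensity (lambda rho) F rho) (N rho).
Hypothesis hlambda_rho_oo :
  lambda rho * rho `^ (gamma1 + gamma2) @[rho --> 0^'+] --> +oo.
Context (d : measure_display) (OmegaZ : measurableType d) (PZ : probability OmegaZ R).
Context (Z : signed_measure R -> {RV PZ >-> R}).
Hypothesis gaussian_Z : gaussian_field PZ (M gamma1 gamma2) (fun mu => Z mu : OmegaZ -> R).
Hypothesis linear_Z : linear_field PZ (M gamma1 gamma2) (fun mu => Z mu : OmegaZ -> R).
Hypothesis mean_Z : forall mu, M gamma1 gamma2 mu -> ('E_PZ[Z mu] = 0)%E.
Hypothesis cov_Z : forall mu nu, M gamma1 gamma2 mu -> M gamma1 gamma2 nu ->
  covariance PZ (Z mu) (Z nu) = C_Z gamma1 gamma2 mu nu.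
Context (n : nat) (t : 'I_n -> signed_measure R).
Hypothesis ht : forall i, M gamma1 gamma2 (t i).

Let gt1 : 1 < gamma1. Proof. by case/andP : hgamma1. Qed.
Let gt2 : 1 < gamma2. Proof. by case/andP : hgamma2. Qed.

Let Y (w : OmegaZ) : 'rV[R]_n := \row_(i < n) Z (t i) w.

(** The field is defined only for rho > 0; elsewhere it is replaced by 0 so that
    measurability and integrability hold for all rho. *)
Let X (rho : R) (w : Omega rho) : 'rV[R]_n :=
  if 0 < rho then
    \row_(i < n) (J_centred (P rho) (N rho) (t i) w / scale gamma1 gamma2 lambda rho)
  else 0.
Arguments X : clear implicits.

Let measurable_Z mu : measurable_fun setT (Z mu : OmegaZ -> R).
Proof. by move=> mT A mA; exact: (measurable_funPT (Z mu)). Qed.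

Let measurable_Y (k : 'I_n) : measurable_fun setT (fun w => Y w 0 k).
Proof.
rewrite (_ : (fun w => _) = (Z (t k) : OmegaZ -> R)); first exact: measurable_Z.
by apply/funext => w; rewrite /Y mxE.
Qed.

Let measurable_X (rho : R) (k : 'I_n) : measurable_fun setT (fun w => X rho w 0 k).
Proof.
have [r0|r0] := ltP 0 rho; last first.
  rewrite (_ : (fun w => _) = cst 0); first exact: measurable_cst.
  by apply/funext => w; rewrite /X ltNge r0 /= mxE.
have [m [mE hm]] := intensity_measure F rho (hlambda r0).
have hNm : poisson_random_measure (P rho) m (N rho) by rewrite mE; exact: hN.
have mJ := measurable_J_centred hf1 hf2 hF (hlambda r0) r0 hm hNm (t k).
rewrite (_ : (fun w => _) = fun w => J_centred (P rho) (N rho) (t k) w *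
    (scale gamma1 gamma2 lambda rho)^-1).
  by apply: measurable_funM => //; exact: measurable_cst.
by apply/funext => w; rewrite /X r0 mxE.
Qed.

(** A linear combination of the coordinates is almost surely Z(nu) for the
    combined charge nu, and Z(nu) is Gaussian with variance C_Z(nu,nu). *)
Let exp_Y (a : 'rV[R]_n) (nu := combination t (fun i => a 0 i)) :
  PZ.-integrable setT (EFin \o (fun w => expR (dot a (Y w)))) /\
  \int[PZ]_w expR (dot a (Y w)) = expR (limit_variance gamma1 gamma2 nu / 2).
Proof.
have hnu : M gamma1 gamma2 nu by exact: M_combinations.
have gnu : gaussian PZ (Z nu).
  have := gaussian_Z (t := fun _ : 'I_1 => nu) (fun=> 1) (fun=> hnu).
  by rewrite (_ : (fun w => _) = (Z nu : OmegaZ -> R))//; apply/funext => w; rewrite big_ord1 mul1r.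
have vnu : covariance PZ (Z nu) (Z nu) = (limit_variance gamma1 gamma2 nu)%:E.
  by rewrite cov_Z// C_Z_diag// (limit_varianceE hf1 hf2 hnu).
have [ie ee] := gaussian_mgf gnu (mean_Z hnu) vnu 1.
have [|||iY <-] := @ae_eq_mean R _ _ PZ (fun w => expR (1 * Z nu w)) (fun w => expR (dot a (Y w))).
- by apply: measurableT_comp => //; exact: measurable_dot.
- apply: filterS (linear_field_combination hgamma1 hgamma2 linear_Z (fun i => a 0 i) ht) => w e.
  by rewrite mul1r e /dot; congr expR; apply: eq_bigr => i _; rewrite /Y mxE.
- exact: ie.
by split; rewrite // ee expr1n mul1r.
Qed.

(** The same reduction to the combined charge for the centred Poisson field. *)
Let exp_X (a : 'rV[R]_n) (nu := combination t (fun i => a 0 i)) (rho : R) : 0 < rho ->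
  (P rho).-integrable setT (EFin \o (fun w => expR (dot a (X rho w)))) /\
  \int[P rho]_w expR (dot a (X rho w)) =
  \int[P rho]_w expR ((scale gamma1 gamma2 lambda rho)^-1 * J_centred (P rho) (N rho) nu w).
Proof.
move=> r0.
have [m [mE hm]] := intensity_measure F rho (hlambda r0).
have hNm : poisson_random_measure (P rho) m (N rho) by rewrite mE; exact: hN.
have [ie _] := J_centred_mgf hf1 hf2 hF (hlambda r0) r0 hm hNm nu (scale gamma1 gamma2 lambda rho)^-1.
have lJ := @J_centred_linear _ _ _ _ _ hf1 hf2 _ hF _ _ (hlambda r0) r0 _ hm _ _ _ _ hNm (M gamma1 gamma2).
have [|||iX <-] := @ae_eq_mean R _ _ (P rho)
  (fun w => expR ((scale gamma1 gamma2 lambda rho)^-1 * J_centred (P rho) (N rho) nu w))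
  (fun w => expR (dot a (X rho w))).
- by apply: measurableT_comp => //; exact: measurable_dot.
- apply: filterS (linear_field_combination hgamma1 hgamma2 lJ (fun i => a 0 i) ht) => w e.
  rewrite e /dot mulr_sumr; congr expR; apply: eq_bigr => i _.
  by rewrite /X r0 mxE mulrCA [(_)^-1 * _]mulrC.
- exact: ie.
by split.
Qed.

Lemma exp_moments_cvg (a : 'rV[R]_n) :
  mean_cvg 0^'+ P PZ (fun rho w => expR (dot a (X rho w))) (fun w => expR (dot a (Y w))).
Proof.
have [iY eY] := exp_Y a; split => //.
  move=> rho; have [r0|r0] := ltP 0 rho; first exact: (exp_X a r0).1.
  rewrite (_ : _ \o _ = EFin \o cst 1); first exact: finite_measure_integrable_cst.
  apply/funext => w; rewrite /= /X ltNge r0 /= /dot big1 ?expR0// => i _.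
  by rewrite mxE mulr0.
rewrite eY.
have hnu : M gamma1 gamma2 (combination t (fun i => a 0 i)) by exact: M_combinations.
have h := J_centred_mgf_cvg gt1 gt2 hf1 hf2 hF hlambda hN hlambda_rho_oo hnu.
apply: cvg_trans h; apply: near_eq_cvg; near=> rho.
have r0 : 0 < rho by near: rho; exact: nbhs_right_gt.
by rewrite (exp_X a r0).2.
Unshelve. all: by end_near. Qed.

Lemma finite_dimensional_cvg :
  cvg_in_distribution P PZ (fun rho w => \row_(i < n) (J_centred (P rho) (N rho) (t i) w /
    Num.sqrt (lambda rho * rho `^ (gamma1 + gamma2)))) 0^'+ Y.
Proof.
move=> g cg gK.
have [iX iY c] := mean_cvg_bounded_continuous measurable_X measurable_Y exp_moments_cvg cg gK.
have Emean d' (T : measurableType d') (Q : probability T R) (U : T -> R) :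
    Q.-integrable setT (EFin \o U) -> ('E_Q[U])%E = (\int[Q]_w U w)%:E.
  by move=> iU; rewrite unlock /Rintegral fineK//; exact: integrable_fin_num.
rewrite (Emean _ _ _ _ iY).
have h : (\int[P rho]_w g (X rho w))%:E @[rho --> 0^'+] --> (\int[PZ]_w g (Y w))%:E.
  by apply: cvg_EFin => //; exact: nearW.
apply: cvg_trans h; apply: near_eq_cvg; near=> rho.
have r0 : 0 < rho by near: rho; exact: nbhs_right_gt.
rewrite -Emean//; congr ('E_(P rho)[_])%E; apply/funext => w /=.
by rewrite /X r0.
Unshelve. all: by end_near. Qed.

End finite_dimensional_limit.

Theorem theorem2 (R : realType) (gamma1 gamma2 : R)
  (hgamma1 : 1 < gamma1 < 2) (hgamma2 : 1 < gamma2 < 2)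
  (hgamma : gamma1 < gamma2)
  (f1 f2 : R -> R)
  (hf1 : edge_density gamma1 f1) (hf2 : edge_density gamma2 f2)
  (F : probability (plane R) R) (hF : has_product_density F f1 f2)
  (lambda : R -> R) (hlambda : forall rho, 0 < rho -> 0 < lambda rho)
  (dO : R -> measure_display) (Omega : forall rho, measurableType (dO rho))
  (P : forall rho, probability (Omega rho) R)
  (N : forall rho, Omega rho -> {measure set (plane R * plane R) -> \bar R})
  (hN : forall rho, 0 < rho ->
     poisson_random_measure (P rho) (intensity (lambda rho) F rho) (N rho))
  (hlambda_oo : lambda rho @[rho --> 0^'+] --> +oo)
  (hlambda_rho_oo :
     lambda rho * rho `^ (gamma1 + gamma2) @[rho --> 0^'+] --> +oo) :
  (forall mu nu : signed_measure R, M gamma1 gamma2 mu -> M gamma1 gamma2 nu ->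
     (leb2 \x leb2)%E.-integrable rectangles (C_Z_integrand gamma1 gamma2 mu nu))
  /\
  (forall (d : measure_display) (OmegaZ : measurableType d)
     (PZ : probability OmegaZ R) (Z : signed_measure R -> {RV PZ >-> R}),
     gaussian_field PZ (M gamma1 gamma2) (fun mu => Z mu : OmegaZ -> R) ->
     linear_field PZ (M gamma1 gamma2) (fun mu => Z mu : OmegaZ -> R) ->
     (forall mu, M gamma1 gamma2 mu -> 'E_PZ[Z mu] = 0)%E ->
     (forall mu nu, M gamma1 gamma2 mu -> M gamma1 gamma2 nu ->
        covariance PZ (Z mu) (Z nu) = C_Z gamma1 gamma2 mu nu) ->
     cvg_fdd P PZ (M gamma1 gamma2)
       (fun rho mu w => J_centred (P rho) (N rho) mu w /
          Num.sqrt (lambda rho * rho `^ (gamma1 + gamma2)))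
       0^'+ (fun mu => Z mu : OmegaZ -> R)).
Proof.
split.
  move=> mu nu hmu hnu; exact: (C_Z_integrable hf1 hf2 hmu hnu).
move=> d OmegaZ PZ Z gZ lZ mZ cZ n t ht.
exact: (finite_dimensional_cvg hgamma1 hgamma2 hf1 hf2 hF hlambda hN hlambda_rho_oo gZ lZ mZ cZ ht).
Qed.
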